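(* Let $\alpha\in\mathbb R$. Then: (i) if $\alpha\le-3$, $\Delta|_{C_c^\infty(M)}$ is essentially self-adjoint on $L^2(M,d\omega)$; (ii) if $\alpha\in(-3,-1]$, then $\widehat\Delta_0$ is not essentially self-adjoint on $L^2(\mathbb R\setminus\{0\},|x|^{-\alpha}dx)$, while $\widehat\Delta_k$ is essentially self-adjoint for every $k\in\mathbb Z\setminus\{0\}$ (in particular $\Delta|_{C_c^\infty(M)}$ is not essentially self-adjoint); (iii) if $\alpha\in(-1,1)$, then $\widehat\Delta_k$ is not essentially self-adjoint for every $k\in\mathbb Z$; (iv) if $\alpha\ge1$, $\Delta|_{C_c^\infty(M)}$ is essentially self-adjoint.
   Context: Fix $\alpha\in\mathbb R$. Let $\mathbb T=\mathbb R/2\pi\mathbb Z$ and $M=(\mathbb R\setminus\{0\})\times\mathbb T$ with coordinates $(x,\theta)$, endowed with the Riemannian metric $g=dx^2+|x|^{-2\alpha}d\theta^2$, whose Riemannian volume is $d\omega=|x|^{-\alpha}\,dx\,d\theta$. The Laplace–Beltrami operator is $\Delta=\partial_x^2+|x|^{2\alpha}\partial_\theta^2-\frac{\alpha}{x}\partial_x$; $\Delta|_{C_c^\infty(M)}$ denotes this operator as an unbounded operator on the real Hilbert space $L^2(M,d\omega)$ with domain $C_c^\infty(M)$. For $k\in\mathbb Z$, the $k$-th Fourier component is $\widehat\Delta_k=\partial_x^2-\frac{\alpha}{x}\partial_x-k^2|x|^{2\alpha}$, an unbounded operator on $L^2(\mathbb R\setminus\{0\},|x|^{-\alpha}dx)$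 with domain $C_c^\infty(\mathbb R\setminus\{0\})$; via Fourier series in $\theta$, $L^2(M,d\omega)=\bigoplus_{k\in\mathbb Z}H_k$ with $H_k\cong L^2(\mathbb R\setminus\{0\},|x|^{-\alpha}dx)$, and $\Delta$ acts on $H_k$ as $\widehat\Delta_k$. (Essential self-adjointness on the real space is equivalent to that on the corresponding complex space.) *)

(* Defs.v *)
From HB Require Import structures.
From mathcomp Require Import all_boot all_order all_algebra.
From mathcomp Require Import all_classical all_reals all_analysis.
Set Implicit Arguments. Unset Strict Implicit. Unset Printing Implicit Defensive.
Import Order.TTheory GRing.Theory Num.Theory.
Import numFieldNormedType.Exports.
Local Open Scope classical_set_scope.
Local Open Scope ring_scope.

Section WeightedL2.
Context {d : measure_display} {T : measurableType d} {R : realType}.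
Variables (mu : {measure set T -> \bar R}) (D : set T) (w : T -> R).

Definition L2 (f : T -> R) : Prop :=
  measurable_fun D f /\
  (\int[mu]_(x in D) ((f x) ^+ 2 * w x)%:E < +oo)%E.

Definition ip (f g : T -> R) : R := Rintegral mu D (fun x => f x * g x * w x).

Definition nrm (f : T -> R) : R := Num.sqrt (ip f f).

(* operators are represented by their graphs, pairs of L^2 representatives;
   everything below is invariant under a.e. equality *)
Definition adjoint (G : set ((T -> R) * (T -> R))) : set ((T -> R) * (T -> R)) :=
  [set uv | L2 uv.1 /\ L2 uv.2 /\
     forall xy, G xy -> ip xy.2 uv.1 = ip xy.1 uv.2].

Definition closure_graph (G : set ((T -> R) * (T -> R))) : set ((T -> R) * (T -> R)) :=
  [set uv | L2 uv.1 /\ L2 uv.2 /\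
     forall e : R, 0 < e -> exists xy, G xy /\
        nrm (uv.1 \- xy.1) + nrm (uv.2 \- xy.2) < e].

Definition self_adjoint (G : set ((T -> R) * (T -> R))) : Prop := G = adjoint G.

Definition ess_self_adjoint (G : set ((T -> R) * (T -> R))) : Prop :=
  self_adjoint (closure_graph G).

Definition op_graph (Dom : set (T -> R)) (A : (T -> R) -> (T -> R)) :=
  [set (phi, A phi) | phi in Dom].
End WeightedL2.

Section Surface.
Context {R : realType}.

Definition dx (f : R * R -> R) : R * R -> R :=
  fun p => derive1 (fun y => f (y, p.2)) p.1.
Definition dth (f : R * R -> R) : R * R -> R :=
  fun p => derive1 (fun t => f (p.1, t)) p.2.

Fixpoint Ck2 (k : nat) (f : R * R -> R) : Prop :=
  match k with
  | 0 => continuous f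
  | k.+1 => [/\ continuous f,
               (forall p : R * R, derivable (fun y => f (y, p.2)) p.1 1),
               (forall p : R * R, derivable (fun t => f (p.1, t)) p.2 1),
               Ck2 k (dx f) & Ck2 k (dth f)]
  end.
Definition smooth2 (f : R * R -> R) := forall k, Ck2 k f.

(* C_c^infty(M): smooth, 2pi-periodic in theta (so it lives on T = R/2piZ),
   with support in {a <= |x| <= b} x T for some 0 < a <= b,
   i.e. compact support in M *)
Definition CcM (f : R * R -> R) : Prop :=
  [/\ smooth2 f,
      (forall x t, f (x, t + 2 * pi) = f (x, t)) &
      exists a b : R, 0 < a /\
        forall p : R * R, f p != 0 -> a <= `|p.1| <= b].

Definition Mdom : set (R * R) := [set p | p.1 != 0 /\ 0 <= p.2 < 2 * pi].

(* density of the Riemannian volume d omega = |x|^{-alpha} dx dtheta *)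
Definition Mweight (alpha : R) (p : R * R) : R := `|p.1| `^ (- alpha).

Definition Mmeasure := ((@lebesgue_measure R) \x (@lebesgue_measure R))%E.

Definition LB (alpha : R) (f : R * R -> R) : R * R -> R :=
  fun p => dx (dx f) p + `|p.1| `^ (2 * alpha) * dth (dth f) p
           - alpha / p.1 * dx f p.

Definition LB_graph (alpha : R) := op_graph CcM (LB alpha).

Definition LB_ess_sa (alpha : R) : Prop :=
  ess_self_adjoint Mmeasure Mdom (Mweight alpha) (LB_graph alpha).

Fixpoint Ck1 (k : nat) (f : R -> R) : Prop :=
  match k with
  | 0 => continuous f
  | k.+1 => [/\ continuous f, (forall x : R, derivable f x 1) & Ck1 k (derive1 f)]
  end.
Definition smooth1 (f : R -> R) := forall k, Ck1 k f.

Definition Cc1 (f : R -> R) : Prop :=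
  smooth1 f /\ exists a b : R, 0 < a /\ forall x, f x != 0 -> a <= `|x| <= b.

Definition Rdom : set R := [set x | x != 0].
Definition Rweight (alpha : R) (x : R) : R := `|x| `^ (- alpha).

Definition LBk (alpha : R) (k : int) (f : R -> R) : R -> R :=
  fun x => derive1 (derive1 f) x - alpha / x * derive1 f x
           - (k%:~R) ^+ 2 * `|x| `^ (2 * alpha) * f x.

Definition LBk_graph (alpha : R) (k : int) := op_graph Cc1 (LBk alpha k).

Definition LBk_ess_sa (alpha : R) (k : int) : Prop :=
  ess_self_adjoint (@lebesgue_measure R) Rdom (Rweight alpha) (LBk_graph alpha k).
End Surface.

(* Main.v *)
Require Import Defs.
From HB Require Import structures.
From mathcomp Require Import all_boot all_order all_algebra.
From mathcomp Require Import all_classical all_reals all_analysis.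
From mathcomp Require Import measurable_realfun ring lra.
Set Implicit Arguments. Unset Strict Implicit. Unset Printing Implicit Defensive.
Import Order.TTheory GRing.Theory Num.Theory.
Import numFieldNormedType.Exports.
Local Open Scope classical_set_scope.
Local Open Scope ring_scope.
(* A symmetric nonpositive operator A is essentially self-adjoint as soon as A - 1 has dense range,
   i.e. as soon as no nonzero u in L^2 is orthogonal to the range of A - 1.  For A = Delta_k such
   a u solves u'' - (alpha / x) u' = (k^2 |x|^(2 alpha) + 1) u weakly, hence classically, on each
   half-line, so g = |x|^(-alpha / 2) u lies in L^2(dx) and satisfies g'' = V g with
   V = alpha (alpha + 2) / (4 x^2) + k^2 |x|^(2 alpha) + 1.  Integrability at infinity forces
   g g' <= 0.  If V >= 3 / (4 x^2) near 0, which is the case when alpha <= -3, when alpha >= 1, and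
   when alpha <= -1 and k <> 0, then comparison with x^(3/2) shows that a nonzero g is not square
   integrable at 0.  For A = Delta the Fourier coefficients of u in theta satisfy these equations.

   If -3 < alpha < 1, and k = 0 or alpha > -1, then h'' - (alpha / x) h' = k^2 x^(2 alpha) h has
   two solutions that are square integrable at 0+ and have nonzero Wronskian.  Multiplied by
   a cutoff and extended by 0 to x < 0, they lie in the domain of the adjoint, which is therefore
   not symmetric.  For k = 0 the same functions, constant in theta, serve for Delta. *)

(** * Weighted L2 spaces and self-adjointness *)

(** The number 3/4 is the borderline of the Euler equation: [g'' = (c / x^2) g] has the solutions
    [x^s] with [s (s - 1) = c], and c = 3/4 gives x^(3/2) and x^(-1/2), the latter just failing to
    be square integrable at 0. The condition alpha (alpha + 2) / 4 >= 3/4 reads (alpha + 3) (alpha -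
    1) >= 0, whence the thresholds -3 and 1. For alpha <= -1 this term is still at least -1/4, and
    k^2 |x|^(2 alpha) >= x^(-2) near 0 supplies exactly the missing 1. Elements of L^2 are
    functions, not classes, so the norm is a seminorm, and completeness and projection are argued on
    representatives. A kernel element is only locally integrable; its regularity comes from
    integrating twice the divergence form (x^(-alpha) u')' = x^(-alpha) q u. Likewise the return
    from Fourier coefficients to u needs uniqueness for merely integrable functions, obtained from
    trigonometric polynomials that converge to indicators of arcs. In the negative cases the cutoff
    is (1 - x^2)^2 on ]0, 1]: its double zero at 1 removes every boundary term there, and what
    remains is the Wronskian at 0. *)

Section WeightedL2Theory.
Context {d : measure_display} {T : measurableType d} {R : realType}.
Variables (mu : {measure set T -> \bar R}) (D : set T) (w : T -> R).
Hypothesis mD : measurable D.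
Hypothesis mw : measurable_fun D w.
Hypothesis w_gt0 : forall x, D x -> 0 < w x.
Implicit Types f g h u v : T -> R.
Notation L2 := (L2 mu D w).
Notation ip := (ip mu D w).
Notation nrm := (nrm mu D w).

Lemma L2_sq_integrable f : L2 f ->
  mu.-integrable D (EFin \o (fun x => f x ^+ 2 * w x)).
Proof.
move=> [mf fo]; apply/integrableP; split.
  by apply/measurable_EFinP/measurable_funM => //; exact: measurable_funX.
under eq_integral => x xD.
  rewrite /= ger0_norm; last first.
    by rewrite mulr_ge0 ?sqr_ge0// ltW// w_gt0// -inE.
  over.
exact: fo.
Qed.

Lemma sq_integrable_L2 f : measurable_fun D f ->
  mu.-integrable D (EFin \o (fun x => f x ^+ 2 * w x)) -> L2 f.
Proof. by move=> mf /integrable_lty fo; split => //; exact: fo. Qed.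

(** Dominated pointwise through [|f g| <= f^2 + g^2]. *)
Lemma L2_mul_integrable f g : L2 f -> L2 g ->
  mu.-integrable D (EFin \o (fun x => f x * g x * w x)).
Proof.
move=> Lf Lg; have if2 := L2_sq_integrable Lf; have ig2 := L2_sq_integrable Lg.
apply: (le_integrable mD _ _ (integrableD mD if2 ig2)).
  apply/measurable_EFinP/measurable_funM => //.
  by apply: measurable_funM; [case: Lf | case: Lg].
move=> x Dx /=; rewrite lee_fin.
have wx := w_gt0 Dx.
rewrite -mulrDl !normrM (gtr0_norm wx) ler_pM2r// -normrM.
rewrite [leRHS]ger0_norm ?addr_ge0 ?sqr_ge0//.
rewrite ler_norml; apply/andP; split.
  by have := sqr_ge0 (f x + g x); have := sqr_ge0 (f x); have := sqr_ge0 (g x); nra.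
by have := sqr_ge0 (f x - g x); have := sqr_ge0 (f x); have := sqr_ge0 (g x); nra.
Qed.

Lemma L2_lin a f g : L2 f -> L2 g -> L2 (fun x => a * f x + g x).
Proof.
move=> Lf Lg.
apply: sq_integrable_L2.
  apply: measurable_funD; last by case: Lg.
  by apply: measurable_funM => //; case: Lf.
have h := integrableD mD (integrableD mD
  (integrableZl mD (a ^+ 2) (L2_sq_integrable Lf))
  (integrableZl mD (2 * a) (L2_mul_integrable Lf Lg))) (L2_sq_integrable Lg).
apply: eq_integrable h => // x _ /=.
by rewrite -!EFinM -!EFinD; congr EFin; ring.
Qed.

Lemma L2_cst0 : L2 (fun=> 0).
Proof.
split; first exact: measurable_cst.
by under eq_integral do rewrite expr0n mul0r; rewrite integral0.
Qed.

Lemma L2D f g : L2 f -> L2 g -> L2 (f \+ g).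
Proof.
move=> Lf Lg; have := L2_lin 1 Lf Lg.
by rewrite (_ : (fun x => _) = f \+ g)//; apply/funext => x /=; rewrite mul1r.
Qed.

Lemma L2Z a f : L2 f -> L2 (fun x => a * f x).
Proof.
move=> Lf; have := L2_lin a Lf L2_cst0.
by rewrite (_ : (fun x => _) = (fun x => a * f x))//; apply/funext => x /=; rewrite addr0.
Qed.

Lemma L2B f g : L2 f -> L2 g -> L2 (f \- g).
Proof.
move=> Lf Lg; have := L2_lin (-1) Lg Lf.
by rewrite (_ : (fun x => _) = f \- g)//; apply/funext => x /=; ring.
Qed.

Lemma ipC f g : ip f g = ip g f.
Proof. by apply: eq_Rintegral => x _; rewrite (mulrC (f x)). Qed.

Lemma ip_linl a f g h : L2 f -> L2 g -> L2 h ->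
  ip (fun x => a * f x + g x) h = a * ip f h + ip g h.
Proof.
move=> Lf Lg Lh; have ifh := L2_mul_integrable Lf Lh.
rewrite /ip -RintegralZl// -RintegralD//; last exact: L2_mul_integrable.
  by apply: eq_Rintegral => x _; ring.
exact: (integrableZl mD a ifh).
Qed.

Lemma ip_linr a f g h : L2 f -> L2 g -> L2 h ->
  ip h (fun x => a * f x + g x) = a * ip h f + ip h g.
Proof. by move=> *; rewrite ipC ip_linl// (ipC f) (ipC g). Qed.

Lemma ipBl f g h : L2 f -> L2 g -> L2 h -> ip (f \- g) h = ip f h - ip g h.
Proof.
move=> Lf Lg Lh; have := ip_linl (-1) Lg Lf Lh.
rewrite mulN1r addrC => <-; congr Defs.ip; apply/funext => x /=; ring.
Qed.

Lemma ipBr f g h : L2 f -> L2 g -> L2 h -> ip h (f \- g) = ip h f - ip h g.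
Proof. by move=> *; rewrite ipC ipBl// (ipC f) (ipC g). Qed.

Lemma ip_ge0 f : 0 <= ip f f.
Proof.
apply: Rintegral_ge0 => x Dx.
by rewrite mulr_ge0 ?(ltW (w_gt0 _))// -expr2 sqr_ge0.
Qed.

Lemma EFin_ip f : L2 f -> ((ip f f)%:E = \int[mu]_(x in D) (f x ^+ 2 * w x)%:E)%E.
Proof.
move=> Lf; rewrite /ip /Rintegral fineK; last first.
  by apply: integrable_fin_num => //; exact: L2_mul_integrable.
by apply: eq_integral => x _; rewrite expr2.
Qed.

Lemma ip_sub_scale t f g : L2 f -> L2 g ->
  ip (fun x => t * g x + f x) (fun x => t * g x + f x) =
  ip f f + 2 * t * ip f g + t ^+ 2 * ip g g.
Proof.
move=> Lf Lg; have L := L2_lin t Lg Lf.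
by rewrite ip_linl// !ip_linr// (ipC g f); ring.
Qed.

Lemma cauchy_schwarz f g : L2 f -> L2 g -> ip f g ^+ 2 <= ip f f * ip g g.
Proof.
move=> Lf Lg; have q t : 0 <= ip f f + 2 * t * ip f g + t ^+ 2 * ip g g.
  by rewrite -ip_sub_scale// ip_ge0.
have [gz|gz] := eqVneq (ip g g) 0.
  suff -> : ip f g = 0 by rewrite expr0n gz mulr0.
  apply/eqP; apply: contraT => b0.
  (* With [ip g g = 0] the quadratic is affine in [t], and this [t] gives it the value -1. *)
  have := q (- (ip f f + 1) / (2 * ip f g)); rewrite gz.
  have -> : ip f f + 2 * (- (ip f f + 1) / (2 * ip f g)) * ip f g +
    (- (ip f f + 1) / (2 * ip f g)) ^+ 2 * 0 = -1 by field.
  by lra.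
have gp : 0 < ip g g by rewrite lt_def gz ip_ge0.
have := q (- ip f g / ip g g).
have -> : ip f f + 2 * (- ip f g / ip g g) * ip f g +
    (- ip f g / ip g g) ^+ 2 * ip g g = ip f f - ip f g ^+ 2 / ip g g by field.
by rewrite subr_ge0 ler_pdivrMr.
Qed.

Lemma nrm_ge0 f : 0 <= nrm f. Proof. exact: sqrtr_ge0. Qed.

Lemma nrm_sq f : nrm f ^+ 2 = ip f f.
Proof. by rewrite sqr_sqrtr// ip_ge0. Qed.

Lemma ip_le_nrm f g : L2 f -> L2 g -> `|ip f g| <= nrm f * nrm g.
Proof.
move=> Lf Lg; rewrite -ler_sqr ?nnegrE ?mulr_ge0 ?nrm_ge0// real_normK ?num_real//.
by rewrite exprMn !nrm_sq cauchy_schwarz.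
Qed.

Lemma nrmD f g : L2 f -> L2 g -> nrm (f \+ g) <= nrm f + nrm g.
Proof.
move=> Lf Lg; rewrite -ler_sqr ?nnegrE ?addr_ge0 ?nrm_ge0//.
have -> : f \+ g = fun x => 1 * g x + f x.
  by apply/funext => x /=; rewrite mul1r addrC.
rewrite nrm_sq ip_sub_scale// sqrrD !nrm_sq.
have := ip_le_nrm Lf Lg; rewrite ler_norml => /andP[_]; lra.
Qed.

Lemma nrmN f : nrm (\- f) = nrm f.
Proof.
by rewrite /nrm /ip; congr Num.sqrt; apply: eq_Rintegral => x _ /=; ring.
Qed.

Lemma ip0l u : ip (fun=> 0) u = 0.
Proof.
rewrite /ip /Rintegral; under eq_integral do rewrite !mul0r.
by rewrite integral0.
Qed.

Lemma ipZl a u v : L2 u -> L2 v -> ip (fun x => a * u x) v = a * ip u v.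
Proof.
move=> Lu Lv; have := ip_linl a Lu L2_cst0 Lv; rewrite ip0l addr0 => <-.
by congr Defs.ip; apply/funext => x; rewrite addr0.
Qed.

(** Written with the midpoint, so that minimality of a distance bounds the subtracted term from
    below. *)
Lemma parallelogram f g : L2 f -> L2 g ->
  ip (f \- g) (f \- g) =
  2 * ip f f + 2 * ip g g - 4 * ip (fun x => 2^-1 * (f x + g x)) (fun x => 2^-1 * (f x + g x)).
Proof.
move=> Lf Lg.
have -> : (fun x => 2^-1 * (f x + g x)) = (fun x => 2^-1 * g x + 2^-1 * f x).
  by apply/funext => x; ring.
have -> : (f \- g) = (fun x => -1 * g x + f x).
  by apply/funext => x /=; ring.
rewrite !ip_sub_scale//; last exact: L2Z.
rewrite !ipZl//; last exact: L2Z.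
by rewrite (ipC f (fun x => 2^-1 * f x)) ipZl//; field.
Qed.

Let sqw_ge0 x (y : R) : D x -> 0 <= y ^+ 2 * w x.
Proof. by move=> Dx; rewrite mulr_ge0 ?sqr_ge0// ltW ?w_gt0. Qed.

Let wsqw_ge0 n x (y : R) : D x -> 0 <= 4 ^+ n * (y ^+ 2 * w x).
Proof. by move=> Dx; rewrite mulr_ge0 ?sqw_ge0// exprn_ge0. Qed.

(** Completeness for a geometric rate. The sum of [4^n (r (n+1) - r n)^2 w] has finite integral,
    hence is finite almost everywhere; there [|r (n+1) x - r n x|] is O(2^-n) and [r n x] converges.
    Fatou's lemma then carries the bound over to the limit. *)
Lemma L2_limit (r : nat -> T -> R) : (forall n, L2 (r n)) ->
  (forall n m, (n <= m)%N -> ip (r m \- r n) (r m \- r n) <= 16^-1 ^+ n) ->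
  exists2 u, L2 u & forall n, ip (u \- r n) (u \- r n) <= 16^-1 ^+ n.
Proof.
move=> Lr rc.
pose g n x := (4 ^+ n * ((r n.+1 x - r n x) ^+ 2 * w x))%:E.
have LB' n m : L2 (r m \- r n) by apply: L2B.
have mg n : measurable_fun D (g n).
  apply/measurable_EFinP/measurable_funM => //; apply: measurable_funM => //.
  by apply: measurable_funX; case: (LB' n n.+1).
have g0 n x : D x -> (0 <= g n x)%E.
  by move=> Dx; rewrite lee_fin; exact: wsqw_ge0.
have ig n : (\int[mu]_(x in D) g n x = (4 ^+ n * ip (r n.+1 \- r n) (r n.+1 \- r n))%:E)%E.
  rewrite EFinM EFin_ip// -ge0_integralZl//.
  - by apply: (measurable_int mu); exact: L2_sq_integrable (LB' n n.+1).
  - by move=> x Dx; rewrite lee_fin; exact: sqw_ge0.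
have gfin : (\int[mu]_(x in D) (\sum_(n <oo) g n x) < +oo)%E.
  rewrite integral_nneseries//.
  (* Here 4^n 16^-n = 4^-n, which is at most 2^-n = 2 / 2^(n+1), a term of a summable series. *)
  apply: (@le_lt_trans _ _ (\sum_(n <oo) (2 / (2 ^ n.+1)%:R)%:E)%E); last first.
    by apply: le_lt_trans (epsilon_trick0 _ _) _; rewrite ?ltry.
  apply: lee_nneseries => [n _ _|n _]; first exact: integral_ge0 (g0 n).
  rewrite [leLHS]ig lee_fin.
  apply: le_trans (ler_wpM2l (exprn_ge0 _ _) (rc n n.+1 (leqnSn n))) _ => //.
  rewrite -exprMn expnS natrM natrX invfM mulrA divff// mul1r -exprVn.
  have -> : 4 * 16^-1 = 4^-1 :> R by field.
  by apply: lerXn2r; rewrite ?nnegrE ?invr_ge0// lef_pV2 ?posrE// ler_nat.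
have mG : measurable_fun D (fun x => \sum_(n <oo) g n x)%E.
  by apply: (@ge0_emeasurable_sum _ _ _ D g xpredT) => // k x Dx _; exact: g0.
have iG : mu.-integrable D (fun x => \sum_(n <oo) g n x)%E.
  apply/integrableP; split => //.
  apply: le_lt_trans gfin; rewrite le_eqVlt; apply/orP; left; apply/eqP.
  apply: eq_integral => x; rewrite inE => Dx; rewrite gee0_abs//.
  by apply: nneseries_ge0 => n _ _; exact: g0.
have [N [mN N0 subN]] := integrable_ae mD iG.
pose E := D `\` N.
have mE : measurable E by exact: measurableD.
have cvr x : E x -> cvgn (r ^~ x).
  move=> [Dx nNx].
  have fG : (\sum_(n <oo) g n x)%E \is a fin_num.
    by apply: contrapT => H; apply: nNx; apply: subN => /= /(_ Dx).
  set M := fine (\sum_(n <oo) g n x)%E.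
  have wx := w_gt0 Dx.
  have bnd n : `|r n.+1 x - r n x| <= Num.sqrt (M / w x) * 2^-1 ^+ n.
    have : (g n x <= M%:E)%E.
      rewrite fineK// (@nneseriesD1 _ _ n)//; last by move=> *; exact: g0.
      by rewrite leeDl// nneseries_ge0// => k _ _; exact: g0.
    rewrite lee_fin => gM.
    rewrite -ler_sqr ?nnegrE ?mulr_ge0 ?sqrtr_ge0 ?exprn_ge0//.
    have M0 : 0 <= M.
      by apply: le_trans gM; exact: wsqw_ge0.
    rewrite real_normK ?num_real// exprMn sqr_sqrtr ?divr_ge0 ?(ltW wx)//.
    rewrite -exprM mulnC exprM mulrAC ler_pdivlMr//.
    have -> : (2^-1 ^+ 2 : R) = 4^-1 by field.
    rewrite exprVn ler_pdivlMr ?exprn_gt0//.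
    by rewrite mulrC.
  have -> : r ^~ x = (fun n => r 0%N x + series (telescope (r ^~ x)) n).
    by apply/funext => n; exact: eq_sum_telescope.
  apply: is_cvgD; first exact: is_cvg_cst.
  apply: normed_cvg; apply: series_le_cvg bnd _ => [n|n|].
  - by [].
  - by rewrite mulr_ge0 ?sqrtr_ge0 ?exprn_ge0.
  - by apply: is_cvg_geometric_series; rewrite ger0_norm//; lra.
(* Replacing [r n] by 0 on the null set makes the sequence converge at every point of [D], so the
   limit is measurable. *)
pose rE n x := r n x * \1_E x.
pose u x := limn (rE ^~ x).
have cvu x : D x -> rE ^~ x @ \oo --> u x.
  move=> Dx; have [xE|xE] := boolP (x \in E).
    have -> : rE ^~ x = r ^~ x.
      by apply/funext => n; rewrite /rE indicE xE /= mulr1.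
    suff -> : u x = limn (r ^~ x) by apply: cvr; rewrite -inE.
    by rewrite /u /rE indicE xE; under eq_fun do rewrite mulr1.
  by rewrite /u /rE indicE (negPf xE); under eq_fun do rewrite mulr0;
     rewrite lim_cst//; exact: cvg_cst.
have uE x : E x -> r ^~ x @ \oo --> u x.
  move=> Ex; have := cvu x (proj1 Ex); rewrite /rE indicE mem_set//.
  by under eq_fun do rewrite mulr1.
have mu_ : measurable_fun D u.
  apply: measurable_fun_cvg cvu => n; apply: measurable_funM; first by case: (Lr n).
  exact: measurable_funTS.
have bound n : (\int[mu]_(x in D) ((u x - r n x) ^+ 2 * w x)%:E <= (16^-1 ^+ n)%:E)%E.
  have mh m : measurable_fun D (fun x => ((r m x - r n x) ^+ 2 * w x)%:E).
    apply/measurable_EFinP/measurable_funM => //; apply: measurable_funX.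
    by case: (LB' n m).
  rewrite (@ge0_negligible_integral _ _ _ mu D N)//; first last.
  - by move=> x Dx; rewrite lee_fin; exact: sqw_ge0.
  - apply/measurable_EFinP/measurable_funM => //; apply: measurable_funX.
    by apply: measurable_funB => //; case: (Lr n).
  rewrite -/E.
  have -> : (\int[mu]_(x in E) ((u x - r n x) ^+ 2 * w x)%:E =
     \int[mu]_(x in E) limn_einf (fun m => ((r m x - r n x) ^+ 2 * w x)%:E))%E.
    apply: eq_integral => x; rewrite inE => Ex.
    have c : (fun m => ((r m x - r n x) ^+ 2 * w x)%:E) @ \oo --> ((u x - r n x) ^+ 2 * w x)%:E.
      apply: cvg_EFin; first by near=> m.
      apply: cvgMr_tmp; rewrite expr2; under eq_fun do rewrite expr2.
      by apply: cvgM; apply: cvgB; (exact: uE || exact: cvg_cst).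
    by rewrite (cvg_limn_einf_sup c).1.
  apply: le_trans.
    apply: fatou => //.
    - by move=> m; apply: measurable_funS (mh m) => //; exact: subDsetl.
    - by move=> m x [Dx _]; rewrite lee_fin; exact: sqw_ge0.
  rewrite limn_einf_lim; apply: lime_le; first exact: is_cvg_einfs.
  near=> k; apply: (@le_trans _ _ (\int[mu]_(x in E) ((r (maxn k n) x - r n x) ^+ 2 * w x)%:E)%E).
    by apply: ereal_inf_lbound; exists (maxn k n) => //=; rewrite leq_maxl.
  have rk := rc n (maxn k n) (leq_maxr _ _).
  rewrite -lee_fin EFin_ip// in rk.
  apply: le_trans rk; apply: ge0_subset_integral => //.
  - by move=> x Dx; rewrite lee_fin; exact: sqw_ge0.
  - exact: subDsetl.
have Lu : L2 u.
  have Lur : L2 (u \- r 0%N).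
    split; first by apply: measurable_funB => //; case: (Lr 0%N).
    by apply: le_lt_trans (bound 0%N) _; rewrite ltry.
  have := L2D Lur (Lr 0%N); rewrite (_ : _ \+ _ = u)//.
  by apply/funext => x /=; rewrite subrK.
exists u => // n; rewrite -lee_fin EFin_ip; last exact: L2B.
exact: bound.
Unshelve. all: by end_near. Qed.

Lemma ipB_le f g : L2 f -> L2 g -> ip (f \- g) (f \- g) <= 2 * ip f f + 2 * ip g g.
Proof.
move=> Lf Lg; rewrite parallelogram// lerBlDr lerDl.
by rewrite mulr_ge0 ?ip_ge0.
Qed.

Lemma small_geometric (K e : R) : 0 < e -> exists n, K * 16^-1 ^+ n < e.
Proof.
move=> e0; have [K0|K0] := leP K 0.
  by exists 0%N; rewrite expr0 mulr1 (le_lt_trans K0).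
exists (Num.truncn (K / e)).+1.
rewrite exprVn ltr_pdivrMr ?exprn_gt0// mulrC -ltr_pdivrMr//.
apply: lt_trans (truncnS_gt _) _.
by rewrite -natrX ltr_nat ltn_expl.
Qed.

(** The projection argument for a subspace that need not be closed. Along a minimising sequence the
    residuals [f - v n] form a Cauchy sequence by the parallelogram identity; their limit [u] is
    orthogonal to [V], so it has norm zero and the distance from [f] to [V] is zero. *)
Lemma orth_trivial_dense (V : set (T -> R)) :
  (forall v, V v -> L2 v) -> V (fun=> 0) ->
  (forall a u v, V u -> V v -> V (fun x => a * u x + v x)) ->
  (forall u, L2 u -> (forall v, V v -> ip v u = 0) -> ip u u = 0) ->
  forall f, L2 f -> forall e, 0 < e -> exists2 v, V v & ip (f \- v) (f \- v) < e.
Proof.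
move=> LV V0 Vlin Vorth f Lf e e0.
pose A := [set ip (f \- v) (f \- v) | v in V].
have A0 : has_inf A.
  split; first by exists (ip (f \- (fun=> 0)) (f \- (fun=> 0))), (fun=> 0).
  by exists 0 => _ [v _ <-]; exact: ip_ge0.
have dle v : V v -> inf A <= ip (f \- v) (f \- v).
  by move=> Vv; apply: ge_inf; [case: A0 | exists v].
(* The parallelogram identity leaves [2 c m + 2 c n <= 4 c n]; the division by 4 turns this into the
   rate 16^-n that the completeness lemma expects. *)
pose c n : R := 16^-1 ^+ n / 4.
have c0 n : 0 < c n by rewrite divr_gt0// exprn_gt0// invr_gt0.
have /choice[v vP] : forall n, exists v, V v /\ ip (f \- v) (f \- v) < inf A + c n.
  move=> n; have [_ [v Vv <-] h] := inf_adherent (c0 n) A0.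
  by exists v.
have Vv n := (vP n).1; have vlt n := (vP n).2.
pose r n := f \- v n.
have Lr n : L2 (r n) by apply: L2B => //; exact: LV.
have [u Lu ur] : exists2 u, L2 u & forall n, ip (u \- r n) (u \- r n) <= 16^-1 ^+ n.
  apply: L2_limit => // n m nm; rewrite parallelogram//.
  (* The midpoint of [v m] and [v n]; the trailing 0 comes from building it by two uses of [Vlin] on
     top of [V0]. *)
  have Vmid : V (fun x => 2^-1 * v m x + (2^-1 * v n x + 0)).
    by do 2! apply: (Vlin _ _ _ (Vv _)).
  have := dle _ Vmid.
  rewrite (_ : f \- _ = fun x => 2^-1 * (r m x + r n x)); last first.
    by apply/funext => x; rewrite /r /=; field.
  have cm : c m <= c n.
    by rewrite ler_pM2r ?invr_gt0//; apply: ler_wiXn2l => //; lra.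
  have := vlt n; have := vlt m; rewrite -/(r n) -/(r m).
  have : 16^-1 ^+ n = 4 * c n by rewrite /c; field.
  lra.
have uu : ip u u = 0.
  apply: Vorth => // g Vg; have Lg := LV _ Vg.
  have gg := ip_ge0 g.
  (* Moving [v n] along [g] cannot lower the squared distance by more than [c n], so the quadratic
     in [t] below is nonnegative and its discriminant bounds [ip (r n) g]. *)
  have rg n : ip (r n) g ^+ 2 <= 16^-1 ^+ n * ip g g.
    have q t : 0 <= c n + 2 * t * ip (r n) g + t ^+ 2 * ip g g.
      have /dle := Vlin (- t) _ _ Vg (Vv n).
      rewrite (_ : f \- _ = fun x => t * g x + r n x); last first.
        by apply/funext => x; rewrite /r /=; ring.
      by rewrite ip_sub_scale//; have := vlt n; rewrite -/(r n); lra.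
    have [gz|gz] := eqVneq (ip g g) 0.
      have := cauchy_schwarz (Lr n) Lg; rewrite gz !mulr0; exact.
    have gp : 0 < ip g g by rewrite lt_def gz ip_ge0.
    have := q (- ip (r n) g / ip g g).
    have -> : c n + 2 * (- ip (r n) g / ip g g) * ip (r n) g +
      (- ip (r n) g / ip g g) ^+ 2 * ip g g = c n - ip (r n) g ^+ 2 / ip g g by field.
    rewrite subr_ge0 ler_pdivrMr// => /le_trans; apply.
    rewrite ler_pM2r// /c ler_pdivrMr// ler_peMr ?exprn_ge0 ?invr_ge0//.
    by rewrite ler1n.
  have ug n : ip u g ^+ 2 <= (4 * ip g g) * 16^-1 ^+ n.
    have := cauchy_schwarz (L2B Lu (Lr n)) Lg; rewrite ipBl//.
    (* From [a^2 <= 2 (a - b)^2 + 2 b^2], where both squares on the right are at most 16^-n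
       [ip g g]. *)
    have := rg n; have := ler_wpM2r gg (ur n).
    set a := ip u g; set b := ip (r n) g; have := sqr_ge0 (a - 2 * b); nra.
  rewrite ipC; apply/eqP; rewrite -sqrf_eq0; apply: contraT => h.
  have h0 : 0 < ip u g ^+ 2 by rewrite lt_def h sqr_ge0.
  by have [n] := small_geometric (4 * ip g g) h0; rewrite ltNge ug.
have [n small] := small_geometric 2 e0.
exists (v n) => //; apply: le_lt_trans small; rewrite -/(r n).
have := ipB_le Lu (L2B Lu (Lr n)); rewrite uu (_ : u \- _ = r n); last first.
  by apply/funext => x /=; ring.
have := ur n; lra.
Qed.

Section Operator.
Variables (Dom : set (T -> R)) (A : (T -> R) -> T -> R).
Let G := op_graph Dom A.
Hypothesis L2Dom : forall phi, Dom phi -> L2 phi.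
Hypothesis L2A : forall phi, Dom phi -> L2 (A phi).

Lemma graph_sub_closure : G `<=` closure_graph mu D w G.
Proof.
move=> _ [phi Dphi <-]; split; first exact: L2Dom.
split=> [|e e0]; first exact: L2A.
exists (phi, A phi); split => /=; first by exists phi.
have z f : nrm (f \- f) = 0.
  rewrite /nrm (_ : f \- f = fun=> 0); first by rewrite ip0l sqrtr0.
  by apply/funext => x /=; rewrite subrr.
by rewrite !z addr0.
Qed.

(** The adjoint relation is continuous for the graph norm: replacing [(x, y)] by [(phi, A phi)]
    changes the two sides by at most [|y - A phi| |u| + |x - phi| |v|]. *)
Lemma adjoint_closure : adjoint mu D w (closure_graph mu D w G) = adjoint mu D w G.
Proof.
apply/seteqP; split => -[u v] /= [Lu [Lv uv]].
  by do 2 split => //; move=> xy /graph_sub_closure/uv.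
split => //; split => // -[x y] /= [Lx [Ly xy]].
apply/eqP; rewrite -subr_eq0 -normr_eq0; apply: contraT => h.
set K := nrm u + nrm v + 1.
have K0 : 0 < K by rewrite ltr_wpDl// addr_ge0 ?nrm_ge0.
have e0 : 0 < `|ip y u - ip x v| / K by rewrite divr_gt0// lt_def h normr_ge0.
have [_ [[phi Dphi <-] /=]] := xy _ e0.
have Lp := L2Dom Dphi; have LAp := L2A Dphi.
have := uv (phi, A phi); rewrite /= => E; have {}E := E (ex_intro2 _ _ phi Dphi erefl).
have -> : ip y u - ip x v = ip (y \- A phi) u - ip (x \- phi) v.
  by rewrite !ipBl// E; ring.
rewrite ltr_pdivlMr// ltNge => /negP; case.
apply: le_trans (ler_normB _ _) _.
have := ip_le_nrm (L2B Ly LAp) Lu; have := ip_le_nrm (L2B Lx Lp) Lv.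
have := nrm_ge0 u; have := nrm_ge0 v; have := nrm_ge0 (y \- A phi).
have := nrm_ge0 (x \- phi); rewrite /K; nra.
Qed.

(** A self-adjoint closure would equal the adjoint, and then any two elements of the adjoint would
    satisfy the symmetry relation. *)
Lemma not_ess_self_adjoint u u' v v' :
  adjoint mu D w G (u, u') -> adjoint mu D w G (v, v') ->
  ip u' v <> ip u v' -> ~ ess_self_adjoint mu D w G.
Proof.
move=> uA vA neq; rewrite /ess_self_adjoint /self_adjoint adjoint_closure => e.
apply: neq; have uC : closure_graph mu D w G (u, u') by rewrite e.
by move: vA; rewrite -adjoint_closure => -[_ [_ /(_ _ uC)]].
Qed.

Hypothesis Dom0 : Dom (fun=> 0).
Hypothesis Dom_lin : forall a u v, Dom u -> Dom v -> Dom (fun x => a * u x + v x).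
Hypothesis A_lin : forall a u v, Dom u -> Dom v ->
  A (fun x => a * u x + v x) = fun x => a * A u x + A v x.
Hypothesis A_sym : forall u v, Dom u -> Dom v -> ip (A u) v = ip u (A v).
Hypothesis A_le0 : forall u, Dom u -> ip (A u) u <= 0.
Hypothesis A_ker : forall u, L2 u ->
  (forall phi, Dom phi -> ip (A phi \- phi) u = 0) -> ip u u = 0.

Let B phi := A phi \- phi.

Let L2B' phi : Dom phi -> L2 (B phi).
Proof. by move=> Dp; apply: L2B; [exact: L2A|exact: L2Dom]. Qed.

(** As [A] is nonpositive, [|phi|^2] is at most [- ip (B phi) phi]; Cauchy-Schwarz finishes. *)
Let nrm_le_B phi : Dom phi -> nrm phi <= nrm (B phi).
Proof.
move=> Dp; have Lp := L2Dom Dp; have LA := L2A Dp.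
have h : nrm phi ^+ 2 <= nrm (B phi) * nrm phi.
  apply: le_trans (ip_le_nrm (L2B' Dp) Lp).
  rewrite nrm_sq ler_normr /B ipBl//; apply/orP; right.
  have := A_le0 Dp; lra.
have [->|p0] := eqVneq (nrm phi) 0; first exact: nrm_ge0.
move: h; rewrite expr2 ler_pM2r// lt_def p0 nrm_ge0//.
Qed.

Let range_dense f : L2 f -> forall e, 0 < e ->
  exists2 phi, Dom phi & nrm (f \- B phi) < e.
Proof.
move=> Lf e e0.
have e20 : 0 < e ^+ 2 by rewrite exprn_gt0.
have [_ [phi Dphi <-] h] := @orth_trivial_dense [set B phi | phi in Dom]
  ltac:(by move=> _ [phi Dp <-]; exact: L2B')
  ltac:(exists (fun=> 0) => //; rewrite /B; have := A_lin (-1) Dom0 Dom0;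
    rewrite (_ : (fun x => _) = fun=> 0) => [->|]; apply/funext => x /=; ring)
  ltac:(move=> a _ _ [u Du <-] [v Dv <-]; exists (fun x => a * u x + v x);
    [exact: Dom_lin | rewrite /B A_lin//; apply/funext => x /=; ring])
  ltac:(move=> u Lu h; apply: A_ker => // phi Dp; apply: h; by exists phi)
  f Lf _ e20.
exists phi => //; rewrite -(@ltr_pXn2r _ 2)// ?nnegrE ?nrm_ge0 ?ltW//.
by rewrite nrm_sq.
Qed.

(** For [(u, v)] in the adjoint take [phi] with [(A - 1) phi] close to [v - u]. The error
    [x = u - phi] solves the adjoint equation with the small right-hand side [r], so it is itself
    small, and [v - A phi = r + x] is small as well. *)
Let adjoint_sub_closure : adjoint mu D w G `<=` closure_graph mu D w G.
Proof.
move=> [u v] [/= Lu [Lv uv]]; split => //; split => // e e0.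
(* The final estimate is [|x| + |r| + |x| <= 3 |r|], so a quarter of [e] suffices. *)
have e40 : 0 < e / 4 by rewrite divr_gt0.
have [phi Dp h] := range_dense (L2B Lv Lu) e40.
have Lp := L2Dom Dp; have LA := L2A Dp.
exists (phi, A phi); split => /=; first by exists phi.
pose x := u \- phi; pose r := (v \- u) \- B phi.
have Lx : L2 x by exact: L2B.
have Lr : L2 r by apply: L2B; [exact: L2B|exact: L2B'].
have rE : v \- A phi = r \+ x.
  by apply/funext => t; rewrite /r /x /B /=; ring.
(* testing the adjoint relation on (A - 1)psi close to x bounds |x| by |r| *)
have xr : nrm x <= nrm r.
  have key psi : Dom psi -> ip x (B psi) = ip r psi.
    move=> Ds; have Ls := L2Dom Ds; have LAs := L2A Ds.
    have E1 := uv (psi, A psi) (ex_intro2 _ _ psi Ds erefl).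
    rewrite /= in E1; have E2 := A_sym Dp Ds.
    have -> : r = (v \- A phi) \- x by rewrite rE; apply/funext => t /=; ring.
    rewrite /B /x ipBr// !ipBl//; try exact: L2B.
    by rewrite (ipC u (A psi)) (ipC v) E1 E2; ring.
  apply/ler_addgt0Pr => dl' dl0'; pose dl := dl' / 2.
  have dl0 : 0 < dl by rewrite divr_gt0.
  have -> : dl' = 2 * dl by rewrite /dl; field.
  have [psi Ds hs] := range_dense Lx dl0.
  have Ls := L2Dom Ds; have LBs := L2B' Ds.
  have n1 : nrm psi <= nrm x + dl.
    apply: le_trans (nrm_le_B Ds) _.
    have -> : B psi = x \+ (\- (x \- B psi)) by apply/funext => t /=; ring.
    have Lxb : L2 (\- (x \- B psi)).
      have := L2Z (-1) (L2B Lx LBs).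
      by rewrite (_ : (fun t => _) = \- (x \- B psi))//; apply/funext => t /=; ring.
    apply: le_trans (nrmD Lx Lxb) _.
    by rewrite nrmN lerD2l ltW.
  have n2 : nrm x ^+ 2 <= nrm x * dl + nrm r * (nrm x + dl).
    rewrite nrm_sq (_ : ip x x = ip x (x \- B psi) + ip r psi); last first.
      by rewrite ipBr// key//; ring.
    apply: lerD; apply: le_trans (ler_norm _) _.
      apply: le_trans (ip_le_nrm Lx (L2B Lx LBs)) _.
      by rewrite ler_wpM2l ?nrm_ge0// ltW.
    apply: le_trans (ip_le_nrm Lr Ls) _.
    by rewrite ler_wpM2l ?nrm_ge0.
  have := nrm_ge0 x; have := nrm_ge0 r; move: n2 dl0.
  move: (nrm x) (nrm r) => a b.
  (* If [a > b + 2 dl], then [a (a - b - dl) <= b dl] contradicts [a - b - dl > dl] and [a > b]. *)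
  rewrite leNgt => n2 d0 b0 a0; rewrite leNgt; apply/negP => ab.
  by move/negP : n2; apply; nra.
apply: (@le_lt_trans _ _ (nrm x + (nrm r + nrm x))).
  by rewrite lerD2l rE nrmD.
have : nrm r < e / 4 by exact: h.
lra.
Qed.

Lemma ess_self_adjoint_crit : ess_self_adjoint mu D w G.
Proof.
rewrite /ess_self_adjoint /self_adjoint adjoint_closure; apply/seteqP; split => //.
move=> [u v] [/= Lu [Lv uv]]; split => //; split => // xy [phi Dp <-] /=.
(* Symmetry puts [(phi, A phi)] in the adjoint, which is also the adjoint of the closure; testing it
   on [(u, v)] in the closure gives the required relation. *)
have : adjoint mu D w G (phi, A phi).
  split; first exact: L2Dom.
  split; first exact: L2A.
  by move=> _ [psi Ds <-] /=; rewrite A_sym.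
rewrite -adjoint_closure => -[_ [_ /(_ (u, v))]] /=.
rewrite (ipC v) (ipC u) => -> //.
Qed.

End Operator.
End WeightedL2Theory.

(** * Calculus on the line *)

Section Calculus.
Context {R : realType}.
Implicit Types (f g F : R -> R) (x a b c : R) (U : set R).
Notation mu := (@lebesgue_measure R).
Notation isd x f a := (is_derive (x : R) (1 : R) (f : R -> R) (a : R)).

Lemma isd_val x f a : isd x f a -> (derive1 f) x = a.
Proof. by move=> H; rewrite derive1E; apply: derive_val. Qed.

Lemma isd_ex x f a : isd x f a -> derivable f x 1.
Proof. by move=> H; apply: ex_derive. Qed.

Lemma derivable_isd x f : derivable f x 1 -> isd x f ((derive1 f) x).
Proof. by move=> H; apply: DeriveDef => //; rewrite derive1E. Qed.

Lemma isd_continuous x f a : isd x f a -> {for x, continuous f}.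
Proof.
by move=> /isd_ex H; apply/differentiable_continuous; rewrite -derivable1_diffP.
Qed.

Lemma isd_eq x f a b : isd x f a -> a = b -> isd x f b.
Proof. by move=> + <-. Qed.

Lemma isd_cst x c : isd x (fun=> c) 0.
Proof. exact: is_derive_cst. Qed.

Lemma isd_id x : isd x (fun y => y) 1.
Proof. exact: is_derive_id. Qed.

Lemma isdD x f g a b : isd x f a -> isd x g b -> isd x (fun y => f y + g y) (a + b).
Proof. by move=> ? ?; exact: is_deriveD. Qed.

Lemma isdB x f g a b : isd x f a -> isd x g b -> isd x (fun y => f y - g y) (a - b).
Proof. by move=> ? ?; exact: is_deriveB. Qed.

Lemma isdN x f a : isd x f a -> isd x (fun y => - f y) (- a).
Proof. by move=> ?; exact: is_deriveN. Qed.

Lemma isdM x f g a b : isd x f a -> isd x g b ->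
  isd x (fun y => f y * g y) (a * g x + f x * b).
Proof.
move=> hf hg; apply: isd_eq (is_deriveM hf hg) _.
by rewrite addrC; congr (_ + _); rewrite /GRing.scale/= mulrC.
Qed.

Lemma isdZ x f a c : isd x f a -> isd x (fun y => c * f y) (c * a).
Proof. by move=> ?; exact: is_deriveZ. Qed.

Lemma isd_comp x f g a b : isd (g x) f a -> isd x g b ->
  isd x (fun y => f (g y)) (a * b).
Proof. exact: is_derive1_comp. Qed.

Lemma isdV x f a : f x != 0 -> isd x f a -> isd x (fun y => (f y)^-1) (- a / f x ^+ 2).
Proof.
move=> h0 h; apply: isd_eq (is_deriveV h0 h) _.
by rewrite /GRing.scale/= !mulNr mulrC.
Qed.

Lemma isdX x f a n : isd x f a -> isd x (fun y => f y ^+ n) (n%:R * f x ^+ n.-1 * a).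
Proof.
move=> h; have -> : (fun y => f y ^+ n) = f ^+ n by apply/funext => y; rewrite fctE.
exact: is_deriveX.
Qed.

Lemma isd_near x f g a : (\forall y \near x, f y = g y) -> isd x f a -> isd x g a.
Proof. exact: near_eq_is_derive. Qed.

Lemma isd_open U x f g a : open U -> U x -> {in U, f =1 g} -> isd x f a -> isd x g a.
Proof.
move=> oU Ux fg; apply: isd_near.
by apply: filterS (open_nbhs_nbhs (conj oU Ux)) => y Uy; rewrite fg// inE.
Qed.

Lemma itv_cont a b f : (forall x, a <= x <= b -> {for x, continuous f}) ->
  {within `[a, b], continuous f}.
Proof.
move=> h; apply: continuous_in_subspaceT => x; rewrite inE/= in_itv/=.
exact: h.
Qed.

Lemma cont_itv_integrable a b f : (forall x, a <= x <= b -> {for x, continuous f}) ->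
  mu.-integrable `[a, b] (EFin \o f).
Proof.
move=> h; apply: continuous_compact_integrable; first exact: segment_compact.
exact: itv_cont.
Qed.

Lemma FTC2 a b f F : a <= b ->
  (forall x, a <= x <= b -> isd x F (f x)) ->
  (forall x, a <= x <= b -> {for x, continuous f}) ->
  \int[mu]_(x in `[a, b]) f x = F b - F a.
Proof.
rewrite le_eqVlt => /predU1P[<- _ _|ab dF cf].
  by rewrite set_itv1 Rintegral_set1 subrr.
have cF x : a <= x <= b -> {for x, continuous F}.
  by move=> /dF/isd_continuous.
rewrite /Rintegral (@continuous_FTC2 _ f F)//.
- exact: itv_cont.
- have cFab := itv_cont cF.
  have [_ cFa cFb] := (continuous_within_itvP F ab).1 cFab.
  split=> // x; rewrite in_itv/= => /andP[ax xb].
  by apply: isd_ex; apply: dF; rewrite !ltW.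
- by move=> x; rewrite in_itv/= => /andP[ax xb]; apply: isd_val; apply: dF; rewrite !ltW.
Qed.

Lemma isd_ge0_le a b f F : a <= b ->
  (forall x, a <= x <= b -> isd x F (f x)) ->
  (forall x, a <= x <= b -> 0 <= f x) -> F a <= F b.
Proof.
move=> ab dF f0; apply: (@ger0_derive1_ndecr _ F a b) => //.
- by move=> x; rewrite in_itv/= => /andP[ax xb]; apply: isd_ex; apply: dF; rewrite !ltW.
- move=> x; rewrite in_itv/= => /andP[ax xb].
  by rewrite (isd_val (dF x _)) ?f0// !ltW.
- by apply: itv_cont => x /dF/isd_continuous.
Qed.

Lemma isd0_eq a b F : a <= b -> (forall x, a <= x <= b -> isd x F 0) -> F a = F b.
Proof.
move=> ab dF; apply/eqP; rewrite eq_le; apply/andP; split.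
  by apply: (@isd_ge0_le _ _ (fun=> 0)).
rewrite -lerN2; apply: (@isd_ge0_le _ _ (fun=> 0) (fun x => - F x)) => // x /dF h.
by apply: isd_eq (isdN h) _; rewrite oppr0.
Qed.

Lemma isd_expR x f a : isd x f a -> isd x (fun y => expR (f y)) (a * expR (f x)).
Proof. by move=> h; rewrite mulrC; apply: (isd_comp (is_derive_expR _) h). Qed.

Lemma isd_powR x a : 0 < x -> isd x (fun y => y `^ a) (a * x `^ (a - 1)).
Proof. by move=> x0; exact: is_derive1_powR. Qed.

Lemma powR_add x a b : 0 < x -> x `^ (a + b) = x `^ a * x `^ b.
Proof. by move=> x0; apply: powRD; rewrite (gt_eqF x0) implybT. Qed.

Lemma powRB1 x a : 0 < x -> x `^ (a - 1) = x `^ a / x.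
Proof. by move=> x0; rewrite powR_add// powR_inv1// ltW. Qed.

(** Dividing by [x] and not by [|x|] carries the sign, so a single formula serves both
    half-lines. *)
Lemma isd_norm_powR x a : x != 0 ->
  isd x (fun y => `|y| `^ a) (a * `|x| `^ a / x).
Proof.
move=> x0; have [xp|xn|xz] := ltgtP x 0; last by rewrite xz eqxx in x0.
  have xp' : 0 < - x by rewrite oppr_gt0.
  have h := isd_comp (isd_powR a xp') (isdN (isd_id x)).
  apply: (@isd_open [set y | y < 0] _ (fun y => (- y) `^ a)) => //.
  - by move=> y; rewrite inE/= => y0; rewrite ltr0_norm.
  - apply: isd_eq h _; rewrite ltr0_norm// powRB1//.
    by rewrite invrN; ring.
apply: (@isd_open [set y | 0 < y] _ (fun y => y `^ a)) => //.
- by move=> y; rewrite inE/= => y0; rewrite gtr0_norm.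
- by apply: isd_eq (isd_powR a xn) _; rewrite gtr0_norm// powRB1// mulrA.
Qed.

(** A version of [Ck1] local to a set: powers are smooth only on the open half-line, and products of
    powers and test functions are glued from two open pieces. *)
Fixpoint CkU U (k : nat) f : Prop :=
  match k with
  | 0 => forall x, U x -> {for x, continuous f}
  | k.+1 => [/\ forall x, U x -> {for x, continuous f},
                forall x, U x -> derivable f x 1 & CkU U k (derive1 f)]
  end.

Lemma CkUS U k f : CkU U k.+1 f -> CkU U k f.
Proof. by elim: k f => [|k ih] f /= [cf df dk] //; split => //; apply: ih. Qed.

Lemma CkU_eq U k f g : open U -> {in U, f =1 g} -> CkU U k f -> CkU U k g.
Proof.
move=> oU; have nU x : U x -> nbhs x U by move=> Ux; exact: open_nbhs_nbhs.
elim: k f g => [|k ih] f g fg.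
  move=> cf x Ux; have : {for x, continuous f} by apply: cf.
  have fgx : \forall y \near x, f y = g y.
    by apply: filterS (nU _ Ux) => y Uy; rewrite fg// inE.
  rewrite /prop_for /continuous_at -(fg x) ?inE// => h.
  by apply: cvg_trans h; apply: near_eq_cvg.
move=> [cf df dk].
have D x : U x -> isd x g ((derive1 f) x).
  by move=> Ux; apply: (isd_open oU Ux fg); apply: derivable_isd; exact: df.
split.
- by move=> x /D /isd_continuous.
- by move=> x /D /isd_ex.
- by apply: ih dk => x; rewrite inE => /D /isd_val ->.
Qed.

Lemma CkU_isd U k f g : open U -> (forall x, U x -> isd x f (g x)) -> CkU U k g ->
  CkU U k.+1 f.
Proof.
move=> oU D Ck; split.
- by move=> x /D /isd_continuous.
- by move=> x /D /isd_ex.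
- by apply: CkU_eq Ck => // x; rewrite inE => /D /isd_val ->.
Qed.

Lemma CkU_der U k f : CkU U k.+1 f -> forall x, U x -> isd x f ((derive1 f) x).
Proof. by move=> [_ df _] x /df /derivable_isd. Qed.

Lemma CkUD U k f g : open U -> CkU U k f -> CkU U k g -> CkU U k (fun x => f x + g x).
Proof.
move=> oU; elim: k f g => [|k ih] f g.
  by move=> cf cg x Ux; apply: cvgD; [exact: cf|exact: cg].
move=> hf hg; apply: (CkU_isd (g := fun x => (derive1 f) x + (derive1 g) x)) => //.
  by move=> x Ux; apply: isdD; [exact: (CkU_der hf)|exact: (CkU_der hg)].
by apply: ih; [case: hf|case: hg].
Qed.

Lemma CkU_cst U k c : open U -> CkU U k (fun=> c).
Proof.
move=> oU; elim: k c => [|k ih] c; first by move=> x _; exact: cvg_cst.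
by apply: (CkU_isd (g := fun=> 0)) => // x _; exact: isd_cst.
Qed.

Lemma CkUM U k f g : open U -> CkU U k f -> CkU U k g -> CkU U k (fun x => f x * g x).
Proof.
move=> oU; elim: k f g => [|k ih] f g.
  by move=> cf cg x Ux; apply: cvgM; [exact: cf|exact: cg].
move=> hf hg; apply: (CkU_isd (g := fun x => (derive1 f) x * g x + f x * (derive1 g) x)) => //.
  by move=> x Ux; apply: isdM; [exact: (CkU_der hf)|exact: (CkU_der hg)].
by apply: CkUD => //; apply: ih; try exact: CkUS; [case: hf|case: hg].
Qed.

Lemma CkUZ U k c f : open U -> CkU U k f -> CkU U k (fun x => c * f x).
Proof. by move=> oU hf; apply: CkUM => //; exact: CkU_cst. Qed.

Lemma CkUT_affine k f c b : CkU setT k f -> CkU setT k (fun x => f (c * x + b)).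
Proof.
have aff x : isd x (fun x => c * x + b) c.
  by apply: isd_eq (isdD (isdZ c (isd_id x)) (isd_cst x b)) _; rewrite mulr1 addr0.
elim: k f => [|k ih] f hf.
  move=> x _; apply: (@continuous_comp _ _ _ (fun x => c * x + b) f).
    exact: isd_continuous (aff x).
  exact: hf.
apply: (CkU_isd (g := fun x => c * (derive1 f) (c * x + b))); first exact: openT.
  move=> x _; rewrite mulrC; apply: isd_comp (aff x).
  exact: (CkU_der hf).
by apply: CkUZ; [exact: openT|apply: ih; case: hf].
Qed.

Lemma CkU_powR k a : CkU [set x | 0 < x] k (fun x => x `^ a).
Proof.
have oP : open [set x : R | 0 < x] by apply: open_gt.
elim: k a => [|k ih] a; first by move=> x x0; exact: isd_continuous (isd_powR a x0).
apply: (CkU_isd (g := fun x => a * x `^ (a - 1))) => //; exact: CkUZ.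
Qed.

Lemma CkU_glue U V k f : U `|` V = setT -> CkU U k f -> CkU V k f -> CkU setT k f.
Proof.
move=> UV; have d x : U x \/ V x by have : (U `|` V) x by rewrite UV.
elim: k f => [|k ih] f /=.
  by move=> cu cv x _; case: (d x) => [/cu|/cv].
move=> [cu du ku] [cv dv kv]; split.
- by move=> x _; case: (d x) => [/cu|/cv].
- by move=> x _; case: (d x) => [/du|/dv].
- exact: ih.
Qed.

Lemma CkUT_Ck1 k f : CkU setT k f -> Ck1 k f.
Proof.
elim: k f => [|k ih] f /=; first by move=> cf x; exact: cf.
by move=> [cf df dk]; split; [move=> x; exact: cf|move=> x; exact: df|exact: ih].
Qed.

Lemma Ck1_CkUT k f : Ck1 k f -> CkU setT k f.
Proof.
elim: k f => [|k ih] f /=; first by move=> cf x _; exact: cf.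
by move=> [cf df dk]; split; [move=> x _; exact: cf|move=> x _; exact: df|exact: ih].
Qed.

End Calculus.

(** * Vanishing integrals and test functions on the half-line *)

Section NullIntegrals.
Context {d : measure_display} {T : measurableType d} {R : realType}.
Variables (mu : {measure set T -> \bar R}) (D : set T).
Hypothesis mD : measurable D.

Lemma Rintegral_dct0 (f_ : nat -> T -> R) (f g : T -> R) :
  (forall n, measurable_fun D (f_ n)) ->
  (forall x, D x -> f_ ^~ x @ \oo --> f x) ->
  mu.-integrable D (EFin \o g) ->
  (forall n x, D x -> `|f_ n x| <= g x) ->
  (forall n, \int[mu]_(x in D) f_ n x = 0) -> \int[mu]_(x in D) f x = 0.
Proof.
move=> mf_ ff ig fg f0.
have mf : measurable_fun D f by apply: measurable_fun_cvg ff.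
have [iF _ F0] : [/\ mu.-integrable D (EFin \o f),
  [sequence (\int[mu]_(x in D) `|(f_ n x)%:E - (f x)%:E|)%E]_n @ \oo --> (0 : \bar R)%E &
  [sequence (\int[mu]_(x in D) (f_ n x)%:E)%E]_n @ \oo --> (\int[mu]_(x in D) (f x)%:E)%E].
  apply: (@dominated_convergence _ _ _ mu D mD (fun n => EFin \o f_ n) (EFin \o f)
    (EFin \o g)) => //.
  - by move=> n; exact/measurable_EFinP.
  - exact/measurable_EFinP.
  - by apply: aeW => x Dx; apply: cvg_EFin; [near=> n|exact: ff].
  - by apply: aeW => x n Dx; rewrite lee_fin fg.
(* [Rintegral] is the [fine] of an extended integral, so its vanishing could hide an infinite value;
   domination by [g] excludes this. *)
have f_0 n : (\int[mu]_(x in D) (f_ n x)%:E = 0)%E.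
  have := f0 n; rewrite /Rintegral => h.
  rewrite -[LHS]fineK ?h//; apply: integrable_fin_num => //.
  apply: le_integrable ig => //; first exact/measurable_EFinP.
  by move=> x Dx; rewrite /= lee_fin (le_trans (fg _ _ Dx))// ler_norm.
rewrite /Rintegral; suff -> : (\int[mu]_(x in D) (f x)%:E = 0)%E by [].
have /cvg_lim <- // := F0.
by under eq_fun do rewrite f_0; rewrite lim_cst.
Unshelve. all: by end_near. Qed.

End NullIntegrals.

Section CompactSupport.
Context {R : realType}.
Implicit Types (f g : R -> R) (a b c d x : R).
Notation mu := (@lebesgue_measure R).
Notation isd x f a := (is_derive (x : R) (1 : R) (f : R -> R) (a : R)).
Notation Pos := (`]0%R, +oo[%classic : set R).

(** By Lebesgue differentiation [f] is almost everywhere the derivative of its primitive, here the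
    zero function. *)
Lemma Rintegral_itv_ae0 f : mu.-integrable setT (EFin \o f) ->
  (forall x, \int[mu]_(t in `]-oo, x]) f t = 0) -> {ae mu, forall x, f x = 0}.
Proof.
move=> fi f0.
have fiy y : mu.-integrable `]-oo, y] (EFin \o f) by apply: integrableS fi.
have := FTC1Ny fiy (open_integrable_locally openT fi).
apply: filterS; first exact: (ae_filter_ringOfSetsType mu).
move=> x [_ <-].
rewrite (_ : (fun x => _) = fun=> 0); first by rewrite (isd_val (isd_cst x 0)).
by apply/funext => y; rewrite f0.
Qed.

Lemma sub_itv_pos a b : 0 < a -> `[a, b] `<=` Pos.
Proof.
move=> a0 x /=; rewrite !in_itv/= andbT => /andP[ax _]; exact: lt_le_trans ax.
Qed.

Lemma integrable_contM (c g : R -> R) a b :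
  (forall x, a <= x <= b -> {for x, continuous c}) ->
  mu.-integrable `[a, b] (EFin \o g) ->
  mu.-integrable `[a, b] (EFin \o (fun x => c x * g x)).
Proof.
move=> cc ig; have wc := itv_cont cc.
have := @integrableMr _ _ _ mu `[a, b] (measurable_itv _) c (EFin \o g).
apply => //.
  by apply: subspace_continuous_measurable_fun => //; exact: measurable_itv.
have /compact_bounded[M [_ mrt]] := continuous_compact wc (@segment_compact _ a b).
by exists M; split; rewrite ?num_real // => ? ? ? ?; exact: mrt.
Qed.

Section Support.
Variables (a b : R) (f : R -> R).
Hypothesis a0 : 0 < a.
Hypothesis f0 : forall x, 0 < x -> ~~ (a <= x <= b) -> f x = 0.

Let f_restr : {in Pos, f \_ `[a, b]%classic =1 f}.
Proof.
move=> x; rewrite inE/= in_itv/= andbT => x0.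
rewrite /patch; case: ifPn => //; rewrite notin_setE/= in_itv/= => /negP h.
by rewrite f0.
Qed.

Let posI : Pos `&` `[a, b]%classic = `[a, b]%classic.
Proof. by apply/setIidPr; exact: sub_itv_pos. Qed.

Lemma Rintegral_support : \int[mu]_(x in Pos) f x = \int[mu]_(x in `[a, b]) f x.
Proof. by rewrite -posI Rintegral_mkcondr; apply: eq_Rintegral => x xP; rewrite f_restr. Qed.

Lemma integrable_support : mu.-integrable `[a, b] (EFin \o f) ->
  mu.-integrable Pos (EFin \o f).
Proof.
rewrite -posI => /(integrable_restrict mu (measurable_itv _) (measurable_itv _) _).1.
by apply: eq_integrable => // x xP; rewrite restrict_EFin /= f_restr.
Qed.

End Support.

(** Handles the one point where [flat] cannot be differentiated by the usual rules. *)
Lemma isd_quadratic f C : (forall h, `|f h| <= C * h ^+ 2) -> isd 0 f 0.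
Proof.
move=> fC.
have f0 : f 0 = 0.
  by apply/eqP; rewrite -normr_le0; apply: le_trans (fC 0) _; rewrite expr0n mulr0.
have C0 : 0 <= C by have := fC 1; rewrite expr1n mulr1; apply: le_trans.
have L : (fun h : R => h^-1 *: ((f \o shift (0 : R)) (h *: (1 : R)) - f 0)) @ 0^' --> (0 : R).
  apply/cvgr0Pnorm_le => e e0.
  near=> h.
  have h0 : h != 0 by near: h; exact: nbhs_dnbhs_neq.
  rewrite /= addr0 f0 subr0 /GRing.scale/= mulr1 normrM normfV.
  rewrite mulrC ler_pdivrMr ?normr_gt0//.
  apply: le_trans (fC h) _.
  rewrite -(real_normK (num_real h)) expr2 mulrA ler_pM2r ?normr_gt0//.
  have C1 : 0 < C + 1 by rewrite ltr_wpDl.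
  have he : `|h| < e / (C + 1).
    by near: h; apply: dnbhs0_lt; rewrite divr_gt0 // ltr_wpDl.
  rewrite ltr_pdivlMr// in he; apply: ltW; apply: le_lt_trans he.
  by rewrite mulrC ler_wpM2l// lerDl.
by apply: DeriveDef; [apply/cvg_ex; exists 0 | apply/cvg_lim].
Unshelve. all: by end_near. Qed.

(** Induction on the polynomial: half of the exponential is kept for the induction hypothesis, the
    other half absorbs the new factor through [y <= (2 / t) expR (t y / 2)]. *)
Lemma poly_expR_bound (p : {poly R}) (t : R) : 0 < t ->
  exists2 C, 0 <= C & forall y, 0 <= y -> `|p.[y]| * expR (- (t * y)) <= C.
Proof.
elim/poly_ind: p t => [|p c ih] t t0.
  by exists 0 => // y _; rewrite horner0 normr0 mul0r.
have t20 : 0 < t / 2 by rewrite divr_gt0.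
have [C C0 hC] := ih _ t20.
exists (C * (2 / t) + `|c|).
  by rewrite addr_ge0// mulr_ge0// divr_ge0// ltW.
move=> y y0; rewrite hornerMXaddC.
have e1 : expR (- (t * y)) <= 1.
  by rewrite -expR0 ler_expR oppr_le0 mulr_ge0// ltW.
apply: (@le_trans _ _ (`|p.[y] * y| * expR (- (t * y)) + `|c| * expR (- (t * y)))).
  by rewrite -mulrDl ler_wpM2r ?expR_ge0// ler_normD.
apply: lerD; last by rewrite ler_piMr.
have -> : - (t * y) = - (t / 2 * y) + - (t / 2 * y) by field.
rewrite expRD normrM (ger0_norm y0) mulrACA.
apply: ler_pM => //; rewrite ?mulr_ge0 ?expR_ge0 ?hC//.
rewrite expRN ler_pdivrMr ?expR_gt0//.
apply: le_trans (ler_wpM2l _ (expR_ge1Dx _)); last by rewrite divr_ge0// ltW.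
have -> : 2 / t * (1 + t / 2 * y) = 2 / t + y by field; rewrite gt_eqF.
by rewrite lerDr divr_ge0// ltW.
Qed.

(** The functions p(1/x) exp(-1/x) extended by 0. Allowing every polynomial makes the family closed
    under differentiation, [p] becoming [X^2 (p - p')], so smoothness is a plain induction on the
    order. *)
Definition flat (p : {poly R}) (x : R) : R :=
  if 0 < x then p.[x^-1] * expR (- x^-1) else 0.

Lemma isd_flat p x : isd x (flat p) (flat ('X^2 * (p - p^`())) x).
Proof.
have [x0|x0|->] := ltgtP x 0.
- rewrite {2}/flat ltNge ltW//=.
  apply: (@isd_open _ [set y | y < 0] _ (fun=> 0)) => //.
    by move=> y; rewrite inE/= => y0; rewrite /flat ltNge ltW.
- rewrite {2}/flat x0.
  apply: (@isd_open _ [set y | 0 < y] _ (fun y => p.[y^-1] * expR (- y^-1))) => //.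
    by move=> y; rewrite inE/= => y0; rewrite /flat y0.
  have hV := isdV (lt0r_neq0 x0) (isd_id x).
  apply: isd_eq (isdM (isd_comp (is_derive_poly p _) hV) (isd_expR (isdN hV))) _.
  by rewrite hornerM hornerXn hornerD hornerN; field; rewrite gt_eqF.
- rewrite {2}/flat ltxx.
  have [C C0 hC] := poly_expR_bound ('X^2 * p) ltr01.
  apply: (@isd_quadratic _ C) => h; rewrite /flat.
  case: ifPn => h0; last by rewrite normr0 mulr_ge0// sqr_ge0.
  have hp : 0 < h ^+ 2 by rewrite exprn_gt0.
  have := hC h^-1; rewrite invr_ge0 ltW// => /(_ isT).
  rewrite mul1r hornerM hornerXn normrM [X in _ -> X <= _]normrM (ger0_norm (expR_ge0 _)).
  by rewrite exprVn normfV (ger0_norm (ltW hp)) -mulrA mulrC ler_pdivrMr.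
Qed.

Lemma smooth_flat p k : CkU setT k (flat p).
Proof.
elim: k p => [|k ih] p; first by move=> x _; exact: isd_continuous (isd_flat p x).
by apply: (CkU_isd openT _ (ih _)) => x _; exact: isd_flat.
Qed.

(** The stretching factor makes these bumps tend to the indicator of []c, d[] while their support
    stays fixed; [n.+1] keeps the bump positive inside already for n = 0. *)
Definition bumpf (c d : R) (n : nat) (x : R) : R :=
  flat 1 (n.+1%:R * (x - c)) * flat 1 (n.+1%:R * (d - x)).

Lemma flat1_bound x : 0 <= flat 1 x <= 1.
Proof.
rewrite /flat; case: ifPn => x0; last by rewrite lexx ler01.
by rewrite hornerC mul1r expR_ge0 -expR0 ler_expR oppr_le0 invr_ge0 ltW.
Qed.

Lemma bump_bound c d n x : 0 <= bumpf c d n x <= 1.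
Proof.
have /andP[a0 a1] := flat1_bound (n.+1%:R * (x - c)).
have /andP[b0 b1] := flat1_bound (n.+1%:R * (d - x)).
by rewrite /bumpf mulr_ge0//= -[leRHS]mulr1 ler_pM.
Qed.

Lemma flat_le0 p y : y <= 0 -> flat p y = 0.
Proof. by move=> y0; rewrite /flat ltNge y0. Qed.

Lemma flat1_gt0 y : 0 < y -> 0 < flat 1 y.
Proof. by move=> y0; rewrite /flat y0 hornerC mul1r expR_gt0. Qed.

Lemma bump_out c d n x : ~~ (c < x < d) -> bumpf c d n x = 0.
Proof.
rewrite /bumpf negb_and -!leNgt => /orP[h|h].
  by rewrite flat_le0 ?mul0r// pmulr_rle0 ?ltr0n// subr_le0.
by rewrite mulrC flat_le0 ?mul0r// pmulr_rle0 ?ltr0n// subr_le0.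
Qed.

Lemma bump_gt0 c d n x : c < x < d -> 0 < bumpf c d n x.
Proof.
move=> /andP[cx xd]; rewrite /bumpf mulr_gt0// flat1_gt0//.
  by rewrite pmulr_rgt0 ?ltr0n// subr_gt0.
by rewrite pmulr_rgt0 ?ltr0n// subr_gt0.
Qed.

Lemma smooth_bump c d n k : CkU setT k (bumpf c d n).
Proof.
have oT : open [set: R] by exact: openT.
apply: CkUM => //.
  apply: (CkU_eq oT _ (CkUT_affine n.+1%:R (- (n.+1%:R * c)) (smooth_flat 1 k))) => x _.
  by congr flat; ring.
apply: (CkU_eq oT _ (CkUT_affine (- n.+1%:R) (n.+1%:R * d) (smooth_flat 1 k))) => x _.
by congr flat; ring.
Qed.

Lemma flat1_cvg y : 0 < y -> (fun n => flat 1 (n.+1%:R * y)) @ \oo --> (1 : R).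
Proof.
move=> y0.
have -> : (fun n => flat 1 (n.+1%:R * y)) = (fun n => expR (- (y^-1 * n.+1%:R^-1))).
  by apply/funext => n; rewrite /flat pmulr_rgt0 ?ltr0n// y0 hornerC mul1r invfM mulrC.
suff : (fun n => expR (- (y^-1 * n.+1%:R^-1))) @ \oo --> (expR (- (y^-1 * 0)) : R).
  by rewrite mulr0 oppr0 expR0.
apply: (@continuous_cvg _ _ _ _ _ _ expR); first exact: continuous_expR.
by apply: cvgN; apply: cvgM; [exact: cvg_cst|exact: cvg_harmonic].
Qed.

Lemma bump_cvg c d x : bumpf c d ^~ x @ \oo --> (\1_`]c, d[ x : R).
Proof.
rewrite indicE; have [] := boolP (x \in `]c, d[%classic).
  rewrite inE/= in_itv/= => /andP[cx xd].
  have -> : (true%:R : R) = 1 * 1 by rewrite mulr1.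
  by apply: cvgM; apply: flat1_cvg; rewrite subr_gt0.
rewrite notin_setE/= in_itv/= => /negP h.
by under eq_fun do rewrite bump_out//; exact: cvg_cst.
Qed.

(** Test functions of the positive half-line, kept as smooth functions on the whole line so that
    they also serve as elements of [Cc1]. *)
Definition CcP (f : R -> R) : Prop := (forall k, CkU setT k f) /\
  exists a b, [/\ 0 < a, a < b & forall x, ~~ (a < x < b) -> f x = 0].

Lemma CcP_bump c d n : 0 < c -> c < d -> CcP (bumpf c d n).
Proof.
move=> c0 cd; split; first by move=> k; exact: smooth_bump.
by exists c, d; split => // x h; exact: bump_out.
Qed.

Lemma CcP_lin t f g : CcP f -> CcP g -> CcP (fun x => t * f x + g x).
Proof.
move=> [sf [a [b [a0 ab f0]]]] [sg [a' [b' [a0' ab' g0]]]]; split.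
  by move=> k; apply: CkUD; [exact: openT|apply: CkUZ; [exact: openT|]|].
exists (Num.min a a'), (Num.max b b'); split.
- by rewrite lt_min a0.
- by rewrite gt_min lt_max ab.
- move=> x; rewrite gt_min lt_max !negb_and !negb_or => h.
  rewrite f0 ?g0 ?mulr0 ?addr0// negb_and; case/orP: h => /andP[h1 h2]; rewrite ?h1 ?h2 ?orbT//.
Qed.

Lemma CcP_der f : CcP f -> CcP (derive1 f).
Proof.
move=> [sf [a [b [a0 ab f0]]]]; split; first by move=> k; case: (sf k.+1).
exists (a / 2), (b + 1); split; first by rewrite divr_gt0.
  by rewrite (@lt_trans _ _ a)//; lra.
move=> x; rewrite negb_and -!leNgt => /orP[xa|bx].
  apply: isd_val; apply: (@isd_open _ [set y | y < a] _ (fun=> 0)).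
  - by apply: open_lt.
  - by rewrite /=; lra.
  - by move=> y; rewrite inE/= => ya; rewrite f0// negb_and -leNgt ltW.
apply: isd_val; apply: (@isd_open _ [set y | b < y] _ (fun=> 0)).
- by apply: open_gt.
- by rewrite /=; lra.
- by move=> y; rewrite inE/= => ya; rewrite f0// negb_and -!leNgt (ltW ya) orbT.
Qed.

(** The power is smooth for [x > 0] and the product vanishes for [x < a]; these two open sets cover
    the line. *)
Lemma CcP_powRM f r : CcP f -> CcP (fun x => x `^ r * f x).
Proof.
move=> [sf [a [b [a0 ab f0]]]]; split; last first.
  by exists a, b; split => // x /f0 ->; rewrite mulr0.
have oP : open [set x : R | 0 < x] by apply: open_gt.
have oN : open [set x : R | x < a] by apply: open_lt.
have sfU U k : CkU U k f.
  by elim: k f {f0 sf} (sf k) => [|k ih] g /= h; [move=> x _; exact: h|case: h => h1 h2 h3;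
    split; [move=> x _; exact: h1|move=> x _; exact: h2|exact: ih]].
move=> k; apply: (@CkU_glue _ [set x | 0 < x] [set x | x < a]).
- apply/seteqP; split => // x _ /=.
  by case: (ltP 0 x) => [|h]; [left|right; exact: le_lt_trans h a0].
- by apply: CkUM => //; exact: CkU_powR.
- apply: (CkU_eq oN _ (CkU_cst k 0 oN)) => x; rewrite inE/= => xa.
  by rewrite f0 ?mulr0// negb_and -leNgt ltW.
Qed.

Lemma CcP_cont f : CcP f -> forall x, {for x, continuous f}.
Proof. by move=> [sf _] x; exact: (sf 0%N). Qed.

Lemma CcP_isd f : CcP f -> forall x, isd x f (derive1 f x).
Proof. by move=> [sf _] x; exact: (CkU_der (sf 1%N)). Qed.

Definition loc_int g := forall a b, 0 < a -> a < b -> mu.-integrable `[a, b] (EFin \o g).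

Lemma loc_int_cont g : (forall x, 0 < x -> {for x, continuous g}) -> loc_int g.
Proof.
move=> cg a b a0 ab; apply: cont_itv_integrable => x /andP[ax _].
by apply: cg; exact: lt_le_trans ax.
Qed.

Lemma loc_intM (c g : R -> R) : (forall x, 0 < x -> {for x, continuous c}) -> loc_int g ->
  loc_int (fun x => c x * g x).
Proof.
move=> cc lg a b a0 ab; apply: integrable_contM; last exact: lg.
by move=> x /andP[ax _]; apply: cc; exact: lt_le_trans ax.
Qed.

Lemma loc_intD f g : loc_int f -> loc_int g -> loc_int (fun x => f x + g x).
Proof.
move=> lf lg a b a0 ab.
apply: eq_integrable (integrableD _ (lf _ _ a0 ab) (lg _ _ a0 ab)) => // x _ /=.
Qed.

Lemma loc_intB f g : loc_int f -> loc_int g -> loc_int (fun x => f x - g x).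
Proof.
move=> lf lg a b a0 ab.
apply: eq_integrable (integrableB _ (lf _ _ a0 ab) (lg _ _ a0 ab)) => // x _ /=.
Qed.

Lemma CcP_integrable f g : CcP f -> loc_int g ->
  mu.-integrable Pos (EFin \o (fun x => f x * g x)).
Proof.
move=> cf lg; case: (cf) => sf [a [b [a0 ab f0]]].
apply: (@integrable_support a b) => //.
  by move=> x _ h; rewrite f0 ?mul0r//; apply: contra h => /andP[? ?]; rewrite !ltW.
by apply: integrable_contM; [move=> x _; exact: CcP_cont|exact: lg].
Qed.

Lemma loc_int_cst c : loc_int (fun=> c).
Proof. by apply: loc_int_cont => x _; exact: cvg_cst. Qed.

(** The primitive from 0 vanishes below the support, and above it equals the total integral, which
    is zero. *)
Lemma CcP_prim f : CcP f -> \int[mu]_(x in Pos) f x = 0 ->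
  exists2 F, CcP F & forall x, isd x F (f x).
Proof.
move=> cf If; case: (cf) => sf [a [b [a0 ab f0]]].
pose F x := \int[mu]_(t in `[0, x]) f t.
have cc x : {for x, continuous f} by exact: CcP_cont.
have Fa x : x <= a -> F x = 0.
  move=> xa; rewrite /F /Rintegral integral0_eq// => t.
  by rewrite /= in_itv/= => /andP[_ tx]; rewrite f0// negb_and -leNgt (le_trans tx).
have dF x : isd x F (f x).
  have [xa|ax] := ltP x a.
    rewrite f0 ?negb_and -?leNgt ?(ltW xa)//.
    apply: (@isd_open _ [set y | y < a] _ (fun=> 0)) => //.
    by move=> y; rewrite inE/= => /ltW /Fa ->.
  have := @continuous_FTC1_closed _ f 0 x (x + 1).
  case=> //.
  - by rewrite ltrDl.
  - exact: cont_itv_integrable.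
  - exact: lt_le_trans ax.
  - by move=> dx Ex; rewrite -Ex; exact: derivable_isd.
exists F => //; split.
  move=> [|k]; first by move=> x _; exact: isd_continuous (dF x).
  by apply: (CkU_isd openT _ (sf k)) => x _; exact: dF.
exists a, b; split => // x; rewrite negb_and -!leNgt => /orP[/Fa//|bx].
have f0' y : 0 < y -> ~~ (a <= y <= b) -> f y = 0.
  by move=> _ h; rewrite f0//; apply: contra h => /andP[? ?]; rewrite !ltW.
rewrite (Rintegral_support a0 f0') (@FTC2 _ a b f F) ?ltW// (Fa a)// subr0 in If.
rewrite -If; apply/esym/isd0_eq => // y /andP[byy _].
by apply: isd_eq (dF y) _; rewrite f0// negb_and -!leNgt byy orbT.
Qed.

End CompactSupport.

(** * Fubini for real-valued integrals, and integration by parts *)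

Section RealFubini.
Context {d1 d2 : measure_display} {T1 : measurableType d1} {T2 : measurableType d2}
  {R : realType}.
Variables (m1 : {sigma_finite_measure set T1 -> \bar R})
  (m2 : {sigma_finite_measure set T2 -> \bar R}).

(** Inner integrals are finite only almost everywhere, so [fine] is undone outside a null set. *)
Lemma Rintegral_prod12 (f : T1 * T2 -> R) :
  (m1 \x m2)%E.-integrable setT (EFin \o f) ->
  \int[(m1 \x m2)%E]_z f z = \int[m1]_x \int[m2]_y f (x, y).
Proof.
move=> fi; rewrite /Rintegral -integral12_prod_meas1//; congr fine.
apply: ae_eq_integral => //.
- exact: (measurable_fubini_F fi).
- apply/measurable_EFinP; apply: measurableT_comp => //.
  exact: (measurable_fubini_F fi).
- have := ae_integrable1 fi; apply: filterS.
  move=> x xi _; rewrite fineK//.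
  exact: integrable_fin_num xi.
Qed.

Lemma Rintegral_prod21 (f : T1 * T2 -> R) :
  (m1 \x m2)%E.-integrable setT (EFin \o f) ->
  \int[(m1 \x m2)%E]_z f z = \int[m2]_y \int[m1]_x f (x, y).
Proof.
move=> fi; rewrite /Rintegral -integral21_prod_meas1//; congr fine.
apply: ae_eq_integral => //.
- exact: (measurable_fubini_G fi).
- apply/measurable_EFinP; apply: measurableT_comp => //.
  exact: (measurable_fubini_G fi).
- have := ae_integrable2 fi; apply: filterS.
  move=> x xi _; rewrite fineK//.
  exact: integrable_fin_num xi.
Qed.

Lemma integrable_tensor (p : T1 -> R) (h : T2 -> R) :
  m1.-integrable setT (EFin \o p) -> m2.-integrable setT (EFin \o h) ->
  (m1 \x m2)%E.-integrable setT (EFin \o (fun z => p z.1 * h z.2)).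
Proof.
move=> pi hi.
have mp : measurable_fun setT p by apply/measurable_EFinP/(measurable_int m1).
have mh : measurable_fun setT h by apply/measurable_EFinP/(measurable_int m2).
apply/integrable12ltyP.
  apply/measurable_EFinP/measurable_funM.
    exact: (measurableT_comp mp measurable_fst).
  exact: (measurableT_comp mh measurable_snd).
have hn := integrable_norm hi.
set H := \int[m2]_y `|h y|.
have HE x : (\int[m2]_y `|(EFin \o (fun z : T1 * T2 => (p z.1 * h z.2)%R)) (x, y)| =
    (`|p x| * H)%:E)%E.
  under eq_integral => y _ do rewrite /= normrM EFinM.
  rewrite integralZl// EFinM; congr (_ * _)%E.
  by rewrite /H /Rintegral fineK//; exact: integrable_fin_num.
under eq_integral do rewrite HE.
have := integrableZr measurableT H (integrable_norm pi).
exact: integrable_lty.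
Qed.

End RealFubini.

Section AbsolutelyContinuousParts.
Context {R : realType}.
Implicit Types (f g phi chi : R -> R) (a b c x y : R).
Notation mu := (@lebesgue_measure R).
Notation isd x f a := (is_derive (x : R) (1 : R) (f : R -> R) (a : R)).

(** Since [p] is merely integrable, the product rule is replaced by Fubini on the triangle
    [a <= x <= y <= b]: integrating [dphi y] over [y] in [[x, b]] gives [- phi x] because
    [phi b = 0]. *)
Lemma ac_integration_by_parts a b (p phi dphi : R -> R) : a < b ->
  mu.-integrable `[a, b] (EFin \o p) ->
  (forall x, isd x phi (dphi x)) -> (forall x, {for x, continuous dphi}) ->
  phi b = 0 ->
  \int[mu]_(x in `[a, b]) (p x * phi x) =
  - \int[mu]_(y in `[a, b]) ((\int[mu]_(x in `[a, y]) p x) * dphi y).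
Proof.
move=> ab ip dp cd pb.
pose P := p \_ `[a, b]%classic; pose H := dphi \_ `[a, b]%classic.
have iP : mu.-integrable setT (EFin \o P).
  by rewrite /P -restrict_EFin; apply/integrable_restrict => //; rewrite setTI.
have iH : mu.-integrable setT (EFin \o H).
  rewrite /H -restrict_EFin; apply/integrable_restrict => //; rewrite setTI.
  by apply: cont_itv_integrable => x _; exact: cd.
pose F z := (z.1 <= z.2)%R%:R * (P z.1 * H z.2) : R.
have iF : (mu \x mu)%E.-integrable setT (EFin \o F).
  have := @integrableMr _ _ _ (mu \x mu)%E setT measurableT
    (fun z : R * R => (z.1 <= z.2)%R%:R) (EFin \o (fun z => P z.1 * H z.2)).
  apply.
  - have mS : measurable [set z : R * R | z.1 <= z.2].
      have := @measurable_fun_le _ _ R setT (fun z : R * R => z.1) (fun z => z.2)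
        measurableT measurable_fst measurable_snd.
      by rewrite setTI.
    have := @measurable_indic _ _ R setT _ mS.
    by apply: eq_measurable_fun => z _; rewrite indicE mem_setE.
  - exists 1; split; first exact: num_real.
    move=> M M1 z _ /=; case: (z.1 <= z.2); rewrite ?normr1 ?normr0 ?(ltW M1)//.
    by rewrite (le_trans _ (ltW M1)).
  - exact: integrable_tensor.
have E12 := Rintegral_prod12 iF; have E21 := Rintegral_prod21 iF.
rewrite E12 in E21.
have L x : \int[mu]_y F (x, y) = - (P x * phi x).
  rewrite /F /=.
  have [xab|xab] := boolP (x \in `[a, b]%classic); last first.
    rewrite /P /patch (negPf xab) mul0r oppr0 /Rintegral integral0_eq// => y _.
    by rewrite mul0r mulr0.
  have := xab; rewrite inE/= in_itv/= => /andP[ax xb].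
  transitivity (\int[mu]_(y in `[x, b]) (P x * dphi y)).
    rewrite [RHS]Rintegral_mkcond; apply: eq_Rintegral => y _.
    rewrite /H /patch !mem_setE !in_itv/=.
    have [xy|yx] := leP x y; last by rewrite mul0r.
    by rewrite (le_trans ax xy)/= mul1r; case: ifP => _ //; rewrite mulr0.
  rewrite RintegralZl//; last by apply: cont_itv_integrable => y _; exact: cd.
  by rewrite (@FTC2 _ x b dphi phi)// pb sub0r mulrN.
have Rr y : \int[mu]_x F (x, y) =
    ((fun y => (\int[mu]_(x in `[a, y]) p x) * dphi y) \_ `[a, b]%classic) y.
  rewrite /F /= /patch.
  have [yab|yab] := boolP (y \in `[a, b]%classic); last first.
    rewrite /H /patch (negPf yab) /Rintegral integral0_eq// => x _.
    by rewrite !mulr0.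
  have := yab; rewrite inE/= in_itv/= => /andP[ay yb].
  rewrite -RintegralZr//; last first.
    apply: integrableS ip => //; apply: subset_itvl.
    by rewrite bnd_simp.
  rewrite [RHS]Rintegral_mkcond; apply: eq_Rintegral => x _.
  rewrite /P /H /patch !mem_setE !in_itv/= ay yb/=.
  have [xy|yx] := leP x y; last by rewrite andbF mul0r.
  by rewrite (le_trans xy yb) mul1r andbT; case: ifP => _ //; rewrite mul0r.
have E : \int[mu]_x (- (P x * phi x)) =
    \int[mu]_(y in `[a, b]) ((\int[mu]_(x in `[a, y]) p x) * dphi y).
  rewrite [RHS]Rintegral_mkcond.
  transitivity (\int[mu]_x \int[mu]_y F (x, y)); first exact: eq_Rintegral.
  by rewrite E21; apply: eq_Rintegral.
rewrite -E Rintegral_mkcond.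
transitivity (- (-1 * \int[mu]_x (P x * phi x))).
  rewrite mulN1r opprK; apply: eq_Rintegral => x _.
  by rewrite /P /patch; case: ifP => //; rewrite mul0r.
congr (- _); rewrite -RintegralZl//.
  by apply: eq_Rintegral => x _; rewrite mulN1r.
have ipp : mu.-integrable `[a, b] (EFin \o (fun x => p x * phi x)).
  apply: eq_integrable (integrable_contM (c := phi) _ ip) => //.
  - by move=> x _ /=; rewrite mulrC.
  - by move=> x _; exact: isd_continuous (dp x).
rewrite (_ : (fun x => P x * phi x) = (fun x => p x * phi x) \_ `[a, b]%classic).
  by rewrite -restrict_EFin; apply/integrable_restrict => //; rewrite setTI.
by apply/funext => x; rewrite /P /patch; case: ifP; rewrite ?mul0r.
Qed.

End AbsolutelyContinuousParts.

(** * Weak solutions on a half-line *)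

Section Primitives.
Context {R : realType}.
Implicit Types (f g phi chi : R -> R) (a b c x y : R).
Notation mu := (@lebesgue_measure R).
Notation isd x f a := (is_derive (x : R) (1 : R) (f : R -> R) (a : R)).
Notation Pos := (`]0%R, +oo[%classic : set R).

(** The signed integral from 1 to [x]: the interval of one of the two terms is always empty or a
    point. The base point 1 avoids any integrability at 0. *)
Definition prim1 g x := \int[mu]_(t in `[1, x]) g t - \int[mu]_(t in `[x, 1]) g t.

Lemma Rintegral_itv_cat a b c g : a <= b -> b <= c ->
  mu.-integrable `[a, c] (EFin \o g) ->
  \int[mu]_(t in `[a, c]) g t =
  \int[mu]_(t in `[a, b]) g t + \int[mu]_(t in `[b, c]) g t.
Proof.
move=> ab bc gi.
have := @Rintegral_itvB _ g (BLeft a) (BRight c) b gi; rewrite !bnd_simp.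
move=> /(_ ab bc) h; rewrite -[LHS](subrK (\int[mu]_(t in `[a, b]) g t)) h addrC.
rewrite Rintegral_itv_obnd_cbnd//.
by apply: integrableS gi => //; apply: subset_itv; rewrite bnd_simp.
Qed.

Lemma prim1E g a x : loc_int g -> 0 < a -> a <= x ->
  prim1 g x = prim1 g a + \int[mu]_(t in `[a, x]) g t.
Proof.
move=> lg a0 ax; rewrite /prim1.
have lg' b c : 0 < b -> mu.-integrable `[b, c] (EFin \o g).
  move=> b0; have [bc|cb] := ltP b c; first exact: lg.
  have := lg b (b + 1) b0; rewrite ltrDl => /(_ ltr01); apply: integrableS => //.
  by apply: subset_itvl; rewrite bnd_simp; lra.
have Z b c : c <= b -> \int[mu]_(t in `[b, c]) g t = 0.
  rewrite le_eqVlt => /predU1P[->|cb]; first by rewrite set_itv1 Rintegral_set1.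
  by rewrite set_itv_ge ?Rintegral_set0// bnd_simp -ltNge.
have [a1|a1] := leP 1 a.
  have x1 := le_trans a1 ax.
  by rewrite (Z x 1)// (Z a 1)// !subr0 -Rintegral_itv_cat//; exact: lg'.
have [x1|x1] := leP 1 x.
  rewrite (Z x 1)// (Z 1 a) ?(ltW a1)// (@Rintegral_itv_cat a 1 x) ?(ltW a1)//; last exact: lg'.
  by rewrite sub0r addrA addNr add0r subr0.
rewrite (Z 1 a) ?(Z 1 x) ?(ltW a1) ?(ltW x1)//.
by rewrite (@Rintegral_itv_cat a x 1) ?(ltW x1)//; [ring|exact: lg'].
Qed.

Lemma prim1_cont g : loc_int g -> forall x, 0 < x -> {for x, continuous (prim1 g)}.
Proof.
move=> lg x x0.
have a0 : 0 < x / 2 by rewrite divr_gt0.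
have ab : x / 2 < x + 1 by lra.
have := parameterized_integral_continuous (ltW ab) (lg _ _ a0 ab).
move=> /(continuous_within_itvP _ ab)[c _ _].
have xin : x \in `](x / 2), (x + 1)[ by rewrite in_itv/=; lra.
have {}c := c _ xin.
have : {for x, continuous (fun y => prim1 g (x / 2) + parameterized_integral mu (x / 2) y g)}.
  by apply: cvgD; [exact: cvg_cst|exact: c].
rewrite /prop_for /continuous_at /= => h.
rewrite (@prim1E g (x / 2) x lg a0); last by lra.
apply: cvg_trans h; apply: near_eq_cvg; near=> y; rewrite (@prim1E g (x / 2) y lg a0)//.
by apply: ltW; near: y; apply: lt_nbhsr; lra.
Unshelve. all: by end_near. Qed.

Lemma isd_prim1 g x : (forall x, 0 < x -> {for x, continuous g}) -> 0 < x ->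
  isd x (prim1 g) (g x).
Proof.
move=> cg x0; have lg := loc_int_cont cg.
have a0 : 0 < x / 2 by rewrite divr_gt0.
have ab : x / 2 < x + 1 by lra.
have xab : x / 2 < x by lra.
have := @continuous_FTC1_closed _ g (x / 2) x (x + 1).
case=> //; [by rewrite ltrDl|exact: lg|exact: cg|] => dx Ex.
have h : isd x (fun y => prim1 g (x / 2) + \int[mu]_(t in `[(x / 2), y]) g t) (g x).
  by apply: isd_eq (isdD (isd_cst x _) (derivable_isd dx)) _; rewrite add0r Ex.
apply: (@isd_open _ [set y | x / 2 < y] _ _ _ _ _ _ _ h) => //.
by move=> y; rewrite inE/= => /ltW xy; rewrite (@prim1E g (x / 2) y lg a0).
Qed.

Definition pair f g := \int[mu]_(x in Pos) (f x * g x).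

Lemma pair_linl t f g h : CcP f -> CcP g -> loc_int h ->
  pair (fun x => t * f x + g x) h = t * pair f h + pair g h.
Proof.
move=> cf cg lh; have fh := CcP_integrable cf lh; have gh := CcP_integrable cg lh.
rewrite /pair -RintegralZl// -RintegralD//.
  by apply: eq_Rintegral => x _; ring.
exact: (integrableZl _ t fh).
Qed.

Lemma pair_linr t f g h : CcP f -> loc_int g -> loc_int h ->
  pair f (fun x => t * g x + h x) = t * pair f g + pair f h.
Proof.
move=> cf lg lh; have fg := CcP_integrable cf lg; have fh := CcP_integrable cf lh.
rewrite /pair -RintegralZl// -RintegralD//.
  by apply: eq_Rintegral => x _; ring.
exact: (integrableZl _ t fg).
Qed.

Lemma eq_pair f f' g g' : (forall x, 0 < x -> f x * g x = f' x * g' x) ->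
  pair f g = pair f' g'.
Proof. by move=> h; apply: eq_Rintegral => x; rewrite inE/= in_itv/= andbT; exact: h. Qed.

Lemma pair_derl chi S dS : CcP chi -> (forall x, 0 < x -> isd x S (dS x)) ->
  (forall x, 0 < x -> {for x, continuous dS}) ->
  pair (derive1 chi) S = - pair chi dS.
Proof.
move=> cchi dSx cdS; have c' := CcP_der cchi.
have cS x : 0 < x -> {for x, continuous S} by move=> /dSx/isd_continuous.
have i1 := CcP_integrable c' (loc_int_cont cS).
have i2 := CcP_integrable cchi (loc_int_cont cdS).
apply/eqP; rewrite -addr_eq0 /pair -RintegralD//; apply/eqP.
have dchi := CcP_isd cchi.
case: (cchi) => _ [a [b [a0 ab z]]].
have z' x : 0 < x -> ~~ (a <= x <= b) -> chi x = 0.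
  by move=> _ h; rewrite z//; apply: contra h => /andP[? ?]; rewrite !ltW.
have dz x : 0 < x -> ~~ (a <= x <= b) -> derive1 chi x = 0.
  move=> x0; rewrite negb_and -!ltNge => /orP[xa|bx]; apply: isd_val.
    apply: (@isd_open _ [set y | y < a] _ (fun=> 0)) => //.
    by move=> y; rewrite inE/= => ya; rewrite z// negb_and -leNgt ltW.
  apply: (@isd_open _ [set y | b < y] _ (fun=> 0)) => //.
  by move=> y; rewrite inE/= => yb; rewrite z// negb_and -!leNgt (ltW yb) orbT.
rewrite (@Rintegral_support _ a b (fun x => derive1 chi x * S x + chi x * dS x) a0); last first.
  by move=> x x0 h; rewrite z'// dz// !mul0r addr0.
transitivity (chi b * S b - chi a * S a); last first.
  by rewrite !z ?mul0r ?subrr// ?ltxx ?andbF.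
apply: (@FTC2 _ a b _ (fun x => chi x * S x)); first exact: ltW.
  by move=> x /andP[ax _]; apply: isdM => //; apply: dSx; exact: lt_le_trans ax.
move=> x /andP[ax _]; have x0 := lt_le_trans a0 ax.
by apply: cvgD; apply: cvgM; [exact: CcP_cont|exact: cS|exact: CcP_cont|exact: cdS].
Qed.

(** The distributional derivative of [prim1 p] is [p], with no continuity of [p]. *)
Lemma pair_der_prim1 phi p : CcP phi -> loc_int p ->
  pair (derive1 phi) (prim1 p) = - pair phi p.
Proof.
move=> cphi lp; case: (cphi) => _ [a [b [a0 ab z]]].
have z' x : 0 < x -> ~~ (a <= x <= b) -> phi x = 0.
  by move=> _ h; rewrite z//; apply: contra h => /andP[? ?]; rewrite !ltW.
have dphi := CcP_isd cphi; have cd := CcP_cont (CcP_der cphi).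
have dz x : 0 < x -> ~~ (a <= x <= b) -> derive1 phi x = 0.
  move=> x0; rewrite negb_and -!ltNge => /orP[xa|bx]; apply: isd_val.
    apply: (@isd_open _ [set y | y < a] _ (fun=> 0)) => //.
    by move=> y; rewrite inE/= => ya; rewrite z// negb_and -leNgt ltW.
  apply: (@isd_open _ [set y | b < y] _ (fun=> 0)) => //.
  by move=> y; rewrite inE/= => yb; rewrite z// negb_and -!leNgt (ltW yb) orbT.
rewrite /pair (@Rintegral_support _ a b (fun x => phi x * p x) a0); last first.
  by move=> x x0 h; rewrite z'// mul0r.
rewrite (@Rintegral_support _ a b (fun x => derive1 phi x * prim1 p x) a0); last first.
  by move=> x x0 h; rewrite dz// mul0r.
have pb : phi b = 0 by rewrite z// ltxx andbF.
have pa : phi a = 0 by rewrite z// ltxx.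
have := ac_integration_by_parts ab (lp _ _ a0 ab) dphi cd pb.
under eq_Rintegral do rewrite mulrC.
move=> ->; rewrite opprK.
have ii : mu.-integrable `[a, b] (EFin \o (fun x => (\int[mu]_(t in `[a, x]) p t) * derive1 phi x)).
  apply: continuous_compact_integrable; first exact: segment_compact.
  have h1 := parameterized_integral_continuous (ltW ab) (lp _ _ a0 ab).
  have h2 := @itv_cont _ a b (derive1 phi) (fun x _ => cd x).
  by move=> x; apply: cvgM; [exact: h1|exact: h2].
(* Changing the base point from [a] to 1 adds the constant [prim1 p a], which pairs to zero with the
   derivative of [phi]. *)
transitivity (\int[mu]_(x in `[a, b]) ((\int[mu]_(t in `[a, x]) p t) * derive1 phi x +
    prim1 p a * derive1 phi x)).
  apply: eq_Rintegral => x; rewrite inE/= in_itv/= => /andP[ax _].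
  by rewrite (prim1E lp a0 ax); ring.
have id : mu.-integrable `[a, b] (EFin \o derive1 phi).
  by apply: cont_itv_integrable => x _; exact: cd.
rewrite RintegralD//; last exact: (integrableZl _ (prim1 p a) id).
by rewrite RintegralZl// (@FTC2 _ a b _ phi) ?ltW// pa pb subrr mulr0 addr0.
Qed.

End Primitives.

Section WeakSolutions.
Context {R : realType}.
Implicit Types (f g phi chi eta : R -> R) (a b c d x y : R).
Notation mu := (@lebesgue_measure R).
Notation isd x f a := (is_derive (x : R) (1 : R) (f : R -> R) (a : R)).
Notation Pos := (`]0%R, +oo[%classic : set R).

Lemma aeS (P Q : R -> Prop) : (forall x, P x -> Q x) ->
  {ae mu, forall x, P x} -> {ae mu, forall x, Q x}.
Proof.
by move=> PQ; apply: filterS; [exact: (ae_filter_ringOfSetsType mu) | exact: PQ].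
Qed.

Lemma loc_int_itv g a b : loc_int g -> 0 < a -> mu.-integrable `[a, b] (EFin \o g).
Proof.
move=> lg a0; have [ab|ba] := ltP a b; first exact: lg.
have := lg a (a + 1) a0; rewrite ltrDl => /(_ ltr01); apply: integrableS => //.
by apply: subset_itvl; rewrite bnd_simp; lra.
Qed.

(** Bumps converge boundedly to the indicator of []c, d[], with [|g|] on [[c, d]] as dominating
    function. *)
Lemma loc_int_itvoo0 g c d : loc_int g -> (forall eta, CcP eta -> pair eta g = 0) ->
  0 < c -> \int[mu]_(x in `]c, d[) g x = 0.
Proof.
move=> lg h c0; have [cd|dc] := ltP c d; last first.
  by rewrite set_itv_ge ?Rintegral_set0// bnd_simp -leNgt.
have sub : Pos `&` `]c, d[%classic = `]c, d[%classic.
  apply/setIidPr => x /=; rewrite !in_itv/= andbT => /andP[cx _].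
  exact: lt_trans cx.
rewrite -sub Rintegral_mkcondr.
have ig : mu.-integrable Pos (EFin \o (fun x => `|(g \_ `[c, d]%classic) x|)).
  have h1 : mu.-integrable Pos (EFin \o (g \_ `[c, d]%classic)).
    rewrite -restrict_EFin; apply/(integrable_restrict mu (measurable_itv _) (measurable_itv _) _).
    rewrite (_ : _ `&` _ = `[c, d]%classic); first exact: lg.
    by apply/setIidPr; exact: sub_itv_pos.
  exact: integrable_norm h1.
have := @Rintegral_dct0 _ _ _ mu Pos (measurable_itv _) (fun n x => bumpf c d n x * g x)
  (g \_ `]c, d[%classic) (fun x => `|(g \_ `[c, d]%classic) x|).
apply => //.
- move=> n; apply/measurable_EFinP; apply: (measurable_int mu).
  by apply: CcP_integrable => //; exact: CcP_bump.
- move=> x _; rewrite (_ : (g \_ `]c, d[%classic) x = \1_`]c, d[ x * g x).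
    by apply: cvgM; [exact: bump_cvg|exact: cvg_cst].
  by rewrite /patch indicE; case: ifP => _; rewrite ?mul1r ?mul0r.
- move=> n x _; have /andP[b0 b1] := bump_bound c d n x.
  have [xcd|xcd] := boolP (c < x < d); last by rewrite bump_out// mul0r normr0.
  rewrite /patch mem_setE in_itv/=; case/andP: xcd => cx xd; rewrite (ltW cx) (ltW xd)/=.
  by rewrite normrM (ger0_norm b0) ler_piMl.
- by move=> n; apply: h; exact: CcP_bump.
Qed.

(** The fundamental lemma of the calculus of variations: integrals of [g] over all compactly
    contained intervals vanish, so Lebesgue differentiation applies on each interval [I n] of an
    exhaustion of the half-line. *)
Lemma CcP_ortho g : loc_int g -> (forall eta, CcP eta -> pair eta g = 0) ->
  {ae mu, forall x, Pos x -> g x = 0}.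
Proof.
move=> lg h.
pose I n := `](n.+2%:R^-1 : R), n.+2%:R[%classic.
have c0 n : 0 < n.+2%:R^-1 :> R by rewrite invr_gt0.
have H n : {ae mu, forall x, (g \_ (I n)) x = 0}.
  apply: Rintegral_itv_ae0.
    rewrite -restrict_EFin; apply/integrable_restrict => //; first exact: measurable_itv.
    rewrite setTI; apply: integrableS (loc_int_itv n.+2%:R lg (c0 n)) => //.
      exact: measurable_itv.
    exact: subset_itv_oo_cc.
  move=> x; rewrite -Rintegral_mkcondr.
  have [xc|cx] := leP x (n.+2%:R^-1).
    rewrite (_ : _ `&` _ = set0) ?Rintegral_set0//.
    rewrite /I; apply/seteqP; split => // y [] /=; rewrite !in_itv/= => yx /andP[cy _].
    by have := lt_le_trans cy (le_trans yx xc); rewrite ltxx.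
  have [xd|dx] := ltP x n.+2%:R.
    rewrite (_ : _ `&` _ = `](n.+2%:R^-1), x]%classic); last first.
      rewrite /I; apply/seteqP; split => y /=; rewrite !in_itv/=.
        by move=> [yx /andP[-> _]]; rewrite yx.
      by move=> /andP[cy yx]; rewrite yx cy (le_lt_trans yx).
    rewrite -Rintegral_itv_bndo_bndc; first exact: loc_int_itvoo0.
    apply: integrableS (loc_int_itv x lg (c0 n)) => //.
    exact: subset_itv_oo_cc.
  rewrite (_ : _ `&` _ = `](n.+2%:R^-1), n.+2%:R[%classic); first exact: loc_int_itvoo0.
  rewrite /I; apply/setIidPr => y /=; rewrite !in_itv/= => /andP[_ yd].
  by rewrite ltW// (lt_le_trans yd).
have := ae_foralln H; apply: aeS => x hx x0.
have {}x0 : 0 < x by move: x0; rewrite /= in_itv/= andbT.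
pose M := Num.max x x^-1.
have [n Mn] : exists n, M < n.+2%:R.
  exists (Num.truncn M); apply: lt_trans (truncnS_gt _) _.
  by rewrite ltr_nat.
have := hx n; rewrite /patch /I mem_setE in_itv/=.
move: Mn; rewrite gt_max => /andP[xn vn].
by rewrite xn andbT invf_plt ?posrE// vn.
Qed.

Lemma CcPZ t f : CcP f -> CcP (fun x => t * f x).
Proof.
move=> cf; have := CcP_lin (t - 1) cf cf.
by rewrite (_ : (fun x => _) = fun x => t * f x)//; apply/funext => x; ring.
Qed.

(** A nonnegative bump has nonzero integral: otherwise its increasing primitive would be constant on
    [[1, 2]] and the bump would vanish at 3/2. Normalising gives total mass 1. *)
Lemma CcP_unit : exists2 rho : R -> R, CcP rho & pair rho (fun=> 1) = 1.
Proof.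
pose r : R -> R := bumpf 1 2 0.
have c12 : 1 < 2 :> R by lra.
have cr : CcP r by exact: CcP_bump.
have N0 : pair r (fun=> 1) != 0.
  apply/negP => /eqP; rewrite /pair; under eq_Rintegral do rewrite mulr1.
  rewrite (@Rintegral_support _ 1 2)//; last first.
    move=> x _ hx; rewrite /r bump_out//; apply: contra hx => /andP[? ?].
    by rewrite !ltW.
  have cc x : 0 < x -> {for x, continuous r} by move=> _; exact: CcP_cont.
  have dF x : 0 < x -> isd x (prim1 r) (r x) by exact: isd_prim1.
  have mono x y : 1 <= x -> x <= y -> prim1 r x <= prim1 r y.
    move=> x1 xy; apply: (@isd_ge0_le _ x y r) => // z /andP[xz zy].
      by apply: dF; lra.
    by have /andP[] := bump_bound (1 : R) 2 0 z.
  rewrite -[LHS](addKr (prim1 r 1)) -prim1E//; [|exact: loc_int_cont|lra].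
  rewrite addrC => /subr0_eq F12.
  have E y : 1 < y < 2 -> prim1 r y = prim1 r 1.
    move=> /andP[/ltW y1 /ltW y2]; apply/le_anti/andP; split; last exact: mono.
    by rewrite -F12; exact: mono.
  have h : isd (3 / 2) (prim1 r) 0.
    apply: (@isd_open _ `]1, 2[%classic _ (fun=> prim1 r 1)) => //.
    - by rewrite /= in_itv/=; lra.
    - by move=> y; rewrite inE/= in_itv/= => /E ->.
  have : 0 < r (3 / 2) by apply: bump_gt0; lra.
  have := isd_val h; rewrite (isd_val (dF _ _)) => [->|]; last by lra.
  by rewrite ltxx.
exists (fun x => (pair r (fun=> 1))^-1 * r x); first exact: CcPZ.
have lc1 : loc_int (fun=> 1 : R) := loc_int_cst 1.
have := pair_linl ((pair r (fun=> 1))^-1 - 1) cr cr lc1.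
rewrite (_ : (fun x => _) = fun x => (pair r (fun=> 1))^-1 * r x); last first.
  by apply/funext => x; ring.
by move=> ->; field.
Qed.

(** The lemma of du Bois-Reymond. Subtracting from a test function its integral times [rho] leaves a
    function of mean zero, which is the derivative of a test function; hence [g] minus [pair rho g]
    is orthogonal to every test function. *)
Lemma CcP_der_ortho g : loc_int g ->
  (forall chi, CcP chi -> pair (derive1 chi) g = 0) ->
  exists A, {ae mu, forall x, Pos x -> g x = A}.
Proof.
move=> lg h; have [rho cr r1] := CcP_unit.
have l1 : loc_int (fun=> 1 : R) := loc_int_cst 1.
exists (pair rho g).
have lgA : loc_int (fun x => g x - pair rho g).
  by apply: loc_intB => //; exact: loc_int_cst.
have := CcP_ortho lgA.
move=> H; suff : {ae mu, forall x, Pos x -> g x - pair rho g = 0}.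
  by apply: aeS => x hx /hx /subr0_eq.
apply: H => eta ce.
pose m := pair eta (fun=> 1).
pose eta1 x := (- m) * rho x + eta x.
have c1 : CcP eta1 by exact: CcP_lin.
have I1 : \int[mu]_(x in Pos) eta1 x = 0.
  transitivity (pair eta1 (fun=> 1)).
    by apply: eq_Rintegral => x _; rewrite mulr1.
  by rewrite pair_linl// r1 -/m; ring.
have [chi cchi dchi] := CcP_prim c1 I1.
have dE : derive1 chi = eta1 by apply/funext => x; exact: isd_val (dchi x).
have := h _ cchi; rewrite dE pair_linl// => E.
rewrite (_ : (fun x => g x - pair rho g) = fun x => (- pair rho g) * 1 + g x); last first.
  by apply/funext => x; ring.
by rewrite pair_linr// -/m; move: E; lra.
Qed.

Lemma CcP_derE r phi x : CcP phi -> 0 < x ->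
  derive1 (fun x => x `^ r * phi x) x =
  x `^ r * (derive1 phi x + r / x * phi x).
Proof.
move=> cphi x0; rewrite (isd_val (isdM (isd_powR r x0) (CcP_isd cphi x))).
by rewrite powRB1//; field; rewrite gt_eqF.
Qed.

Lemma eq_prim1 f g x : loc_int f -> loc_int g -> 0 < x ->
  {ae mu, forall x, Pos x -> f x = g x} -> prim1 f x = prim1 g x.
Proof.
move=> lf lg x0 fg.
have E a b : 0 < a -> \int[mu]_(t in `[a, b]) f t = \int[mu]_(t in `[a, b]) g t.
  move=> a0; congr fine; apply: ae_eq_integral => //.
  - by apply: (measurable_int mu); exact: loc_int_itv.
  - by apply: (measurable_int mu); exact: loc_int_itv.
  - apply: aeS fg => t ft tab; rewrite ft//.
    exact: (sub_itv_pos a0 tab).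
by rewrite /prim1 !E.
Qed.

(** In divergence form the equation is the first-order system for [v] and the quasi-derivative
    [z = x^(-alpha) v']. With [P] a primitive of [x^(-alpha) q u], two applications of the du
    Bois-Reymond idea produce the constants [K] and [A] with [z = P - K] and [u = S - K s + A]
    almost everywhere, where [S] and [s] are primitives of [x^alpha P] and [x^alpha]. *)
Lemma weak_regularity alpha (q u : R -> R) :
  (forall x, 0 < x -> {for x, continuous q}) -> loc_int u ->
  (forall phi, CcP phi ->
    \int[mu]_(x in Pos) ((derive1 (derive1 phi) x - alpha / x * derive1 phi x
       - q x * phi x) * u x * x `^ (- alpha)) = 0) ->
  exists v z : R -> R, [/\
    forall x, 0 < x -> isd x v (x `^ alpha * z x),
    forall x, 0 < x -> isd x z (x `^ (- alpha) * (q x * v x)) &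
    {ae mu, forall x, Pos x -> u x = v x}].
Proof.
move=> cq lu weak.
have cpow r x : 0 < x -> {for x, continuous (fun x => x `^ r)}.
  by move=> x0; exact: isd_continuous (isd_powR r x0).
pose p x := (x `^ (- alpha) * q x) * u x.
have cpq x : 0 < x -> {for x, continuous (fun x => x `^ (- alpha) * q x)}.
  by move=> x0; apply: cvgM; [exact: cpow|exact: cq].
have lp : loc_int p by apply: loc_intM.
pose P := prim1 p.
have cP : forall x, 0 < x -> {for x, continuous P} by exact: prim1_cont.
have lP : loc_int P by exact: loc_int_cont.
(* The once integrated equation. It is available only for [w] of mean zero, which is what makes [w]
   the derivative of a test function [phi]. *)
have W1 w : CcP w -> pair w (fun=> 1) = 0 ->
    pair (derive1 (fun x => x `^ (- alpha) * w x)) u + pair w P = 0.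
  move=> cw Iw; have [phi cphi dphi] : exists2 F, CcP F & forall x, isd x F (w x).
    by apply: CcP_prim => //; rewrite -[RHS]Iw; apply: eq_Rintegral => x _; rewrite mulr1.
  have dE : derive1 phi = w by apply/funext => x; exact: isd_val (dphi x).
  have := pair_der_prim1 cphi lp; rewrite dE -/P => ->.
  rewrite -[RHS](weak _ cphi) dE /pair -RintegralB//.
  - apply: eq_Rintegral => x; rewrite inE/= in_itv/= andbT => x0.
    by rewrite (CcP_derE _ cw x0) /p; ring.
  - by apply: CcP_integrable => //; apply: CcP_der; exact: CcP_powRM.
  - exact: CcP_integrable.
have [rho cr r1] := CcP_unit.
pose sg := derive1 (fun x => x `^ (- alpha) * rho x).
have csg : CcP sg by apply: CcP_der; exact: CcP_powRM.
pose K := pair sg u + pair rho P.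
have cxP x : 0 < x -> {for x, continuous (fun x => x `^ alpha * P x)}.
  by move=> x0; apply: cvgM; [exact: cpow|exact: cP].
pose S := prim1 (fun x => x `^ alpha * P x).
have dS x : 0 < x -> isd x S (x `^ alpha * P x).
  by move=> x0; apply: (@isd_prim1 _ (fun x => x `^ alpha * P x)).
pose s := prim1 (fun x : R => x `^ alpha).
have ds x : 0 < x -> isd x s (x `^ alpha).
  by move=> x0; apply: (@isd_prim1 _ (fun x => x `^ alpha)) => //; exact: cpow.
have lS : loc_int S by apply: loc_int_cont => x /dS/isd_continuous.
have ls : loc_int s by apply: loc_int_cont => x /ds/isd_continuous.
have l1 : loc_int (fun=> 1 : R) := loc_int_cst 1.
have lg : loc_int (fun x => K * s x + (u x - S x)).
  apply: loc_intD; last exact: loc_intB.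
  by apply: loc_intM => // x _; exact: cvg_cst.
have [A hA] : exists A, {ae mu, forall x, Pos x -> K * s x + (u x - S x) = A}.
  apply: CcP_der_ortho => // chi cchi.
  have c' := CcP_der cchi.
  pose c := pair chi (fun x => x `^ alpha).
  have cxc : CcP (fun x => x `^ alpha * chi x) by exact: CcP_powRM.
  (* [x^alpha chi] corrected to mean zero by a multiple of [rho]; the correction contributes
     [- c K], and [c] is minus the pairing of [s] with the derivative of [chi]. *)
  pose w x := (- c) * rho x + x `^ alpha * chi x.
  have cw : CcP w by exact: CcP_lin.
  have Iw : pair w (fun=> 1) = 0.
    rewrite pair_linl// r1 (@eq_pair _ _ chi _ (fun x => x `^ alpha)) -/c; first by ring.
    by move=> x _; ring.
  have := W1 w cw Iw.
  rewrite (@eq_pair _ _ (fun x => (- c) * sg x + derive1 chi x) _ u); last first.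
    move=> x x0; congr (_ * _); rewrite /sg !CcP_derE//.
    have -> : derive1 w x = (- c) * derive1 rho x + derive1 (fun x => x `^ alpha * chi x) x.
      exact: (isd_val (isdD (isdZ (- c) (CcP_isd cr x)) (CcP_isd cxc x))).
    rewrite CcP_derE// /w.
    have := powRN x alpha; have : x `^ alpha != 0 by rewrite gt_eqF// powR_gt0.
    move=> xa ->; field; by rewrite gt_eqF//= xa.
  rewrite !pair_linl//.
  have -> : pair (fun x => x `^ alpha * chi x) P = pair chi (fun x => x `^ alpha * P x).
    by apply: eq_pair => x _; ring.
  have E1 := pair_derl cchi dS cxP.
  have E2 := pair_derl cchi ds (cpow alpha).
  rewrite -/c in E2.
  have -> : pair chi (fun x => x `^ alpha * P x) = - pair (derive1 chi) S.
    by rewrite E1 opprK.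
  have -> : (fun x => K * s x + (u x - S x)) =
            (fun x => K * s x + ((-1) * S x + u x)) by apply/funext => x; ring.
  have lSu : loc_int (fun x => -1 * S x + u x).
    apply: loc_intD => //; apply: loc_intM => // x _; exact: cvg_cst.
  rewrite !pair_linr// /K; rewrite (_ : pair (derive1 chi) s = - c)//.
  move: (pair (derive1 chi) u) (pair (derive1 chi) S) (pair sg u) (pair rho P).
  by move=> a b k1 k2; clearbody c => E; rewrite -[RHS]E; ring.
pose v x := S x - K * s x + A.
pose z x := P x - K.
have dv x : 0 < x -> isd x v (x `^ alpha * z x).
  move=> x0; apply: isd_eq (isdD (isdB (dS x x0) (isdZ K (ds x x0))) (isd_cst x A)) _.
  by rewrite /z; ring.
have uv : {ae mu, forall x, Pos x -> u x = v x}.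
  by apply: aeS hA => x hx x0; rewrite /v -(hx x0); ring.
exists v, z; split => // x x0.
(* [P] was built from [u], known only almost everywhere. Its values do not change when [u] is
   replaced by [v], and then the integrand is continuous, so [P] is differentiable everywhere. *)
pose p' x := x `^ (- alpha) * (q x * v x).
have cp' y : 0 < y -> {for y, continuous p'}.
  move=> y0; apply: cvgM; first exact: cpow.
  by apply: cvgM; [exact: cq|exact: isd_continuous (dv y y0)].
have lp' := loc_int_cont cp'.
have oP : open [set y : R | 0 < y] by apply: open_gt.
apply: (@isd_open _ [set y | 0 < y] _ (fun y => prim1 p' y - K)) => //.
  move=> y; rewrite inE/= => y0; rewrite /z /P; congr (_ - _).
  apply: eq_prim1 => //; apply: aeS uv => t ht t0.
  by rewrite /p /p' (ht t0); ring.
apply: isd_eq (isdB (isd_prim1 cp' x0) (isd_cst x K)) _.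
by rewrite subr0.
Qed.

End WeakSolutions.

(** * Growth of the solutions of g'' = V g and square integrability *)

Section Growth.
Context {R : realType}.
Implicit Types (f g h V : R -> R) (a b c x y : R).
Notation mu := (@lebesgue_measure R).
Notation isd x f a := (is_derive (x : R) (1 : R) (f : R -> R) (a : R)).
Notation Pos := (`]0%R, +oo[%classic : set R).

Lemma le_Rintegral_pos (f l : R -> R) a b : 0 < a ->
  mu.-integrable Pos (EFin \o f) -> (forall x, 0 < x -> 0 <= f x) ->
  (forall x, a <= x <= b -> {for x, continuous l}) ->
  (forall x, a <= x <= b -> l x <= f x) ->
  \int[mu]_(x in `[a, b]) l x <= \int[mu]_(x in Pos) f x.
Proof.
move=> a0 fi f0 cl lf.
have fiab : mu.-integrable `[a, b] (EFin \o f).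
  by apply: integrableS fi => //; exact: sub_itv_pos.
apply: (@le_trans _ _ (\int[mu]_(x in `[a, b]) f x)).
  apply: le_Rintegral => //; first exact: cont_itv_integrable.
rewrite /Rintegral fine_le//; [exact: integrable_fin_num..|].
apply: ge0_subset_integral => //.
- exact: measurable_int fi.
- by move=> x; rewrite /= in_itv/= andbT lee_fin => /f0.
- exact: sub_itv_pos.
Qed.

Lemma growth_sign g h V : (forall x, 0 < x -> isd x g (h x)) ->
  (forall x, 0 < x -> isd x h (V x * g x)) -> (forall x, 0 < x -> 0 <= V x) ->
  mu.-integrable Pos (EFin \o (fun x => g x ^+ 2)) ->
  forall x, 0 < x -> g x * h x <= 0.
Proof.
move=> dg dh V0 ig x0 x0p; rewrite leNgt; apply/negP => c0.
set c := g x0 * h x0 in c0.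
have lo x : x0 <= x -> c <= g x * h x.
  move=> xx; apply: (@isd_ge0_le _ x0 x (fun y => h y ^+ 2 + V y * g y ^+ 2)
    (fun y => g y * h y)) => // y /andP[xy _]; have y0 := lt_le_trans x0p xy.
    by apply: isd_eq (isdM (dg y y0) (dh y y0)) _; ring.
  by rewrite addr_ge0 ?sqr_ge0// mulr_ge0 ?sqr_ge0// V0.
(* One unit beyond [x0], the slope [2 c] has raised [g^2] to at least [2 c]. *)
have lo2 x : x0 + 1 <= x -> 2 * c <= g x ^+ 2.
  move=> xx; have x0x : x0 <= x by lra.
  have := @isd_ge0_le _ x0 x (fun y => 2 * (g y * h y) - 2 * c)
    (fun y => g y ^+ 2 - 2 * c * y) x0x.
  move=> H; have {H} : g x0 ^+ 2 - 2 * c * x0 <= g x ^+ 2 - 2 * c * x.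
    apply: H => y /andP[xy _]; have y0 := lt_le_trans x0p xy.
      apply: isd_eq (isdB (isdX 2 (dg y y0)) (isdZ (2 * c) (isd_id y))) _.
      by rewrite /=; ring.
    by have := lo y xy; lra.
  have := sqr_ge0 (g x0); nra.
set M := \int[mu]_(x in Pos) (g x ^+ 2).
have key (n : nat) : 2 * c * n%:R <= M.
  have := @le_Rintegral_pos (fun x => g x ^+ 2) (fun=> 2 * c) (x0 + 1) (x0 + 1 + n%:R).
  have -> : \int[mu]_(x in `[x0 + 1, x0 + 1 + n%:R]) (2 * c) = 2 * c * n%:R.
    transitivity (2 * c * (x0 + 1 + n%:R) - 2 * c * (x0 + 1)); last by ring.
    apply: (@FTC2 _ _ _ (fun=> 2 * c) (fun y => 2 * c * y)).
    - by rewrite lerDl.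
    - by move=> x _; apply: isd_eq (isdZ (2 * c) (isd_id x)) _; rewrite mulr1.
    - by move=> x _; exact: cvg_cst.
  apply => //.
  - by lra.
  - by move=> x _; exact: sqr_ge0.
  - by move=> x _; exact: cvg_cst.
  - by move=> x /andP[xx _]; exact: lo2.
have c2 : 0 < 2 * c by lra.
have := key (Num.truncn (M / (2 * c))).+1.
rewrite leNgt => /negP; apply.
by rewrite mulrC -ltr_pdivrMr// truncnS_gt.
Qed.

(** The Wronskian [K] with x^(3/2) is nondecreasing up to [x1] and negative there, so the derivative
    of g / x^(3/2), which is K / x^3, is at most - k / x^3. Integrating towards 0 gives
    [g >= C x^(-1/2)], and then [g^2 >= C^2 / x] is not integrable at 0. *)
Lemma growth_pos g h V x1 : (forall x, 0 < x -> isd x g (h x)) ->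
  (forall x, 0 < x -> isd x h (V x * g x)) ->
  (forall x, 0 < x <= 1 -> 3 / 4 / x ^+ 2 <= V x) ->
  mu.-integrable Pos (EFin \o (fun x => g x ^+ 2)) ->
  0 < x1 <= 1 -> (forall x, 0 < x <= x1 -> 0 < g x) -> h x1 <= 0 -> False.
Proof.
move=> dg dh V1 ig /andP[x10 x11] gp hx1.
pose r x : R := x `^ (3 / 2).
have r0 x : 0 < x -> 0 < r x by move=> x0; exact: powR_gt0.
have rr x : 0 < x -> r x ^+ 2 = x ^+ 3.
  move=> x0; rewrite -powR_mulrn ?ltW ?r0// /r -powRrM.
  by rewrite (_ : 3 / 2 * 2%:R = 3%:R) ?powR_mulrn ?ltW//; field.
have dr x : 0 < x -> isd x r (3 / 2 * r x / x).
  by move=> x0; apply: isd_eq (isd_powR _ x0) _; rewrite powRB1// mulrA.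
(* K is the Wronskian of g with the comparison solution x^(3/2) *)
pose K x := h x * r x - g x * (3 / 2 * r x / x).
have dK x : 0 < x -> isd x K ((V x - 3 / 4 / x ^+ 2) * (g x * r x)).
  move=> x0; have xn : x != 0 by rewrite gt_eqF.
  have dix := isdV xn (isd_id x).
  apply: isd_eq (isdB (isdM (dh x x0) (dr x x0))
    (isdM (dg x x0) (isdM (isdZ (3 / 2) (dr x x0)) dix))) _.
  by field.
have Kle x : 0 < x <= x1 -> K x <= K x1.
  move=> /andP[x0 xx1].
  apply: (isd_ge0_le xx1 (f := fun y => (V y - 3 / 4 / y ^+ 2) * (g y * r y))).
    by move=> y /andP[xy _]; apply: dK; exact: lt_le_trans xy.
  move=> y /andP[xy yx1]; have y0 := lt_le_trans x0 xy.
  rewrite mulr_ge0 ?subr_ge0 ?V1 ?y0 ?(le_trans yx1)//.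
  by rewrite mulr_ge0 ?(ltW (r0 _ _))// ltW// gp// y0.
pose k := - K x1.
have k0 : 0 < k.
  rewrite /k /K opprB subr_gt0.
  apply: (@le_lt_trans _ _ 0); first by rewrite mulr_le0_ge0// ltW// r0.
  by rewrite mulr_gt0 ?gp ?x10 ?lexx// divr_gt0// mulr_gt0// r0.
(* Adding the primitive of k / x^3 to g / x^(3/2) gives a function with derivative (K + k) / x^3,
   nonpositive on []0, x1]]. *)
pose W x := g x / r x - k / 2 * (x ^+ 2)^-1.
have dW x : 0 < x -> isd x W ((K x + k) / x ^+ 3).
  move=> x0; have xn : x != 0 by rewrite gt_eqF.
  have rn : r x != 0 by rewrite gt_eqF// r0.
  have x2n : x ^+ 2 != 0 by rewrite expf_neq0.
  apply: isd_eq (isdB (isdM (dg x x0) (isdV rn (dr x x0)))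
    (isdZ (k / 2) (@isdV _ x (fun y => y ^+ 2) _ x2n (isdX 2 (isd_id x))))) _.
  rewrite -rr// /K /= /k.
  have r2 := rr x x0.
  have -> : (x ^+ 2) ^+ 2 = x * x ^+ 3 by ring.
  by rewrite -r2; field; rewrite xn rn.
have Wle x : 0 < x <= x1 -> W x1 <= W x.
  move=> /andP[x0 xx1]; rewrite -lerN2.
  apply: (isd_ge0_le xx1 (f := fun y => - ((K y + k) / y ^+ 3)) (F := fun y => - W y)).
    by move=> y /andP[xy _]; apply: isdN; apply: dW; exact: lt_le_trans xy.
  move=> y /andP[xy yx1]; have y0 := lt_le_trans x0 xy.
  rewrite oppr_ge0 mulr_le0_ge0 ?invr_ge0 ?exprn_ge0 ?(ltW y0)//.
  by rewrite /k subr_le0 Kle// y0.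
(* For [x <= x1 / 2] the term in [x1^(-2)] is at most a quarter of the one in [x^(-2)], so 3/4 of k
   / 2 survives: this is [C]. *)
pose b := x1 / 2.
have b0 : 0 < b by rewrite divr_gt0.
pose C := 3 / 8 * k.
have C0 : 0 < C by rewrite mulr_gt0.
have low x : 0 < x <= b -> C ^+ 2 * x^-1 <= g x ^+ 2.
  move=> /andP[x0 xb]; have xn : x != 0 by rewrite gt_eqF.
  have xx1 : x <= x1 by rewrite (le_trans xb)// /b; lra.
  have := Wle x; rewrite x0 xx1 => /(_ isT); rewrite /W.
  have g1 : 0 < g x1 / r x1 by rewrite divr_gt0 ?r0 ?gp ?x10 ?lexx.
  have i1 : (x1 ^+ 2)^-1 <= 4^-1 * (x ^+ 2)^-1.
    rewrite -invfM lef_pV2 ?posrE ?mulr_gt0 ?exprn_gt0//.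
    have : x * x <= b * b by rewrite ler_pM// ltW.
    by rewrite /b; nra.
  have ki1 : k / 2 * (x1 ^+ 2)^-1 <= k / 2 * (4^-1 * (x ^+ 2)^-1).
    by rewrite ler_wpM2l// divr_ge0// ltW.
  move=> hW; have hw : C * (x ^+ 2)^-1 <= g x / r x.
    rewrite /C; move: hW ki1 g1; set i := (x ^+ 2)^-1; set j := (x1 ^+ 2)^-1.
    set gg := g x / r x; set g1 := g x1 / r x1; lra.
  have gx : C * (x ^+ 2)^-1 * r x <= g x by rewrite -ler_pdivlMr// r0.
  have : (C * (x ^+ 2)^-1 * r x) ^+ 2 <= g x ^+ 2.
    have A0 : 0 <= C * (x ^+ 2)^-1 * r x.
      by rewrite mulr_ge0 ?(ltW (r0 _ x0))// mulr_ge0 ?(ltW C0)// invr_ge0 exprn_ge0 ?ltW.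
    by rewrite ler_sqr// nnegrE// (le_trans A0).
  move=> hA; apply: le_trans hA.
  rewrite (_ : (C * (x ^+ 2)^-1 * r x) ^+ 2 = (C * (x ^+ 2)^-1) ^+ 2 * x ^+ 3); last first.
    by rewrite -(rr x x0); ring.
  by rewrite le_eqVlt; apply/orP; left; apply/eqP; field.
set M := \int[mu]_(x in Pos) (g x ^+ 2).
(* Chosen so that the integral of [C^2 / x] over [[e, b]] is exactly [M + 1], more than the whole
   integral [M] of [g^2]. *)
pose e := b * expR (- ((M + 1) / C ^+ 2)).
have M0 : 0 <= M by apply: Rintegral_ge0 => x _; exact: sqr_ge0.
have e0 : 0 < e by rewrite mulr_gt0 ?expR_gt0.
have eb : e <= b.
  rewrite /e ler_piMr ?(ltW b0)// -expR0 ler_expR oppr_le0 divr_ge0 ?sqr_ge0//.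
  by rewrite addr_ge0.
have := @le_Rintegral_pos (fun x => g x ^+ 2) (fun x => C ^+ 2 * x^-1) e b e0 ig.
have cV x : e <= x <= b -> {for x, continuous (fun x => C ^+ 2 * x^-1)}.
  move=> /andP[ex _]; have x0 : x != 0 by rewrite gt_eqF// (lt_le_trans e0).
  exact: isd_continuous (isdZ (C ^+ 2) (isdV x0 (isd_id x))).
have -> : \int[mu]_(x in `[e, b]) (C ^+ 2 * x^-1) = C ^+ 2 * ln b - C ^+ 2 * ln e.
  apply: (@FTC2 _ _ _ (fun x => C ^+ 2 * x^-1) (fun y => C ^+ 2 * ln y)); [exact: eb| |exact: cV].
  move=> x /andP[ex _]; have x0 := lt_le_trans e0 ex.
  exact: (isdZ (C ^+ 2) (is_derive1_ln x0)).
have -> : C ^+ 2 * ln b - C ^+ 2 * ln e = M + 1.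
  rewrite /e lnM ?posrE ?expR_gt0// expRK.
  by field; rewrite gt_eqF.
move=> H; have {H} : M + 1 <= M.
  apply: H => //; first by move=> x _; exact: sqr_ge0.
  by move=> x /andP[ex xb]; apply: low; rewrite xb andbT (lt_le_trans e0).
lra.
Qed.

(** Since [g h <= 0], [g^2] is nonincreasing, so a nonzero value at [x] propagates to all of []0,
    x]]. By the intermediate value theorem [g] has constant sign there, and [growth_pos] excludes
    both [g] and [- g]. *)
Lemma growth_zero g h V : (forall x, 0 < x -> isd x g (h x)) ->
  (forall x, 0 < x -> isd x h (V x * g x)) -> (forall x, 0 < x -> 0 <= V x) ->
  (forall x, 0 < x <= 1 -> 3 / 4 / x ^+ 2 <= V x) ->
  mu.-integrable Pos (EFin \o (fun x => g x ^+ 2)) ->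
  forall x, 0 < x -> g x = 0.
Proof.
move=> dg dh V0 V1 ig x x0; apply/eqP; apply: contraT => gx.
have gh := growth_sign dg dh V0 ig.
have sq y z : 0 < y -> y <= z -> g z ^+ 2 <= g y ^+ 2.
  move=> y0 yz; rewrite -lerN2.
  apply: (isd_ge0_le yz (f := fun t => - (2 * (g t * h t))) (F := fun t => - g t ^+ 2)).
    move=> t /andP[yt _]; have t0 := lt_le_trans y0 yt.
    by apply: isd_eq (isdN (isdX 2 (dg t t0))) _; rewrite /=; ring.
  by move=> t /andP[yt _]; have := gh t (lt_le_trans y0 yt); lra.
(* The lower bound on [V] is available only up to 1. *)
pose x1 := Num.min x 1.
have x10 : 0 < x1 by rewrite lt_min x0 ltr01.
have x11 : x1 <= 1 by rewrite ge_min lexx orbT.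
have ne y : 0 < y <= x1 -> g y != 0.
  move=> /andP[y0 yx1]; have yx : y <= x by rewrite (le_trans yx1)// ge_min lexx.
  have := sq y x y0 yx; apply: contraTneq => ->; rewrite expr0n/= -ltNge.
  by rewrite exprn_even_gt0.
have sgn f : (forall x, 0 < x -> {for x, continuous f}) ->
    (forall y, 0 < y <= x1 -> f y != 0) -> 0 < f x1 -> forall y, 0 < y <= x1 -> 0 < f y.
  move=> cf fne fx1 y /andP[y0 yx1]; rewrite ltNge; apply/negP => fy.
  have [] := @IVT _ f y x1 0 yx1.
  - by apply: itv_cont => t /andP[yt _]; apply: cf; exact: lt_le_trans yt.
  - by rewrite ge_min le_max fy (ltW fx1) orbT.
  move=> t; rewrite in_itv/= => /andP[yt tx] /eqP; apply/negP.
  by apply: fne; rewrite tx (lt_le_trans y0).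
have cg : forall x, 0 < x -> {for x, continuous g} by move=> t /dg/isd_continuous.
have x1in : 0 < x1 <= 1 by rewrite x10.
have [gneg|gpos|/eqP] := ltgtP (g x1) 0; last by rewrite (negPf (ne x1 _))// x10 lexx.
  exfalso; apply: (@growth_pos (fun y => - g y) (fun y => - h y) V x1) => //.
  - by move=> t t0; apply: isdN; exact: dg.
  - by move=> t t0; apply: isd_eq (isdN (dh t t0)) _; ring.
  - by apply: eq_integrable ig => // t _ /=; rewrite sqrrN.
  - apply: sgn.
    + by move=> t t0; apply: cvgN; exact: cg.
    + by move=> y /ne; rewrite oppr_eq0.
    + by rewrite oppr_gt0.
  - by have := gh x1 x10; rewrite oppr_le0; nra.
exfalso; apply: (@growth_pos g h V x1) => //; first exact: sgn.
by have := gh x1 x10; nra.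
Qed.

(** The Liouville substitution [g = x^(-alpha/2) v] removes the first-order term and makes the
    weighted norm the plain L2 norm. The real [kk] stands for the square of a frequency, so that the
    same statement serves a single operator and the angular modes. *)
Lemma half_line_kernel alpha kk (u : R -> R) : 0 <= kk ->
  (alpha <= -3 \/ 1 <= alpha \/ (alpha <= -1 /\ 1 <= kk)) ->
  measurable_fun Pos u ->
  mu.-integrable Pos (EFin \o (fun x => u x ^+ 2 * x `^ (- alpha))) ->
  (forall phi, CcP phi ->
    \int[mu]_(x in Pos) ((derive1 (derive1 phi) x - alpha / x * derive1 phi x
       - (kk * x `^ (2 * alpha) + 1) * phi x) * u x * x `^ (- alpha)) = 0) ->
  {ae mu, forall x, Pos x -> u x = 0}.
Proof.
move=> kk0 hyp mu_ iu weak.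
pose q x : R := kk * x `^ (2 * alpha) + 1.
have cpow r x : 0 < x -> {for x, continuous (fun x => x `^ r)}.
  by move=> x0; exact: isd_continuous (isd_powR r x0).
have cq x : 0 < x -> {for x, continuous q}.
  move=> x0; apply: cvgD; last exact: cvg_cst.
  by apply: cvgM; [exact: cvg_cst|exact: cpow].
have pp x r : 0 < x -> x `^ r * x `^ (- r) = 1.
  by move=> x0; rewrite -powR_add// subrr powRr0.
(* Away from 0 the weight is harmless, and [|u| <= 1 + u^2]. *)
have lu : loc_int u.
  move=> a b a0 ab.
  have i1 : mu.-integrable `[a, b] (EFin \o (fun x => x `^ alpha * (u x ^+ 2 * x `^ (- alpha)))).
    apply: integrable_contM; first by move=> x /andP[ax _]; apply: cpow; exact: lt_le_trans ax.
    by apply: integrableS iu => //; exact: sub_itv_pos.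
  apply: le_integrable (integrableD _ (loc_int_cst 1 a0 ab) i1) => //.
    by apply/measurable_EFinP; apply: measurable_funS mu_ => //; exact: sub_itv_pos.
  move=> x /(sub_itv_pos a0); rewrite /= in_itv/= andbT => x0.
  rewrite lee_fin mulrCA pp// mulr1 [leRHS]ger0_norm ?addr_ge0 ?sqr_ge0//.
  rewrite ler_norml; have := sqr_ge0 (u x + 1); have := sqr_ge0 (u x - 1).
  by have := sqr_ge0 (u x); move=> *; apply/andP; split; nra.
have [v [z [dv dz uv]]] := weak_regularity cq lu weak.
pose g x := x `^ (- alpha / 2) * v x.
(* The derivative of [g], written through [z] because only [z], not the derivative of [v], has been
   differentiated. *)
pose h x := - alpha / 2 / x * g x + x `^ (alpha / 2) * z x.
pose V x := alpha * (alpha + 2) / 4 / x ^+ 2 + q x.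
have pE x r : 0 < x -> x `^ (r / 2) ^+ 2 = x `^ r.
  move=> x0; rewrite -powR_mulrn ?powR_ge0// -powRrM.
  by congr (_ `^ _); field.
have hpp x : 0 < x -> x `^ (- alpha / 2) * x `^ alpha = x `^ (alpha / 2).
  by move=> x0; rewrite -powR_add//; congr (_ `^ _); field.
have hpm x : 0 < x -> x `^ (alpha / 2) * x `^ (- alpha) = x `^ (- alpha / 2).
  by move=> x0; rewrite -powR_add//; congr (_ `^ _); field.
have dg x : 0 < x -> isd x g (h x).
  move=> x0; have xn : x != 0 by rewrite gt_eqF.
  apply: isd_eq (isdM (isd_powR _ x0) (dv x x0)) _.
  by rewrite powRB1// [_ * (_ * z x)]mulrA hpp// /h /g; field.
have dh x : 0 < x -> isd x h (V x * g x).
  move=> x0; have xn : x != 0 by rewrite gt_eqF.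
  have dix := isdV xn (isd_id x).
  apply: isd_eq (isdD (isdM (isdZ (- alpha / 2) dix) (dg x x0)) (isdM (isd_powR _ x0) (dz x x0))) _.
  rewrite powRB1// !mulrA hpm//.
  rewrite /h /V /g; set G := x `^ (- alpha / 2); set H := x `^ (alpha / 2).
  by field.
have V0 x : 0 < x -> 0 <= V x.
  move=> x0; have xi : 0 < (x ^+ 2)^-1 by rewrite invr_gt0 exprn_gt0.
  have P0 : 0 <= kk * x `^ (2 * alpha) by rewrite mulr_ge0 ?powR_ge0.
  rewrite /V /q; have [h1|[h1|[h1 h2]]] := hyp.
  - by rewrite addr_ge0 ?addr_ge0// mulr_ge0 ?(ltW xi)//; nra.
  - by rewrite addr_ge0 ?addr_ge0// mulr_ge0 ?(ltW xi)//; nra.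
  have c4 : - (4^-1) <= alpha * (alpha + 2) / 4 by have := sqr_ge0 (alpha + 1); nra.
  have [x1|x1] := leP x 1.
    have : x `^ (- 2) <= x `^ (2 * alpha).
      by apply: ger_powR; [rewrite x0|lra].
    rewrite powR_invn ?(ltW x0)//; move=> h3.
    have h4 : (x ^+ 2)^-1 <= kk * x `^ (2 * alpha).
      by apply: (le_trans h3); rewrite ler_peMl ?powR_ge0.
    nra.
  (* Beyond 1 the possibly negative term is at least -1/4, and the summand 1 of [q] outweighs it. *)
  have : (x ^+ 2)^-1 <= 1 by rewrite invf_le1 ?exprn_gt0// exprn_ege1// ltW.
  nra.
have V1 x : 0 < x <= 1 -> 3 / 4 / x ^+ 2 <= V x.
  move=> /andP[x0 x1]; have xi : 0 < (x ^+ 2)^-1 by rewrite invr_gt0 exprn_gt0.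
  have P0 : 0 <= kk * x `^ (2 * alpha) by rewrite mulr_ge0 ?powR_ge0.
  rewrite /V /q; have [h1|[h1|[h1 h2]]] := hyp.
  - have c4 : 3 / 4 <= alpha * (alpha + 2) / 4 by nra.
    have := ler_wpM2r (ltW xi) c4; lra.
  - have c4 : 3 / 4 <= alpha * (alpha + 2) / 4 by nra.
    have := ler_wpM2r (ltW xi) c4; lra.
  (* The borderline case: -1/4 from the Liouville term plus at least 1 from
     [kk x^(2 alpha) >= x^(-2)] on []0, 1]] gives 3/4. *)
  have c4 : - (4^-1) <= alpha * (alpha + 2) / 4 by have := sqr_ge0 (alpha + 1); nra.
  have : x `^ (- 2) <= x `^ (2 * alpha).
    by apply: ger_powR; [rewrite x0|lra].
  rewrite powR_invn ?(ltW x0)//; move=> h3.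
  have h4 : (x ^+ 2)^-1 <= kk * x `^ (2 * alpha).
    by apply: (le_trans h3); rewrite ler_peMl ?powR_ge0.
  have := ler_wpM2r (ltW xi) c4; lra.
have cg x : 0 < x -> {for x, continuous g} by move=> /dg/isd_continuous.
have ig : mu.-integrable Pos (EFin \o (fun x => g x ^+ 2)).
  have mg : measurable_fun Pos (fun x => g x ^+ 2).
    apply: measurable_funX; apply: open_continuous_measurable_fun.
      by apply: interval_open.
    by move=> x; rewrite inE/= in_itv/= andbT; exact: cg.
  have lty : (\int[mu]_(x in Pos) (EFin \o (fun x => u x ^+ 2 * x `^ (- alpha))%R) x < +oo)%E.
    by apply: integrable_lty.
  apply/integrableP; split; first exact/measurable_EFinP.
  apply: le_lt_trans lty; rewrite le_eqVlt; apply/orP; left; apply/eqP.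
  apply: ae_eq_integral => //.
  - by apply: measurableT_comp => //; exact/measurable_EFinP.
  - exact: measurable_int iu.
  apply: aeS uv => x ux x0; have {}ux := ux x0.
  have {}x0 : 0 < x by move: x0; rewrite /= in_itv/= andbT.
  rewrite /= ger0_norm ?sqr_ge0// /g exprMn pE// ux; congr EFin; ring.
have g0 := growth_zero dg dh V0 V1 ig.
apply: aeS uv => x ux x0; rewrite (ux x0).
have {}x0 : 0 < x by move: x0; rewrite /= in_itv/= andbT.
have /eqP := g0 x x0; rewrite /g mulf_eq0 => /orP[|/eqP//].
by rewrite gt_eqF// powR_gt0.
Qed.

End Growth.

(** * The operators on the punctured line *)

Section PuncturedLine.
Context {R : realType}.
Implicit Types (f g phi psi F : R -> R) (a b c x y : R).
Notation mu := (@lebesgue_measure R).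
Notation isd x f a := (is_derive (x : R) (1 : R) (f : R -> R) (a : R)).

(** Used with [0 < a]: such a function vanishes near 0, so singular coefficients such as [alpha / x]
    do no harm and continuity has to be checked only for [x != 0]. *)
Definition supp a b f := forall x, ~~ (a <= `|x| <= b) -> f x = 0.

Lemma supp_open a b : open [set x : R | ~~ (a <= `|x| <= b)].
Proof.
rewrite (_ : [set x | _] = [set x : R | `|x| < a] `|` [set x : R | b < `|x|]).
  apply: openU.
    rewrite (_ : [set x | _] = Num.norm @^-1` [set y | y < a])//.
    by apply: open_comp; [move=> x _; exact: norm_continuous|apply: open_lt].
  rewrite (_ : [set x | _] = Num.norm @^-1` [set y | b < y])//.
  by apply: open_comp; [move=> x _; exact: norm_continuous|apply: open_gt].
apply/seteqP; split => x /=; rewrite negb_and -!ltNge => /orP //.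
Qed.

Lemma supp_isd a b f x : supp a b f -> ~~ (a <= `|x| <= b) -> isd x f 0.
Proof.
move=> s hx; have h := isd_cst x 0.
apply: (isd_open (supp_open (a := a) (b := b)) _ _ h) => // y.
by rewrite inE/= => hy; rewrite s.
Qed.

Lemma supp_isd0 a b f : 0 < a -> supp a b f -> isd 0 f 0.
Proof. by move=> a0 s; apply: (supp_isd s); rewrite normr0 leNgt a0. Qed.

Lemma supp_der a b f : supp a b f -> supp a b (derive1 f).
Proof. by move=> s x hx; apply: isd_val (supp_isd s hx). Qed.

Lemma supp_le a b a' b' f : a' <= a -> b <= b' -> supp a b f -> supp a' b' f.
Proof.
move=> aa bb s x hx; apply: s; apply: contra hx => /andP[h1 h2].
by rewrite (le_trans aa h1) (le_trans h2 bb).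
Qed.

Lemma suppM a b f g : supp a b f -> supp a b (fun x => f x * g x).
Proof. by move=> s x hx; rewrite s// mul0r. Qed.

Lemma suppD a b f g : supp a b f -> supp a b g -> supp a b (fun x => f x + g x).
Proof. by move=> s s' x hx; rewrite s// s'// addr0. Qed.

Lemma supp0 a b f : 0 < a -> supp a b f -> f 0 = 0.
Proof. by move=> a0; apply; rewrite normr0 leNgt a0. Qed.

Lemma measurable_Rdom : measurable (@Rdom R).
Proof.
rewrite (_ : Rdom = ~` [set 0]); first exact: measurableC.
by apply/seteqP; split => x /= /eqP.
Qed.

Lemma open_Rdom : open (@Rdom R).
Proof.
rewrite (_ : Rdom = ~` [set 0]).
  by apply: closed_openC; exact: closed_eq.
by apply/seteqP; split => x /= /eqP.
Qed.

Lemma Rintegral_Rdom f : mu.-integrable setT (EFin \o f) ->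
  \int[mu]_(x in Rdom) f x = \int[mu]_x f x.
Proof.
move=> fi; rewrite /Rintegral (@negligible_integral _ _ _ mu setT [set 0])//.
  by rewrite setTD; congr (fine (integral _ _ _)); apply/seteqP; split => x /= /eqP.
exact: lebesgue_measure_set1.
Qed.

Lemma supp_cont a b f : 0 < a -> supp a b f ->
  (forall x, x != 0 -> {for x, continuous f}) -> forall x, {for x, continuous f}.
Proof.
move=> a0 s cf x; have [->|/cf//] := eqVneq x 0.
exact: isd_continuous (supp_isd0 a0 s).
Qed.

Lemma supp_integrable a b f : 0 < a -> supp a b f ->
  (forall x, x != 0 -> {for x, continuous f}) ->
  mu.-integrable setT (EFin \o f) /\
  \int[mu]_x f x = \int[mu]_(x in `[- (`|b| + 1), `|b| + 1]) f x.
Proof.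
move=> a0 s cf; have cf' := supp_cont a0 s cf.
set B := `|b| + 1.
have fE : f \_ `[- B, B]%classic = f.
  apply/funext => x; rewrite /patch mem_setE in_itv/= -ler_norml.
  case: ifP => // /negbT; rewrite -ltNge => xB; rewrite s//.
  rewrite negb_and -!ltNge; apply/orP; right.
  by apply: le_lt_trans xB; rewrite /B (le_trans (ler_norm _))// lerDl.
have ib : mu.-integrable `[- B, B] (EFin \o f) by exact: cont_itv_integrable.
split; last by rewrite [RHS]Rintegral_mkcond; apply: eq_Rintegral => x _; rewrite -[in LHS]fE.
rewrite -fE -restrict_EFin; apply/integrable_restrict => //.
by rewrite setTI.
Qed.

Lemma supp_integrable_Rdom a b f : 0 < a -> supp a b f ->
  (forall x, x != 0 -> {for x, continuous f}) ->
  mu.-integrable Rdom (EFin \o f).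
Proof.
move=> a0 s cf; have [fi _] := supp_integrable a0 s cf.
by apply: integrableS fi => //; exact: measurable_Rdom.
Qed.

Lemma supp_Rintegral_der0 a b (F dF : R -> R) : 0 < a -> supp a b F -> supp a b dF ->
  (forall x, x != 0 -> isd x F (dF x)) ->
  (forall x, x != 0 -> {for x, continuous dF}) ->
  \int[mu]_(x in Rdom) dF x = 0.
Proof.
move=> a0 s s' FdF cdF; have [fi E] := supp_integrable a0 s' cdF.
have sB x : `|b| < `|x| -> F x = 0.
  move=> bx; apply: s; rewrite negb_and -!ltNge; apply/orP; right.
  by apply: le_lt_trans bx; exact: ler_norm.
rewrite Rintegral_Rdom// E.
transitivity (F (`|b| + 1) - F (- (`|b| + 1))).
  apply: (@FTC2 _ _ _ dF F).
  - by have := normr_ge0 b; lra.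
  - move=> x _; have [->|/FdF//] := eqVneq x 0.
    by rewrite (supp0 a0 s'); exact: (supp_isd0 a0 s).
  - by move=> x _; exact: (supp_cont a0 s').
have B1 : `|b| < `| `|b| + 1 | by rewrite [ltRHS]ger0_norm ?ltrDl// addr_ge0.
by rewrite !sB ?subrr// normrN.
Qed.

Lemma Rweight_gt0 alpha x : Rdom x -> 0 < Rweight alpha x.
Proof. by move=> x0; rewrite powR_gt0// normr_gt0. Qed.

Lemma norm_powR_cont r x : x != 0 -> {for x, continuous (fun x => `|x| `^ r)}.
Proof. by move=> x0; exact: isd_continuous (isd_norm_powR r x0). Qed.

Lemma measurable_punctured f : (forall x, x != 0 -> {for x, continuous f}) ->
  measurable_fun Rdom f.
Proof.
move=> cf; apply: open_continuous_measurable_fun; first exact: open_Rdom.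
by move=> x; rewrite inE; exact: cf.
Qed.

Lemma measurable_Rweight alpha : measurable_fun Rdom (@Rweight R alpha).
Proof. by apply: measurable_punctured => x; exact: norm_powR_cont. Qed.

Lemma supp_L2 alpha a b f : 0 < a -> supp a b f ->
  (forall x, x != 0 -> {for x, continuous f}) -> L2 mu Rdom (Rweight alpha) f.
Proof.
move=> a0 s cf.
apply: sq_integrable_L2; [exact: measurable_Rdom|exact: measurable_punctured|].
apply: (@supp_integrable_Rdom a b) => //.
  by move=> x hx; rewrite s// expr0n mul0r.
move=> x x0; have c2 := cvgM (cf x x0) (cf x x0).
by apply: cvgM; [exact: c2|exact: norm_powR_cont].
Qed.

(** The weight puts the operator in divergence form, so the two integrands add up to the derivative
    of [f' g |x|^(-alpha)]. Only [f'] and [f''] need support in a shell; [g] is arbitrary. *)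
Lemma radial_by_parts alpha a b (f f' f'' g g' : R -> R) : 0 < a ->
  supp a b f' -> supp a b f'' ->
  (forall x, x != 0 -> isd x f' (f'' x)) -> (forall x, x != 0 -> isd x g (g' x)) ->
  (forall x, x != 0 -> {for x, continuous f''}) ->
  (forall x, x != 0 -> {for x, continuous g'}) ->
  \int[mu]_(x in Rdom) ((f'' x - alpha / x * f' x) * g x * Rweight alpha x) =
  - \int[mu]_(x in Rdom) (f' x * g' x * Rweight alpha x).
Proof.
move=> a0 s1 s2 df dg cf cg; apply/eqP; rewrite -addr_eq0; apply/eqP.
have cf' x : x != 0 -> {for x, continuous f'} by move=> /df/isd_continuous.
have cg' x : x != 0 -> {for x, continuous g} by move=> /dg/isd_continuous.
have cw x : x != 0 -> {for x, continuous (Rweight alpha)} by exact: norm_powR_cont.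
have cV x : x != 0 -> {for x, continuous (fun x : R => x^-1)}.
  by move=> x0; exact: isd_continuous (isdV x0 (isd_id x)).
pose h x := f'' x - alpha / x * f' x.
have ch x : x != 0 -> {for x, continuous h}.
  move=> x0; apply: cvgB; first exact: cf.
  by apply: cvgM; [apply: cvgM; [exact: cvg_cst|exact: cV]|exact: cf'].
have sh : supp a b h by move=> x hx; rewrite /h s1// s2// mulr0 subr0.
have c1 x : x != 0 -> {for x, continuous (fun x => h x * g x * Rweight alpha x)}.
  by move=> x0; apply: cvgM; [apply: cvgM; [exact: ch|exact: cg']|exact: cw].
have c2 x : x != 0 -> {for x, continuous (fun x => f' x * g' x * Rweight alpha x)}.
  by move=> x0; apply: cvgM; [apply: cvgM; [exact: cf'|exact: cg]|exact: cw].
have S1 : supp a b (fun x => h x * g x * Rweight alpha x) by do 2 apply: suppM.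
have S2 : supp a b (fun x => f' x * g' x * Rweight alpha x) by do 2 apply: suppM.
rewrite -RintegralD//; first last.
- exact: supp_integrable_Rdom S2 c2.
- exact: supp_integrable_Rdom S1 c1.
- exact: measurable_Rdom.
apply: (@supp_Rintegral_der0 a b (fun x => f' x * g x * Rweight alpha x)) => //.
- by do 2 apply: suppM.
- exact: suppD.
- move=> x x0; apply: isd_eq (isdM (isdM (df x x0) (dg x x0)) (isd_norm_powR (- alpha) x0)) _.
  by rewrite /h /Rweight; field.
- by move=> x x0; apply: cvgD; [exact: c1|exact: c2].
Qed.

Lemma Cc1_supp phi : Cc1 phi -> exists a b, 0 < a /\ supp a b phi.
Proof.
move=> [_ [a [b [a0 h]]]]; exists a, b; split => // x hx.
by apply/eqP; apply: contraNT hx => /h.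
Qed.

Lemma Cc1_isd phi : Cc1 phi -> forall x, isd x phi (derive1 phi x).
Proof. by move=> [s _] x; apply: derivable_isd; case: (s 1%N). Qed.

Lemma Cc1_isd2 phi : Cc1 phi -> forall x, isd x (derive1 phi) (derive1 (derive1 phi) x).
Proof. by move=> [s _] x; apply: derivable_isd; case: (s 2%N) => _ _ []. Qed.

Lemma Cc1_cont2 phi : Cc1 phi -> forall x, {for x, continuous (derive1 (derive1 phi))}.
Proof. by move=> [s _] x; case: (s 2%N) => _ _ [_ _ h]; exact: h. Qed.

Lemma Cc1_zero : Cc1 (fun=> 0 : R).
Proof.
split; first by move=> k; apply: CkUT_Ck1; apply: CkU_cst; exact: openT.
by exists 1, 1; split => // x; rewrite eqxx.
Qed.

Lemma Cc1_lin t phi psi : Cc1 phi -> Cc1 psi -> Cc1 (fun x => t * phi x + psi x).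
Proof.
move=> cf cg; have [a [b [a0 sa]]] := Cc1_supp cf.
have [a' [b' [a0' sa']]] := Cc1_supp cg.
split.
  move=> k; apply: CkUT_Ck1; apply: CkUD; first exact: openT.
    by apply: CkUZ; [exact: openT|apply: Ck1_CkUT; case: cf].
  by apply: Ck1_CkUT; case: cg.
exists (Num.min a a'), (Num.max b b'); split; first by rewrite lt_min a0.
move=> x; apply: contraNT => hx.
rewrite (@supp_le a b (Num.min a a') (Num.max b b') phi)//; try by rewrite ?ge_min ?le_max lexx.
rewrite (@supp_le a' b' (Num.min a a') (Num.max b b') psi)//;
  try by rewrite ?ge_min ?le_max lexx orbT.
by rewrite mulr0 addr0.
Qed.

Lemma LBk_lin alpha k t phi psi : Cc1 phi -> Cc1 psi ->
  LBk alpha k (fun x => t * phi x + psi x) =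
  fun x => t * LBk alpha k phi x + LBk alpha k psi x.
Proof.
move=> cf cg.
have d1 : derive1 (fun x => t * phi x + psi x) = fun x => t * derive1 phi x + derive1 psi x.
  by apply/funext => x; apply: isd_val; apply: isdD (isdZ t (Cc1_isd cf x)) (Cc1_isd cg x).
have d2 : derive1 (fun x => t * derive1 phi x + derive1 psi x) =
    fun x => t * derive1 (derive1 phi) x + derive1 (derive1 psi) x.
  by apply/funext => x; apply: isd_val; apply: isdD (isdZ t (Cc1_isd2 cf x)) (Cc1_isd2 cg x).
apply/funext => x; rewrite /LBk d1 d2.
move: (derive1 (derive1 phi) x) (derive1 (derive1 psi) x) (derive1 phi x) (derive1 psi x).
by move: (phi x) (psi x) (`|x| `^ (2 * alpha)) => *; ring.
Qed.

Lemma LBk_cont alpha k phi x : Cc1 phi -> x != 0 -> {for x, continuous (LBk alpha k phi)}.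
Proof.
move=> cf x0; apply: cvgB.
  apply: cvgB; first exact: Cc1_cont2.
  apply: cvgM; last exact: isd_continuous (Cc1_isd2 cf x).
  apply: cvgM; first exact: cvg_cst.
  exact: isd_continuous (isdV x0 (isd_id x)).
apply: cvgM; last exact: isd_continuous (Cc1_isd cf x).
by apply: cvgM; [exact: cvg_cst|exact: norm_powR_cont].
Qed.

Lemma LBk_supp alpha k a b phi : supp a b phi -> supp a b (LBk alpha k phi).
Proof.
move=> s x hx; rewrite /LBk (supp_der s)// (supp_der (supp_der s))// s//.
by rewrite !mulr0 !subr0.
Qed.

Lemma Cc1_L2 alpha phi : Cc1 phi -> L2 mu Rdom (Rweight alpha) phi.
Proof.
move=> cf; have [a [b [a0 s]]] := Cc1_supp cf.
by apply: supp_L2 a0 s _ => x _; exact: isd_continuous (Cc1_isd cf x).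
Qed.

Lemma LBk_L2 alpha k phi : Cc1 phi -> L2 mu Rdom (Rweight alpha) (LBk alpha k phi).
Proof.
move=> cf; have [a [b [a0 s]]] := Cc1_supp cf.
by apply: supp_L2 a0 (LBk_supp alpha k s) _ => x; exact: LBk_cont.
Qed.

(** The Dirichlet form, from which both symmetry and nonpositivity can be read off. *)
Lemma LBk_form alpha k phi psi : Cc1 phi -> Cc1 psi ->
  ip mu Rdom (Rweight alpha) (LBk alpha k phi) psi =
  - \int[mu]_(x in Rdom) ((derive1 phi x * derive1 psi x +
       k%:~R ^+ 2 * `|x| `^ (2 * alpha) * (phi x * psi x)) * Rweight alpha x).
Proof.
move=> cf cg; have [a [b [a0 s]]] := Cc1_supp cf.
have cw x : x != 0 -> {for x, continuous (Rweight alpha)} by exact: norm_powR_cont.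
have cc f x : Cc1 f -> {for x, continuous f}.
  by move=> c; exact: isd_continuous (Cc1_isd c x).
have cc1 f x : Cc1 f -> {for x, continuous (derive1 f)}.
  by move=> c; exact: isd_continuous (Cc1_isd2 c x).
pose v x : R := k%:~R ^+ 2 * `|x| `^ (2 * alpha) * (phi x * psi x) * Rweight alpha x.
have cv x : x != 0 -> {for x, continuous v}.
  move=> x0; apply: cvgM; last exact: cw.
  apply: cvgM; last by apply: cvgM; exact: cc.
  by apply: cvgM; [exact: cvg_cst|exact: norm_powR_cont].
have sv : supp a b v by move=> x hx; rewrite /v s// mul0r mulr0 mul0r.
have iv := supp_integrable_Rdom a0 sv cv.
pose e x : R := derive1 phi x * derive1 psi x * Rweight alpha x.
have ce x : x != 0 -> {for x, continuous e}.
  by move=> x0; apply: cvgM; [apply: cvgM; exact: cc1|exact: cw].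
have se : supp a b e by do 2 apply: suppM; exact: supp_der.
have ie := supp_integrable_Rdom a0 se ce.
pose f x : R := (derive1 (derive1 phi) x - alpha / x * derive1 phi x) * psi x * Rweight alpha x.
have cff x : x != 0 -> {for x, continuous f}.
  move=> x0; apply: cvgM; last exact: cw.
  apply: cvgM; last exact: cc.
  apply: cvgB; first exact: Cc1_cont2.
  apply: cvgM; last exact: cc1.
  apply: cvgM; first exact: cvg_cst.
  exact: isd_continuous (isdV x0 (isd_id x)).
have sf : supp a b f.
  do 2 apply: suppM; move=> x hx.
  by rewrite (supp_der s)// (supp_der (supp_der s))// mulr0 subr0.
have iff' := supp_integrable_Rdom a0 sf cff.
have E := @radial_by_parts alpha a b phi (derive1 phi) (derive1 (derive1 phi)) psi
  (derive1 psi) a0 (supp_der s) (supp_der (supp_der s)) (fun x _ => Cc1_isd2 cf x)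
  (fun x _ => Cc1_isd cg x) (fun x _ => @Cc1_cont2 phi cf x) (fun x _ => cc1 psi x cg).
transitivity (\int[mu]_(x in Rdom) f x - \int[mu]_(x in Rdom) v x).
  rewrite -RintegralB//; last exact: measurable_Rdom.
  by apply: eq_Rintegral => x _; rewrite /LBk /f /v; ring.
rewrite E -opprD -RintegralD//; last exact: measurable_Rdom.
by congr (- _); apply: eq_Rintegral => x _; rewrite /e /v; ring.
Qed.

Lemma LBk_sym alpha k phi psi : Cc1 phi -> Cc1 psi ->
  ip mu Rdom (Rweight alpha) (LBk alpha k phi) psi =
  ip mu Rdom (Rweight alpha) phi (LBk alpha k psi).
Proof.
move=> cf cg; rewrite [RHS]ipC !LBk_form//; congr (- _).
by apply: eq_Rintegral => x _; ring.
Qed.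

Lemma LBk_le0 alpha k phi : Cc1 phi ->
  ip mu Rdom (Rweight alpha) (LBk alpha k phi) phi <= 0.
Proof.
move=> cf; rewrite LBk_form// oppr_le0; apply: Rintegral_ge0 => x x0.
rewrite mulr_ge0 ?(ltW (Rweight_gt0 _ _))// -!expr2 addr_ge0 ?sqr_ge0//.
by rewrite mulr_ge0 ?sqr_ge0// mulr_ge0 ?sqr_ge0 ?powR_ge0.
Qed.

End PuncturedLine.

(** * Kernel on the punctured line and essential self-adjointness of the Fourier components *)

Section KernelPuncturedLine.
Context {R : realType}.
Implicit Types (f g u phi psi F : R -> R) (a b x y alpha kk : R).
Notation mu := (@lebesgue_measure R).
Notation isd x f a := (is_derive (x : R) (1 : R) (f : R -> R) (a : R)).
Notation Pos := (`]0%R, +oo[%classic : set R).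
Notation Neg := (`]-oo, 0%R[%classic : set R).

Lemma RdomE : @Rdom R = Neg `|` Pos.
Proof.
apply/seteqP; split => x.
  by rewrite /Rdom/= !in_itv/= andbT neq_lt => /orP.
by rewrite /Rdom/= !in_itv/= andbT neq_lt => h; apply/orP.
Qed.

Lemma Pos_sub_Rdom : Pos `<=` @Rdom R.
Proof. by rewrite RdomE; exact: subsetUr. Qed.

Lemma Neg_sub_Rdom : Neg `<=` @Rdom R.
Proof. by rewrite RdomE; exact: subsetUl. Qed.

(** Lebesgue measure is invariant under negation; the change of variables is made for the positive
    and negative parts separately. *)
Lemma integral_reflect (f : R -> \bar R) : measurable_fun Neg f ->
  (\int[mu]_(x in Neg) f x = \int[mu]_(x in Pos) f (- x)%R)%E.
Proof.
have preE : (-%R : R -> measurableTypeR R) @^-1` Neg = Pos.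
  by apply/seteqP; split => x /=; rewrite !in_itv/= ?andbT oppr_lt0.
have ge0 (h : R -> \bar R) : measurable_fun Neg h -> (forall x, (0 <= h x)%E) ->
    (\int[mu]_(x in Neg) h x = \int[mu]_(x in Pos) h (- x)%R)%E.
  move=> mh h0; rewrite -preE -ge0_integral_pushforward//=.
  by apply: eq_measure_integral => //= A mA AS; exact/esym/lebesgue_measureN.
move=> mf; rewrite integralE [RHS]integralE; congr (_ - _)%E.
  rewrite ge0; [by apply: eq_integral => x _; rewrite !funeposE|
    exact: measurable_funepos|exact: funepos_ge0].
rewrite ge0; [by apply: eq_integral => x _; rewrite !funenegE|
  exact: measurable_funeneg|exact: funeneg_ge0].
Qed.

Lemma Rintegral_Rdom_split f : mu.-integrable Rdom (EFin \o f) ->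
  \int[mu]_(x in Rdom) f x = \int[mu]_(x in Pos) f x + \int[mu]_(x in Pos) f (- x).
Proof.
move=> fi; rewrite RdomE in fi *; rewrite Rintegral_setU//.
  rewrite addrC; congr (_ + _); congr fine; rewrite integral_reflect//.
  apply: (measurable_funS _ (@subsetUl _ Neg Pos) (measurable_int mu fi)).
  exact: measurableU.
apply/disj_setPS => x [] /=; rewrite !in_itv/= ?andbT => h1 h2.
by have := lt_trans h1 h2; rewrite ltxx.
Qed.

Lemma measurable_reflect f : measurable_fun Neg f -> measurable_fun Pos (fun x => f (- x)).
Proof.
move=> mf; apply: (measurable_comp (F := Neg) (f := f)) => //.
by move=> y [x /=]; rewrite !in_itv/= ?andbT => x0 <-; rewrite oppr_lt0.
Qed.

Lemma integrable_reflect f : mu.-integrable Neg (EFin \o f) ->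
  mu.-integrable Pos (EFin \o (fun x => f (- x))).
Proof.
move=> /integrableP[mf fi]; apply/integrableP; split.
  by apply/measurable_EFinP; apply: measurable_reflect; exact/measurable_EFinP.
rewrite -(integral_reflect (f := fun x => `|(f x)%:E|%E))//.
exact: measurableT_comp.
Qed.

Lemma CcP_Cc1 phi : CcP phi -> Cc1 phi.
Proof.
move=> [s [a [b [a0 ab z]]]]; split; first by move=> k; exact: CkUT_Ck1.
exists a, b; split => // x h.
have /andP[ax xb] : a < x < b by apply: contraNT h => /z ->.
by rewrite gtr0_norm ?(lt_trans a0)// !ltW.
Qed.

Lemma CcP_neg0 phi x : CcP phi -> x <= 0 -> phi x = 0.
Proof.
move=> [s [a [b [a0 ab z]]]] x0; apply: z.
by rewrite negb_and -leNgt (le_trans x0 (ltW a0)).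
Qed.

Lemma isd_reflect phi x a : isd (- x) phi a -> isd x (fun y => phi (- y)) (- a).
Proof.
move=> h; rewrite -mulrN1.
exact: (isd_comp (f := phi) (g := fun y => - y) h (isdN (isd_id x))).
Qed.

Lemma Cc1_reflect phi : Cc1 phi -> Cc1 (fun x => phi (- x)).
Proof.
move=> [s [a [b [a0 h]]]]; split.
  move=> k; apply: CkUT_Ck1; have := CkUT_affine (-1) 0 (Ck1_CkUT (s k)).
  by apply: CkU_eq; [exact: openT|move=> x _; rewrite mulN1r addr0].
by exists a, b; split => // x /h; rewrite normrN.
Qed.

Lemma Pos_kernel alpha kk (u : R -> R) : 0 <= kk ->
  (alpha <= -3 \/ 1 <= alpha \/ (alpha <= -1 /\ 1 <= kk)) ->
  measurable_fun Pos u ->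
  mu.-integrable Pos (EFin \o (fun x => u x * u x * Rweight alpha x)) ->
  (forall phi, CcP phi ->
    \int[mu]_(x in Pos) ((derive1 (derive1 phi) x - alpha / x * derive1 phi x
       - (kk * `|x| `^ (2 * alpha) + 1) * phi x) * u x * Rweight alpha x) = 0) ->
  \int[mu]_(x in Pos) (u x * u x * Rweight alpha x) = 0.
Proof.
move=> kk0 hyp mu_ iu weak.
have wE x : Pos x -> `|x| = x.
  by rewrite /= in_itv/= andbT => x0; rewrite gtr0_norm.
have : {ae mu, forall x, Pos x -> u x = 0}.
  apply: (half_line_kernel kk0 hyp) => //.
    apply: eq_integrable iu => // x; rewrite inE => x0.
    by rewrite /= /Rweight wE// expr2.
  move=> phi cphi; rewrite -[RHS](weak phi cphi).
  by apply: eq_Rintegral => x; rewrite inE => x0; rewrite /Rweight wE.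
move=> u0; suff -> : \int[mu]_(x in Pos) (u x * u x * Rweight alpha x) = \int[mu]_(x in Pos) 0.
  by rewrite /Rintegral integral0.
congr fine; apply: ae_eq_integral => //; first exact: measurable_int iu.
by apply: aeS u0 => x ux x0; rewrite (ux x0) mul0r mul0r.
Qed.

(** Test functions supported on one side decouple the two half-lines. The operator commutes with [x]
    to [- x], so the left half is the right half for the reflected function. *)
Lemma punctured_kernel alpha kk (u : R -> R) : 0 <= kk ->
  (alpha <= -3 \/ 1 <= alpha \/ (alpha <= -1 /\ 1 <= kk)) ->
  L2 mu Rdom (Rweight alpha) u ->
  (forall phi, Cc1 phi ->
    \int[mu]_(x in Rdom) ((derive1 (derive1 phi) x - alpha / x * derive1 phi x
       - (kk * `|x| `^ (2 * alpha) + 1) * phi x) * u x * Rweight alpha x) = 0) ->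
  ip mu Rdom (Rweight alpha) u u = 0.
Proof.
move=> kk0 hyp Lu weak.
have mRd := @measurable_Rdom R.
have mw := @measurable_Rweight R alpha.
have w0 := @Rweight_gt0 R alpha.
have iuu := @L2_mul_integrable _ _ _ mu _ _ mRd mw w0 _ _ Lu Lu.
have mu_ : measurable_fun Rdom u by case: Lu.
pose T phi x : R := derive1 (derive1 phi) x - alpha / x * derive1 phi x
       - (kk * `|x| `^ (2 * alpha) + 1) * phi x.
have iT phi : Cc1 phi -> mu.-integrable Rdom (EFin \o (fun x => T phi x * u x * Rweight alpha x)).
  move=> cphi; apply: L2_mul_integrable => //.
  have [a [b [a0 s]]] := Cc1_supp cphi.
  apply: (@supp_L2 _ alpha a b) => //.
    move=> x hx; rewrite /T (supp_der s)// (supp_der (supp_der s))// s//.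
    by rewrite !mulr0 !subr0.
  move=> x x0; apply: cvgB.
    apply: cvgB; first exact: (@Cc1_cont2 _ phi).
    apply: cvgM; last exact: isd_continuous (Cc1_isd2 cphi x).
    apply: cvgM; first exact: cvg_cst.
    exact: isd_continuous (isdV x0 (isd_id x)).
  apply: cvgM; last exact: isd_continuous (Cc1_isd cphi x).
  apply: cvgD; last exact: cvg_cst.
  by apply: cvgM; [exact: cvg_cst|exact: norm_powR_cont].
have weak' phi : Cc1 phi -> \int[mu]_(x in Rdom) (T phi x * u x * Rweight alpha x) = 0 := weak phi.
rewrite /ip Rintegral_Rdom_split//.
have d1neg phi x : CcP phi -> x < 0 -> T phi x = 0.
  move=> cphi x0; rewrite /T (CcP_neg0 cphi (ltW x0)).
  rewrite (CcP_neg0 (CcP_der cphi) (ltW x0)) (CcP_neg0 (CcP_der (CcP_der cphi)) (ltW x0)).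
  by rewrite !mulr0 !subr0.
have -> : \int[mu]_(x in Pos) (u x * u x * Rweight alpha x) = 0.
  apply: (Pos_kernel kk0 hyp).
  - by apply: measurable_funS mu_ => //; exact: Pos_sub_Rdom.
  - by apply: integrableS iuu => //; exact: Pos_sub_Rdom.
  - move=> phi cphi; have c1 := CcP_Cc1 cphi.
    rewrite -[RHS](weak' phi c1) Rintegral_Rdom_split; last exact: iT.
    rewrite [X in _ + X](_ : _ = 0) ?addr0//.
    rewrite /Rintegral integral0_eq// => x; rewrite /= in_itv/= andbT => x0.
    by rewrite d1neg// ?mul0r// oppr_lt0.
rewrite add0r.
pose v x := u (- x).
have wN x : Rweight alpha (- x) = Rweight alpha x by rewrite /Rweight normrN.
transitivity (\int[mu]_(x in Pos) (v x * v x * Rweight alpha x)).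
  by apply: eq_Rintegral => x _; rewrite wN.
apply: (Pos_kernel kk0 hyp).
- apply: measurable_reflect; apply: measurable_funS mu_ => //; exact: Neg_sub_Rdom.
- have h : mu.-integrable Neg (EFin \o (fun x => u x * u x * Rweight alpha x)).
    by apply: integrableS iuu => //; exact: Neg_sub_Rdom.
  by have := integrable_reflect h; apply: eq_integrable => // x _; rewrite /= wN.
- move=> phi cphi; have c1 := Cc1_reflect (CcP_Cc1 cphi).
  have := weak' _ c1; rewrite Rintegral_Rdom_split; last exact: iT.
  have dE : derive1 (fun x => phi (- x)) = fun x => - derive1 phi (- x).
    by apply/funext => x; apply: isd_val; apply: isd_reflect; exact: CcP_isd.
  have ddE x : derive1 (fun x => - derive1 phi (- x)) x = derive1 (derive1 phi) (- x).
    apply: isd_val; rewrite -[X in is_derive _ _ _ X]opprK; apply: isdN.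
    by apply: isd_reflect; apply: CcP_isd; exact: CcP_der.
  have TE x : T (fun x => phi (- x)) (- x) = T phi x.
    by rewrite /T dE ddE !opprK normrN invrN; ring.
  rewrite [X in X + _](_ : _ = 0) ?add0r; last first.
    rewrite /Rintegral integral0_eq// => x; rewrite /= in_itv/= andbT => x0.
    by rewrite -[x in T _ x]opprK TE d1neg ?mul0r// oppr_lt0.
  by move=> E; rewrite -[RHS]E; apply: eq_Rintegral => x _; rewrite TE wN.
Qed.

Lemma LBk_ess_self_adjoint alpha (k : int) :
  (alpha <= -3 \/ 1 <= alpha \/ (alpha <= -1 /\ k != 0)) -> LBk_ess_sa alpha k.
Proof.
move=> hyp.
apply: ess_self_adjoint_crit.
- exact: measurable_Rdom.
- exact: measurable_Rweight.
- exact: Rweight_gt0.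
- exact: Cc1_L2.
- by move=> phi; exact: LBk_L2.
- exact: Cc1_zero.
- exact: Cc1_lin.
- by move=> a phi psi; exact: LBk_lin.
- by move=> phi psi; exact: LBk_sym.
- by move=> phi; exact: LBk_le0.
- move=> u Lu h; apply: (@punctured_kernel alpha (k%:~R ^+ 2)) => //.
  + exact: sqr_ge0.
  + have [?|[?|[? k0]]] := hyp; [by left|by right; left|right; right; split => //].
    (* A nonzero integer has square at least 1, which is the bound that the borderline case
       needs. *)
    by rewrite -rmorphXn/= ler1z -gtz0_ge1 exprn_even_gt0.
  + move=> phi cphi; rewrite -[RHS](h phi cphi); apply: eq_Rintegral => x _.
    by rewrite /LBk /=; ring.
Qed.

End KernelPuncturedLine.

(** * The limit circle case: elements of the adjoint that break symmetry *)

Section NotEssentiallySelfAdjoint.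
Context {R : realType}.
Implicit Types (f g h u phi : R -> R) (a b x y p C : R).
Notation mu := (@lebesgue_measure R).
Notation isd x f a := (is_derive (x : R) (1 : R) (f : R -> R) (a : R)).
Notation Pos := (`]0%R, +oo[%classic : set R).
Notation I01 := (`]0%R, 1%R]%classic : set R).

Lemma I01_sub : I01 `<=` Pos.
Proof. by move=> x /=; rewrite !in_itv/= andbT => /andP[]. Qed.

(** By exhaustion with [[1 / (i + 1), 1]], where the integrals stay below [1 / (p + 1)]. *)
Lemma powR_integrable01 p : -1 < p -> mu.-integrable I01 (EFin \o (fun x => x `^ p)).
Proof.
move=> p1.
have p10 : 0 < p + 1 by lra.
have mf : measurable_fun I01 (fun x : R => (x `^ p)%:E).
  by apply/measurable_EFinP; apply: measurable_funTS; exact: measurable_powR.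
apply/integrableP; split => //.
under eq_integral do rewrite /= ger0_norm ?powR_ge0//.
pose F i := `[(i.+1%:R^-1 : R), 1]%classic.
have FU : \bigcup_i F i = I01.
  apply/seteqP; split => x /=.
    move=> [i _]; rewrite /F /= !in_itv/= => /andP[ix ->]; rewrite andbT.
    by apply: lt_le_trans ix; rewrite invr_gt0.
  rewrite in_itv/= => /andP[x0 x1].
  exists (Num.truncn x^-1) => //; rewrite /F /= in_itv/= x1 andbT.
  by rewrite invf_ple ?posrE// ltW// truncnS_gt.
have sF i : F i `<=` I01 by rewrite -FU; exact: bigcup_sup.
have nF : nondecreasing_seq F.
  move=> i j ij; apply/subsetPset => x; rewrite /F /= !in_itv/= => /andP[ix ->].
  rewrite andbT; apply: le_trans ix; rewrite lef_pV2 ?posrE// ler_nat ltnS //.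
have := @ge0_nondecreasing_set_cvg_integral _ (measurableTypeR R) R F
  (fun x => (x `^ p)%:E) mu nF.
move=> H; have {H} : (\int[mu]_(x in F i) (x `^ p)%:E)%E @[i --> \oo] -->
    (\int[mu]_(x in \bigcup_i F i) (x `^ p)%:E)%E.
  apply: H.
  - by move=> i; exact: measurable_itv.
  - by move=> i; apply: measurable_funS mf => //; exact: sF.
  - by move=> i x _; rewrite lee_fin powR_ge0.
rewrite FU => /cvg_lim <-//; apply: (@le_lt_trans _ _ ((p + 1)^-1)%:E); last by rewrite ltry.
apply: lime_le.
  apply: ereal_nondecreasing_is_cvgn => i j ij.
  apply: ge0_subset_integral => //; try exact: measurable_itv.
  - by apply: measurable_funS mf => //; exact: sF.
  - by move=> x _; rewrite lee_fin powR_ge0.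
  - by apply/subsetPset; exact: nF.
near=> i.
have i0 : 0 < i.+1%:R^-1 :> R by rewrite invr_gt0.
have i1 : i.+1%:R^-1 <= 1 :> R by rewrite invf_le1// ler1n.
have fin : mu.-integrable (F i) (EFin \o (fun x => x `^ p)).
  apply: cont_itv_integrable => x /andP[ix _].
  exact: isd_continuous (isd_powR p (lt_le_trans i0 ix)).
rewrite -[X in (X <= _)%E]fineK; last first.
  by apply: integrable_fin_num; [exact: measurable_itv|exact: fin].
rewrite lee_fin -/(Rintegral mu (F i) (fun x => x `^ p)).
have -> : \int[mu]_(x in F i) x `^ p = (p + 1)^-1 * 1 `^ (p + 1) -
    (p + 1)^-1 * i.+1%:R^-1 `^ (p + 1).
  apply: (@FTC2 _ _ _ (fun x => x `^ p) (fun x => (p + 1)^-1 * x `^ (p + 1))) => //.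
    move=> x /andP[ix _]; have x0 := lt_le_trans i0 ix.
    apply: isd_eq (isdZ (p + 1)^-1 (isd_powR (p + 1) x0)) _.
    by rewrite addrK mulrA mulVf ?mul1r// gt_eqF.
  move=> x /andP[ix _].
  exact: isd_continuous (isd_powR p (lt_le_trans i0 ix)).
rewrite powR1 mulr1 lerBlDr lerDl mulr_ge0 ?powR_ge0// invr_ge0 ltW//.
Unshelve. all: by end_near. Qed.

Lemma restr_L2 alpha f p C : -1 < p ->
  (forall x, 0 < x -> {for x, continuous f}) ->
  (forall x, 0 < x <= 1 -> f x ^+ 2 * x `^ (- alpha) <= C * x `^ p) ->
  L2 mu Rdom (Rweight alpha) (f \_ I01).
Proof.
move=> p1 cf bf.
have sub : @Rdom R `&` I01 = I01.
  by apply/setIidPr => x /I01_sub; exact: Pos_sub_Rdom.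
have mfI : measurable_fun I01 f.
  apply: measurable_funS I01_sub _ => //.
  apply: open_continuous_measurable_fun; first by apply: interval_open.
  by move=> x; rewrite inE/= in_itv/= andbT; exact: cf.
have mpow : measurable_fun I01 (fun x : R => x `^ (- alpha)).
  by apply: measurable_funTS; exact: measurable_powR.
apply: sq_integrable_L2; first exact: measurable_Rdom.
  apply/measurable_restrict => //; first exact: measurable_Rdom.
  by rewrite sub.
have i1 : mu.-integrable I01 (EFin \o (fun x => f x ^+ 2 * x `^ (- alpha))).
  have i0 := @integrableZl _ _ _ mu _ (measurable_itv _) C _ (powR_integrable01 p1).
  apply: le_integrable i0 => //.
    by apply/measurable_EFinP; apply: measurable_funM => //; exact: measurable_funX.
  move=> x; rewrite /= in_itv/= => /bf h; rewrite lee_fin ger0_norm; last first.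
    by rewrite mulr_ge0 ?sqr_ge0 ?powR_ge0.
  by apply: le_trans h _; exact: ler_norm.
rewrite (_ : (fun x => (f \_ I01) x ^+ 2 * Rweight alpha x) =
    (fun x => f x ^+ 2 * `|x| `^ (- alpha)) \_ I01); last first.
  by apply/funext => x; rewrite /patch; case: ifP => // _; rewrite expr0n mul0r.
rewrite -restrict_EFin; apply/integrable_restrict => //; first exact: measurable_Rdom.
rewrite sub; apply: eq_integrable i1 => // x; rewrite inE/= in_itv/= => /andP[x0 _].
by rewrite gtr0_norm.
Qed.

Lemma Rintegral_restr01 f : \int[mu]_(x in Rdom) (f \_ I01) x = \int[mu]_(x in I01) f x.
Proof.
rewrite -Rintegral_mkcondr; congr (Rintegral _ _ _).
by apply/setIidPr => x /I01_sub; exact: Pos_sub_Rdom.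
Qed.

Section Cutoff.
Variables (alpha kk : R) (h h' : R -> R).
Hypothesis dh : forall x, 0 < x -> isd x h (h' x).
Hypothesis dh' : forall x, 0 < x ->
  isd x h' (alpha / x * h' x + kk * x `^ (2 * alpha) * h x).

(** The factor (1 - x^2)^2 has a double zero at 1, so [U] and [U'] both vanish there and extension
    by 0 creates no boundary term. Its derivative is divisible by [x], which cancels [alpha / x] and
    lets [h'] enter the image only as [x h']. *)
Let U x := (1 - x ^+ 2) ^+ 2 * h x.
Let U' x := - 4 * x * (1 - x ^+ 2) * h x + (1 - x ^+ 2) ^+ 2 * h' x.
(* U'' - (alpha / x) U' - kk x^(2 alpha) U, simplified by the equation for h *)
Let V x := (12 * x ^+ 2 - 4 + 4 * alpha * (1 - x ^+ 2)) * h x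
  - 8 * (1 - x ^+ 2) * (x * h' x).

Definition cutoff : R -> R := U \_ I01.
Definition cutoff_image : R -> R := V \_ I01.

Let ch x : 0 < x -> {for x, continuous h}.
Proof. by move=> /dh/isd_continuous. Qed.

Let ch' x : 0 < x -> {for x, continuous h'}.
Proof. by move=> /dh'/isd_continuous. Qed.

Let dq x : isd x (fun y => 1 - y ^+ 2) (- (2 * x)).
Proof. by apply: isd_eq (isdB (isd_cst x 1) (isdX 2 (isd_id x))) _; rewrite /=; ring. Qed.

Let dU x : 0 < x -> isd x U (U' x).
Proof.
by move=> x0; apply: isd_eq (isdM (isdX 2 (dq x)) (dh x0)) _; rewrite /U' /=; ring.
Qed.

Let dU' x : 0 < x -> isd x U' (V x + alpha / x * U' x + kk * x `^ (2 * alpha) * U x).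
Proof.
move=> x0; have xn : x != 0 by rewrite gt_eqF.
apply: isd_eq (isdD (isdM (isdM (isdZ (- 4) (isd_id x)) (dq x)) (dh x0))
  (isdM (isdX 2 (dq x)) (dh' x0))) _.
by rewrite /V /U' /U /=; field.
Qed.

Let cU x : 0 < x -> {for x, continuous U}.
Proof. by move=> /dU/isd_continuous. Qed.

Let cV x : 0 < x -> {for x, continuous V}.
Proof.
move=> x0; have cq := isd_continuous (dq x).
have c2 : {for x, continuous (fun x => x ^+ 2)} := isd_continuous (isdX 2 (isd_id x)).
apply: cvgB.
  apply: cvgM; last exact: ch.
  apply: cvgD; last by apply: cvgM; [exact: cvg_cst|exact: cq].
  by apply: cvgB; last exact: cvg_cst; apply: cvgM; [exact: cvg_cst|exact: c2].
apply: cvgM; first by apply: cvgM; [exact: cvg_cst|exact: cq].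
by apply: cvgM; [exact: isd_continuous (isd_id x)|exact: ch'].
Qed.

Section Bounds.
Variables (p C : R).
Hypothesis p1 : -1 < p.
Hypothesis bh : forall x, 0 < x <= 1 -> h x ^+ 2 * x `^ (- alpha) <= C * x `^ p.
Hypothesis bh' : forall x, 0 < x <= 1 -> (x * h' x) ^+ 2 * x `^ (- alpha) <= C * x `^ p.

Lemma cutoff_L2 : L2 mu Rdom (Rweight alpha) cutoff.
Proof.
apply: (@restr_L2 alpha U p C) => // x /andP[x0 x1].
apply: le_trans (bh (x := x) _); last by rewrite x0.
rewrite ler_wpM2r ?powR_ge0// /U exprMn ler_piMl ?sqr_ge0// -exprM exprn_ile1//.
  by rewrite subr_ge0 exprn_ile1// ltW.
by rewrite lerBlDr lerDl sqr_ge0.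
Qed.

Lemma cutoff_image_L2 : L2 mu Rdom (Rweight alpha) cutoff_image.
Proof.
(* A crude bound for the coefficient of [h] in [V] on []0, 1]]. In the constant below, 128 is twice
   8^2, by [(A - B)^2 <= 2 A^2 + 2 B^2]. *)
pose M := 16 + 4 * `|alpha|.
apply: (@restr_L2 alpha V p ((2 * M ^+ 2 + 128) * C)) => // x /andP[x0 x1].
have x01 : 0 < x <= 1 by rewrite x0.
have w0 : 0 <= x `^ (- alpha) by exact: powR_ge0.
have q0 : 0 <= 1 - x ^+ 2 by rewrite subr_ge0 exprn_ile1// ltW.
have q1 : 1 - x ^+ 2 <= 1 by rewrite lerBlDr lerDl sqr_ge0.
have x2 : 0 <= x ^+ 2 by rewrite sqr_ge0.
set q := 1 - x ^+ 2 in q0 q1.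
have M0 : 0 <= M by rewrite addr_ge0// mulr_ge0.
have cM : (12 * x ^+ 2 - 4 + 4 * alpha * q) ^+ 2 <= M ^+ 2.
  rewrite -[leLHS]real_normK ?num_real// ler_sqr ?nnegrE//.
  apply: le_trans (ler_normD _ _) _; rewrite /M.
  apply: lerD.
    by rewrite ler_norml; apply/andP; split; [lra|rewrite /q in q0; lra].
  rewrite !normrM (ger0_norm q0) ger0_norm// ler_piMr// mulr_ge0//.
have VV : V x ^+ 2 <= 2 * M ^+ 2 * h x ^+ 2 + 128 * (x * h' x) ^+ 2.
  rewrite /V -/q; set c := (12 * _ - 4 + _) in cM *.
  have e1 : (c * h x) ^+ 2 <= M ^+ 2 * h x ^+ 2 by rewrite exprMn ler_wpM2r ?sqr_ge0.
  have e2 : (8 * q * (x * h' x)) ^+ 2 <= 64 * (x * h' x) ^+ 2.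
    rewrite exprMn ler_wpM2r ?sqr_ge0// exprMn.
    have : q ^+ 2 <= 1 by rewrite exprn_ile1.
    lra.
  set A := c * h x in e1 *; set B := 8 * q * (x * h' x) in e2 *.
  have := sqr_ge0 (A + B).
  have : (A - B) ^+ 2 + (A + B) ^+ 2 = 2 * A ^+ 2 + 2 * B ^+ 2 by ring.
  lra.
apply: le_trans (ler_wpM2r w0 VV) _.
have b1 := bh x01; have b2 := bh' x01.
have M2 : 0 <= 2 * M ^+ 2 by rewrite mulr_ge0 ?sqr_ge0.
have := ler_wpM2l M2 b1; lra.
Qed.

End Bounds.

(** Lagrange's identity: the integrand is the derivative of [x^(-alpha) (phi' U - phi U')], which
    vanishes near 0 with [phi] and at 1 with [U] and [U']. The derivatives of [phi] are separate
    arguments so that slices of a function on the surface can be used. *)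
Lemma cutoff_green a b (phi phi' phi'' : R -> R) : 0 < a ->
  supp a b phi -> supp a b phi' ->
  (forall x, isd x phi (phi' x)) -> (forall x, isd x phi' (phi'' x)) ->
  (forall x, {for x, continuous phi''}) ->
  \int[mu]_(x in Rdom) (((phi'' x - alpha / x * phi' x - kk * `|x| `^ (2 * alpha) * phi x)
     * cutoff x - phi x * cutoff_image x) * Rweight alpha x) = 0.
Proof.
move=> a0 s s' d d' c2.
(* Any point below both the support of [phi] and 1. *)
pose e := Num.min a 1 / 2.
have m0 : 0 < Num.min a 1 by rewrite lt_min a0 ltr01.
have e0 : 0 < e by rewrite divr_gt0.
have ea : e < a by apply: (@lt_le_trans _ _ (Num.min a 1)); [rewrite /e; lra|rewrite ge_min lexx].
have e1 : e < 1.
  by apply: (@lt_le_trans _ _ (Num.min a 1)); [rewrite /e; lra|rewrite ge_min lexx orbT].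
have se x : 0 < x -> x <= e -> ~~ (a <= `|x| <= b).
  by move=> x0 xe; rewrite negb_and -!ltNge gtr0_norm// (le_lt_trans xe).
pose G x := x `^ (- alpha) * ((phi'' x - alpha / x * phi' x - kk * x `^ (2 * alpha) * phi x)
     * U x - phi x * V x).
pose F x := x `^ (- alpha) * (phi' x * U x - phi x * U' x).
have dF x : 0 < x -> isd x F (G x).
  move=> x0; have xn : x != 0 by rewrite gt_eqF.
  apply: isd_eq (isdM (isd_powR (- alpha) x0) (isdB (isdM (d' x) (dU x0)) (isdM (d x) (dU' x0)))) _.
  rewrite powRB1// /G; move: (U x) (U' x) (V x) (x `^ (2 * alpha)) => u u' v t.
  by field.
have cphi x : {for x, continuous phi} by exact: isd_continuous (d x).
have cphi' x : {for x, continuous phi'} by exact: isd_continuous (d' x).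
have cG x : 0 < x -> {for x, continuous G}.
  move=> x0; have xn : x != 0 by rewrite gt_eqF.
  have cp r : {for x, continuous (fun x => x `^ r)} by exact: isd_continuous (isd_powR r x0).
  apply: cvgM; first exact: cp.
  apply: cvgB; last by apply: cvgM; [exact: cphi|exact: cV].
  apply: cvgM; last exact: cU.
  apply: cvgB.
    apply: cvgB; first exact: c2.
    apply: cvgM; last exact: cphi'.
    by apply: cvgM; [exact: cvg_cst|exact: isd_continuous (isdV xn (isd_id x))].
  by apply: cvgM; [apply: cvgM; [exact: cvg_cst|exact: cp]|exact: cphi].
transitivity (\int[mu]_(x in Rdom) (G \_ I01) x).
  apply: eq_Rintegral => x _; rewrite /cutoff /cutoff_image /patch.
  case: ifPn => [|_]; last by rewrite !mulr0 subrr mul0r.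
  by rewrite inE/= in_itv/= => /andP[x0 _]; rewrite /G /Rweight gtr0_norm// mulrC.
rewrite Rintegral_restr01.
have GI : {in I01, G \_ `[e, 1]%classic =1 G}.
  move=> x; rewrite inE/= in_itv/= => /andP[x0 x1].
  rewrite /patch mem_setE in_itv/= x1 andbT; case: ifPn => //; rewrite -ltNge => /ltW xe.
  have hx := se x x0 xe.
  have p2 : phi'' x = 0 by rewrite -(isd_val (d' x)); exact: isd_val (supp_isd s' hx).
  by rewrite /G s// s'// p2 !mulr0 !subr0 !mul0r subr0 mulr0.
transitivity (\int[mu]_(x in `[e, 1]) G x).
  have sub : I01 `&` `[e, 1]%classic = `[e, 1]%classic.
    apply/setIidPr => x /=; rewrite !in_itv/= => /andP[ex ->].
    by rewrite (lt_le_trans e0).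
  by rewrite -sub Rintegral_mkcondr; apply: eq_Rintegral => x xI; rewrite GI.
transitivity (F 1 - F e).
  apply: (@FTC2 _ _ _ G F); first exact: ltW.
    by move=> x /andP[ex _]; apply: dF; exact: lt_le_trans ex.
  by move=> x /andP[ex _]; apply: cG; exact: lt_le_trans ex.
have := se e e0 (lexx e) => he.
by rewrite /F /U /U' (s e he) (s' e he) expr1n subrr expr0n /= !(mulr0, mul0r, addr0, subr0).
Qed.

End Cutoff.

(** The terms in [h1 h2] cancel, and the integrand is the derivative of the cutoff squared times the
    constant [W], that is of W (1 - x^2)^4, which falls from [W] at 0 to 0 at 1. *)
Lemma cutoff_wronskian alpha (h1 h1' h2 h2' : R -> R) W :
  (forall x, 0 < x -> h1' x * h2 x - h1 x * h2' x = W * x `^ alpha) ->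
  \int[mu]_(x in Rdom) ((cutoff_image alpha h1 h1' x * cutoff h2 x -
     cutoff h1 x * cutoff_image alpha h2 h2' x) * Rweight alpha x) = - W.
Proof.
move=> hW.
pose G x := W * (- 8 * x * (1 - x ^+ 2) ^+ 3) : R.
have cG x : {for x, continuous G}.
  have d1 : isd x (fun y => 1 - y ^+ 2) (- (2 * x)).
    by apply: isd_eq (isdB (isd_cst x 1) (isdX 2 (isd_id x))) _; rewrite /=; ring.
  exact: isd_continuous (isdZ W (isdM (isdZ (- 8) (isd_id x)) (isdX 3 d1))).
transitivity (\int[mu]_(x in Rdom) (G \_ I01) x).
  apply: eq_Rintegral => x _; rewrite /cutoff /cutoff_image /patch.
  case: ifPn => [|_]; last by rewrite !mulr0 subrr mul0r.
  rewrite inE/= in_itv/= => /andP[x0 _]; rewrite /G /Rweight gtr0_norm//.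
  have := hW x x0.
  have : x `^ alpha * x `^ (- alpha) = 1 by rewrite -powR_add// subrr powRr0.
  move: (h1 x) (h2 x) (h1' x) (h2' x) (x `^ alpha) (x `^ (- alpha)) => a b c d s t st E.
  transitivity (- 8 * x * (1 - x ^+ 2) ^+ 3 * (c * b - a * d) * t); first by ring.
  by rewrite E -[RHS]mulr1 -st; ring.
rewrite Rintegral_restr01 Rintegral_itv_obnd_cbnd; last first.
  apply: (@integrableS _ _ _ mu `[0, 1]) => //; first exact: subset_itv_oc_cc.
  by apply: cont_itv_integrable => x _; exact: cG.
transitivity (W * (1 - 1 ^+ 2) ^+ 4 - W * (1 - 0 ^+ 2) ^+ 4 : R); last by ring.
apply: (@FTC2 _ 0 1 G (fun x => W * (1 - x ^+ 2) ^+ 4)) => //.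
move=> x _.
have d1 : isd x (fun y => 1 - y ^+ 2) (- (2 * x)).
  by apply: isd_eq (isdB (isd_cst x 1) (isdX 2 (isd_id x))) _; rewrite /=; ring.
by apply: isd_eq (isdZ W (isdX 4 d1)) _; rewrite /G /=; ring.
Qed.

End NotEssentiallySelfAdjoint.

Section LimitCircle.
Context {R : realType}.
Implicit Types (h phi : R -> R) (x alpha kk k : R).
Notation mu := (@lebesgue_measure R).
Notation isd x f a := (is_derive (x : R) (1 : R) (f : R -> R) (a : R)).

(* If -1 < p, the bounds make h and x h' square integrable at 0+. *)
Record ode_solution alpha kk (p C : R) (h h' : R -> R) : Prop := OdeSolution {
  ode_der : forall x, 0 < x -> isd x h (h' x);
  ode_eq : forall x, 0 < x ->
    isd x h' (alpha / x * h' x + kk * x `^ (2 * alpha) * h x);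
  ode_bound : forall x, 0 < x <= 1 -> h x ^+ 2 * x `^ (- alpha) <= C * x `^ p;
  ode_bound' : forall x, 0 < x <= 1 -> (x * h' x) ^+ 2 * x `^ (- alpha) <= C * x `^ p }.

(* Weyl's limit circle case at 0+ *)
Definition limit_circle alpha kk := exists p C h1 h1' h2 h2' W,
  [/\ -1 < p, W != 0, ode_solution alpha kk p C h1 h1', ode_solution alpha kk p C h2 h2' &
      forall x, 0 < x -> h1' x * h2 x - h1 x * h2' x = W * x `^ alpha].

Lemma powR_le_exp (x p q : R) : 0 < x <= 1 -> p <= q -> x `^ q <= x `^ p.
Proof. by move=> x01 pq; exact: ger_powR. Qed.

Lemma powR_le1 (x q : R) : 0 < x <= 1 -> 0 <= q -> x `^ q <= 1.
Proof. by move=> x01 q0; rewrite -(powRr0 x); exact: powR_le_exp. Qed.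

(** For [alpha > -1] the equation factors through [h' = k x^alpha h], and both signs of [k] solve
    it. The exponential is bounded on []0, 1]], so [p = - alpha]; the factor [1 + k^2] covers the
    bounds on [h] and on [x h'] at once. *)
Lemma exp_solution alpha k : -1 < alpha < 1 ->
  ode_solution alpha (k ^+ 2) (- alpha)
    ((1 + k ^+ 2) * expR (`|k| / (1 + alpha)) ^+ 2)
    (fun x => expR (k / (1 + alpha) * x `^ (1 + alpha)))
    (fun x => k * x `^ alpha * expR (k / (1 + alpha) * x `^ (1 + alpha))).
Proof.
move=> /andP[a1 _]; have a0 : 0 < 1 + alpha by lra.
have an : 1 + alpha != 0 by rewrite gt_eqF.
set h := fun x => expR (k / (1 + alpha) * x `^ (1 + alpha)).
have dh x : 0 < x -> isd x h (k * x `^ alpha * h x).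
  move=> x0; apply: isd_eq (isd_expR (isdZ (k / (1 + alpha)) (isd_powR (1 + alpha) x0))) _.
  rewrite (_ : 1 + alpha - 1 = alpha); last by ring.
  by rewrite -/(h x); field.
have hb x : 0 < x <= 1 -> h x ^+ 2 <= expR (`|k| / (1 + alpha)) ^+ 2.
  move=> x01; rewrite ler_sqr ?nnegrE ?expR_ge0// ler_expR.
  have x1 := powR_le1 x01 (ltW a0); have xp := powR_ge0 x (1 + alpha).
  apply: (@le_trans _ _ (`|k| / (1 + alpha) * x `^ (1 + alpha))).
    by rewrite ler_wpM2r// ler_wpM2r ?ler_norm// invr_ge0 ltW.
  by rewrite ler_piMr// divr_ge0// ltW.
have E0 := sqr_ge0 (expR (`|k| / (1 + alpha))).
have k0 := sqr_ge0 k.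
split=> [x x0|x x0|x x01|x x01].
- exact: dh.
- have xn : x != 0 by rewrite gt_eqF.
  apply: isd_eq (isdM (isdZ k (isd_powR alpha x0)) (dh x x0)) _.
  rewrite powRB1// (_ : 2 * alpha = alpha + alpha); last by ring.
  by rewrite powR_add// -/(h x); field.
- rewrite ler_wpM2r ?powR_ge0//; apply: le_trans (hb x x01) _.
  by rewrite ler_peMl// lerDl.
- rewrite ler_wpM2r ?powR_ge0// -/(h x).
  have -> : x * (k * x `^ alpha * h x) = k * x `^ (1 + alpha) * h x.
    by case/andP: x01 => x0 _; rewrite powR_add// powRr1 ?(ltW x0)//; ring.
  rewrite exprMn; apply: ler_pM; rewrite ?sqr_ge0//; last exact: hb.
  rewrite exprMn; apply: (@le_trans _ _ (k ^+ 2)); last by rewrite lerDr.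
  by rewrite ler_piMr// exprn_ile1 ?powR_ge0// powR_le1// ltW.
Qed.

Lemma limit_circle_exp alpha k : -1 < alpha < 1 -> k != 0 -> limit_circle alpha (k ^+ 2).
Proof.
move=> al k0; have S1 := exp_solution k al; have S2 := exp_solution (- k) al.
rewrite sqrrN normrN in S2.
do 6 eexists; exists (2 * k); split; [|by rewrite mulf_neq0| exact: S1|exact: S2|].
  by case/andP: al; lra.
move=> x x0; rewrite !mulNr expRN.
set e := expR _; have e0 : e != 0 by rewrite gt_eqF// expR_gt0.
by field.
Qed.

Lemma const_solution alpha p (C : R) : p <= - alpha -> 1 <= C ->
  ode_solution alpha 0 p C (fun=> 1) (fun=> 0).
Proof.
move=> pa C1; have C0 : 0 <= C by lra.
split=> [x _|x x0|x x01|x x01].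
- exact: isd_cst.
- by apply: isd_eq (isd_cst x 0) _; rewrite mulr0 mul0r mul0r addr0.
- rewrite expr1n mul1r; apply: le_trans (powR_le_exp x01 pa) _.
  by rewrite ler_peMl ?powR_ge0.
- by rewrite mulr0 expr0n mul0r mulr_ge0 ?powR_ge0.
Qed.

(** For kk = 0 the solutions are 1 and x^(1 + alpha), with weighted squares x^(-alpha) and x^(2 +
    alpha). Both exponents exceed -1 exactly when -3 < alpha < 1. *)
Lemma limit_circle_pow alpha : -3 < alpha < 1 -> alpha != -1 -> limit_circle alpha 0.
Proof.
move=> /andP[a3 a1] an.
pose p := Num.min (- alpha) (2 + alpha).
have p1 : p <= - alpha by rewrite ge_min lexx.
have p2 : p <= 2 + alpha by rewrite ge_min lexx orbT.
pose C := 1 + (1 + alpha) ^+ 2.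
have C1 : 1 <= C by rewrite lerDl sqr_ge0.
exists p, C, (fun=> 1), (fun=> 0), (fun x => x `^ (1 + alpha)),
  (fun x => (1 + alpha) * x `^ alpha), (- (1 + alpha)); split.
- by rewrite lt_min; apply/andP; split; lra.
- by rewrite oppr_eq0 addrC addr_eq0.
- exact: const_solution.
- have E x : 0 < x -> (x `^ (1 + alpha)) ^+ 2 * x `^ (- alpha) = x `^ (2 + alpha).
    move=> x0; rewrite expr2 -!powR_add//; congr (_ `^ _); ring.
  split=> [x x0|x x0|x x01|x x01].
  + apply: isd_eq (isd_powR (1 + alpha) x0) _.
    by rewrite (_ : 1 + alpha - 1 = alpha)//; ring.
  + apply: isd_eq (isdZ (1 + alpha) (isd_powR alpha x0)) _.
    by rewrite powRB1// mul0r mul0r addr0; field; rewrite gt_eqF.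
  + case/andP: (x01) => x0 _; rewrite E//.
    apply: le_trans (powR_le_exp x01 p2) _.
    by rewrite ler_peMl ?powR_ge0.
  + case/andP: (x01) => x0 _.
    have -> : (x * ((1 + alpha) * x `^ alpha)) ^+ 2 * x `^ (- alpha) =
        (1 + alpha) ^+ 2 * x `^ (2 + alpha).
      rewrite -E// powR_add// powRr1 ?(ltW x0)//; ring.
    apply: ler_pM; rewrite ?sqr_ge0 ?powR_ge0//; last exact: powR_le_exp.
    by rewrite lerDr.
- by move=> x _; ring.
Qed.

(** At alpha = -1 the two powers coincide and the second solution becomes the logarithm. The
    constant 4 comes from [t <= expR t] at [t = - ln x / 2], which gives [x (ln x)^2 <= 4]. *)
Lemma limit_circle_log : limit_circle (-1) 0.
Proof.
exists 0, 4, (fun=> 1), (fun=> 0), (fun x => ln x), (fun x => x^-1), (-1); split.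
- by lra.
- by rewrite oppr_eq0 oner_eq0.
- by apply: const_solution; lra.
- split=> [x x0|x x0|x x01|x x01].
  + exact: is_derive1_ln.
  + have xn : x != 0 by rewrite gt_eqF.
    apply: isd_eq (isdV xn (isd_id x)) _.
    by rewrite mul0r mul0r addr0; field.
  + case/andP: x01 => x0 x1; rewrite opprK powRr1 ?(ltW x0)// powRr0 mulr1.
    pose t := - ln x / 2.
    have t0 : 0 <= t by rewrite /t divr_ge0// oppr_ge0 ln_le0.
    have te : t <= expR t by apply: le_trans (expR_ge1Dx t); rewrite lerDr.
    have e2 : expR t ^+ 2 = x^-1.
      rewrite expr2 -expRD (_ : t + t = - ln x); last by rewrite /t; field.
      by rewrite expRN lnK.
    have t2 : t ^+ 2 <= x^-1 by rewrite -e2 ler_sqr ?nnegrE ?expR_ge0.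
    rewrite (_ : ln x ^+ 2 = 4 * t ^+ 2); last by rewrite /t; field.
    have := ler_wpM2r (ltW x0) t2; rewrite mulVf ?gt_eqF//; lra.
  + case/andP: x01 => x0 x1; rewrite opprK powRr1 ?(ltW x0)// powRr0 mulr1.
    by rewrite divff ?gt_eqF// expr1n mul1r; lra.
- by move=> x x0; rewrite powR_inv1 ?ltW//; ring.
Qed.

Lemma limit_circleP alpha k : -3 < alpha < 1 -> k = 0 \/ -1 < alpha ->
  limit_circle alpha (k ^+ 2).
Proof.
move=> a31 hk; have [->|k0] := eqVneq k 0.
  rewrite expr0n; have [->|an] := eqVneq alpha (-1); first exact: limit_circle_log.
  exact: limit_circle_pow.
apply: limit_circle_exp => //; case: hk => [/eqP|h]; first by rewrite (negPf k0).
by rewrite h; case/andP: a31.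
Qed.

Lemma LBk_adjoint_cutoff alpha (k : int) p C (h h' : R -> R) : -1 < p ->
  ode_solution alpha (k%:~R ^+ 2) p C h h' ->
  adjoint mu Rdom (Rweight alpha) (LBk_graph alpha k) (cutoff h, cutoff_image alpha h h').
Proof.
move=> p1 [dh dh' bh bh'].
have Lu := cutoff_L2 dh p1 bh.
have Lv := cutoff_image_L2 dh dh' p1 bh bh'.
split => //; split => // _ [phi cphi <-] /=.
have Lp := Cc1_L2 alpha cphi; have LA := LBk_L2 alpha k cphi.
have mRd := @measurable_Rdom R.
have mw := @measurable_Rweight R alpha.
have w0 := @Rweight_gt0 R alpha.
have [a [b [a0 s]]] := Cc1_supp cphi.
apply/eqP; rewrite -subr_eq0; apply/eqP.
have i1 := @L2_mul_integrable _ _ _ mu _ _ mRd mw w0 _ _ LA Lu.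
have i2 := @L2_mul_integrable _ _ _ mu _ _ mRd mw w0 _ _ Lp Lv.
rewrite /ip -RintegralB//.
rewrite -[RHS](cutoff_green dh dh' a0 s (supp_der s) (Cc1_isd cphi) (Cc1_isd2 cphi)
  (fun x => @Cc1_cont2 _ phi cphi x)).
by apply: eq_Rintegral => x _; rewrite /LBk /=; ring.
Qed.

(** The two cut-off solutions lie in the domain of the adjoint, and the defect of symmetry between
    them is [- W], which is nonzero. *)
Lemma limit_circle_not_ess_sa alpha (k : int) :
  limit_circle alpha (k%:~R ^+ 2) -> ~ LBk_ess_sa alpha k.
Proof.
move=> [p [C [h1 [h1' [h2 [h2' [W [p1 W0 S1 S2 hW]]]]]]]].
have A1 := LBk_adjoint_cutoff p1 S1; have A2 := LBk_adjoint_cutoff p1 S2.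
have mRd := @measurable_Rdom R.
have mw := @measurable_Rweight R alpha.
have w0 := @Rweight_gt0 R alpha.
apply: (@not_ess_self_adjoint _ _ _ mu Rdom (Rweight alpha) mRd mw w0 Cc1 (LBk alpha k)
  (@Cc1_L2 R alpha) (@LBk_L2 R alpha k) _ _ _ _ A1 A2).
case: A1 => L1 [L1' _]; case: A2 => L2 [L2' _].
have i1 := @L2_mul_integrable _ _ _ mu _ _ mRd mw w0 _ _ L1' L2.
have i2 := @L2_mul_integrable _ _ _ mu _ _ mRd mw w0 _ _ L1 L2'.
move=> /eqP; rewrite -subr_eq0 /ip -RintegralB// => /eqP E.
have := cutoff_wronskian hW.
under eq_Rintegral do rewrite mulrBl.
by rewrite E => /eqP; rewrite eq_sym oppr_eq0 (negPf W0).
Qed.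

End LimitCircle.

(** * The operator on the surface *)

Section Plane.
Context {R : realType}.
Implicit Types (f g : R * R -> R) (a b x y t alpha : R) (p : R * R).
Notation mu := (@lebesgue_measure R).
Notation Th := (`[0%R, 2 * pi[%classic : set R).

(** An open set of the plane is the countable union of the rational boxes that it contains, and
    boxes are measurable for the product sigma-algebra. *)
Lemma open2_measurable (O : set (R * R)) : open O -> measurable O.
Proof.
move=> oO.
pose F (q : rat * rat * (rat * rat)) : set (R * R) :=
  `]ratr q.1.1 : R, ratr q.1.2 : R[%classic `*` `]ratr q.2.1 : R, ratr q.2.2 : R[%classic.
have -> : O = \bigcup_q (if `[< F q `<=` O >] then F q else set0).
  apply/seteqP; split => p.
    move=> Op; have : nbhs p O by apply: open_nbhs_nbhs.
    rewrite -nbhs_ballE => -[e /= e0 eO].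
    have q (x : R) : exists qq : rat * rat, (ratr qq.1 : R) < x < ratr qq.2 /\
        (forall y, ratr qq.1 < y < ratr qq.2 -> ball x e y).
      have /rat_in_itvoo[q1 h1] : x - e < x by rewrite ltrBlDr ltrDl.
      have /rat_in_itvoo[q2 h2] : x < x + e by rewrite ltrDl.
      move: h1 h2; rewrite !in_itv/= => /andP[h1 h2] /andP[h3 h4].
      exists (q1, q2); rewrite /= h2 h3; split => // y /andP[y1 y2].
      by rewrite /ball/= ltr_distlC (lt_trans h1)// (lt_trans y2).
    have [q1 [h1 b1]] := q p.1; have [q2 [h2 b2]] := q p.2.
    exists (q1, q2) => //; rewrite asboolT.
      by split; rewrite /= in_itv/=.
    move=> z [/=]; rewrite !in_itv/= => z1 z2; apply: eO; split.
      exact: b1.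
    exact: b2.
  by move=> [q _]; case: asboolP => // h /h.
apply: countable_bigcupT_measurable => // q; case: asboolP => // _.
by apply: measurableX; exact: measurable_itv.
Qed.

Lemma cont2_measurable f : (forall p, {for p, continuous f}) -> measurable_fun setT f.
Proof.
move=> /continuousP cf; apply: (measurability _ (RGenOpens.measurableE R)).
move=> _ [_ [a [b ->] <-]]; rewrite setTI; apply: open2_measurable.
exact/cf/interval_open.
Qed.

Lemma MdomE : @Mdom R = Rdom `*` Th.
Proof. by apply/seteqP; split => -[x t] /= [] /= h; rewrite ?in_itv/=. Qed.

Lemma measurable_Mdom : measurable (@Mdom R).
Proof.
by rewrite MdomE; apply: measurableX; [exact: measurable_Rdom|exact: measurable_itv].
Qed.

Lemma Mweight_gt0 alpha p : Mdom p -> 0 < Mweight alpha p.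
Proof. by case=> p0 _; exact: (@Rweight_gt0 _ alpha p.1). Qed.

Lemma measurable_fst_Mdom (h : R -> R) : measurable_fun Rdom h ->
  measurable_fun Mdom (fun p : R * R => h p.1).
Proof.
move=> mh; apply: (measurable_comp (F := @Rdom R) (f := h)) => //.
- exact: measurable_Rdom.
- by move=> _ [p [h0 _] <-].
- by apply: measurable_funTS; exact: measurable_fst.
Qed.

Lemma measurable_Mweight alpha : measurable_fun Mdom (@Mweight R alpha).
Proof. exact: measurable_fst_Mdom (@measurable_Rweight R alpha). Qed.

Lemma Rintegral_Mdom12 f : Mmeasure.-integrable Mdom (EFin \o f) ->
  \int[Mmeasure]_(p in Mdom) f p = \int[mu]_(x in Rdom) \int[mu]_(t in Th) f (x, t).
Proof.
move=> fi; rewrite Rintegral_mkcond Rintegral_prod12; last first.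
  rewrite -restrict_EFin; apply/integrable_restrict => //; first exact: measurable_Mdom.
  by rewrite setTI.
rewrite [RHS]Rintegral_mkcond; apply: eq_Rintegral => x _.
rewrite [RHS]/patch; case: ifPn => [xR|xR].
  rewrite [RHS]Rintegral_mkcond; apply: eq_Rintegral => t _; rewrite /patch MdomE.
  by rewrite in_setX xR.
rewrite /Rintegral integral0_eq// => t _; rewrite /patch MdomE.
by rewrite in_setX (negPf xR).
Qed.

Lemma Rintegral_Mdom21 f : Mmeasure.-integrable Mdom (EFin \o f) ->
  \int[Mmeasure]_(p in Mdom) f p = \int[mu]_(t in Th) \int[mu]_(x in Rdom) f (x, t).
Proof.
move=> fi; rewrite Rintegral_mkcond Rintegral_prod21; last first.
  rewrite -restrict_EFin; apply/integrable_restrict => //; first exact: measurable_Mdom.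
  by rewrite setTI.
rewrite [RHS]Rintegral_mkcond; apply: eq_Rintegral => t _.
rewrite [RHS]/patch; case: ifPn => [tT|tT].
  rewrite [RHS]Rintegral_mkcond; apply: eq_Rintegral => x _; rewrite /patch MdomE.
  by rewrite in_setX tT andbT.
rewrite /Rintegral integral0_eq// => x _; rewrite /patch MdomE.
by rewrite in_setX (negPf tT) andbF.
Qed.

Definition supp2 a b f := forall p, ~~ (a <= `|p.1| <= b) -> f p = 0.

Lemma supp2_open a b : open [set p : R * R | ~~ (a <= `|p.1| <= b)].
Proof.
rewrite (_ : [set p | _] = fst @^-1` [set x : R | ~~ (a <= `|x| <= b)])//.
apply: open_comp; first by move=> p _; exact: cvg_fst.
exact: supp_open.
Qed.

Lemma supp2_cont a b f : 0 < a -> supp2 a b f ->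
  (forall p, p.1 != 0 -> {for p, continuous f}) -> forall p, {for p, continuous f}.
Proof.
move=> a0 s cf p; have [p0|/cf//] := eqVneq p.1 0.
have hp : ~~ (a <= `|p.1| <= b) by rewrite p0 normr0 leNgt a0.
change (f q @[q --> p] --> f p); rewrite (s p hp); apply: cvg_near_cst.
have := open_nbhs_nbhs (conj (supp2_open (a := a) (b := b)) hp).
by apply: filterS => q hq; rewrite s.
Qed.

Lemma supp2_integrable a b f : 0 < a -> supp2 a b f ->
  (forall p, p.1 != 0 -> {for p, continuous f}) ->
  Mmeasure.-integrable Mdom (EFin \o f).
Proof.
move=> a0 s cf'; have cf := supp2_cont a0 s cf'.
set B := `|b| + 1.
(* [f] need not vanish anywhere in the angle, so integrability is taken from a closed box containing
   every point over [Th] where [f] can be nonzero. *)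
pose K : set (R * R) := `[- B, B]%classic `*` `[0, 2 * pi]%classic.
have mK : measurable K by apply: measurableX; exact: measurable_itv.
have iK : Mmeasure.-integrable K (EFin \o f).
  apply: measurable_bounded_integrable => //.
  - have E := product_measure1E mu mu (measurable_itv `[- B, B]) (measurable_itv `[0, 2 * pi]).
    apply: (@eq_ind_r _ _ (fun z => z < +oo)%E _ _ E).
    have h (c d : R) : mu `[c, d]%classic \is a fin_num.
      by rewrite lebesgue_measure_itv/=; case: ifP.
    apply: lte_mul_pinfty; [exact: measure_ge0|exact: (h (- B) B)|].
    by have := h 0 (2 * pi); rewrite ge0_fin_numE.
  - by apply: measurable_funTS; exact: cont2_measurable.
  - have cK : compact K by apply: compact_setX; exact: segment_compact.
    have wK : {within K, continuous f} by apply: continuous_in_subspaceT => p _; exact: cf.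
    have /compact_bounded[M [_ mrt]] := continuous_compact wK cK.
    by exists M; split; rewrite ?num_real // => ? ? ? ?; exact: mrt.
have mT : measurable (setT `*` Th : set (R * R)) by apply: measurableX => //; exact: measurable_itv.
suff i2 : (mu \x mu)%E.-integrable (setT `*` Th) (EFin \o f).
  apply: integrableS i2 => //; first exact: measurable_Mdom.
  by rewrite MdomE => p [_ ?].
apply: (@eq_integrable _ _ _ (mu \x mu)%E _ mT ((EFin \o f) \_ K)) => //.
- move=> p; rewrite inE => -[_] /=; rewrite in_itv/= => /andP[p0 p1].
  rewrite /patch; case: ifPn => //; rewrite notin_setE => hK.
  rewrite /= s//; apply/negP => /andP[_ h2]; apply: hK; split => /=; last first.
    by rewrite in_itv/= p0 ltW.
  by rewrite in_itv/= -ler_norml (le_trans h2)// /B (le_trans (ler_norm _))// lerDl.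
apply/(integrable_restrict (mu \x mu)%E mK mT).
by apply: (@integrableS _ _ _ (mu \x mu)%E K) => //; exact: measurableI.
Qed.

End Plane.

Section SurfaceOperator.
Context {R : realType}.
Implicit Types (f g phi psi : R * R -> R) (a b x y t alpha : R) (p : R * R).
Notation mu := (@lebesgue_measure R).
Notation isd x f a := (is_derive (x : R) (1 : R) (f : R -> R) (a : R)).
Notation Th := (`[0%R, 2 * pi[%classic : set R).

Lemma Rintegral_Th F : (forall t, {for t, continuous F}) ->
  \int[mu]_(t in Th) F t = \int[mu]_(t in `[0, 2 * pi]) F t.
Proof.
move=> cF; apply: Rintegral_itv_bndo_bndc.
apply: (@integrableS _ _ _ mu `[0, 2 * pi]) => //; first exact: subset_itv_co_cc.
by apply: cont_itv_integrable => t _; exact: cF.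
Qed.

(** Periodicity replaces compact support in the angular direction. *)
Lemma Rintegral_Th_der0 (F dF : R -> R) : (forall t, isd t F (dF t)) ->
  (forall t, {for t, continuous dF}) -> (forall t, F (t + 2 * pi) = F t) ->
  \int[mu]_(t in Th) dF t = 0.
Proof.
move=> dFF cF per; rewrite Rintegral_Th//.
transitivity (F (2 * pi) - F 0).
  by apply: (@FTC2 _ _ _ dF F) => //; rewrite mulr_ge0 ?pi_ge0.
by rewrite -[X in F X]add0r per subrr.
Qed.

Lemma cont_Th_integrable F : (forall t, {for t, continuous F}) ->
  mu.-integrable Th (EFin \o F).
Proof.
move=> cF; apply: (@integrableS _ _ _ mu `[0, 2 * pi]) => //.
  exact: subset_itv_co_cc.
by apply: cont_itv_integrable => t _; exact: cF.
Qed.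

Lemma slice1 f x t : {for (x, t), continuous f} -> {for x, continuous (fun y => f (y, t))}.
Proof.
move=> cf; apply: (@cvg_comp _ _ _ (fun y => (y, t)) f _ (nbhs (x, t))) => //.
apply: (@cvg_pair _ _ _ (nbhs x) (nbhs x) (nbhs t) _ _ _ (fun y => y) (fun=> t)) => //.
exact: cvg_cst.
Qed.

Lemma slice2 f x t : {for (x, t), continuous f} -> {for t, continuous (fun s => f (x, s))}.
Proof.
move=> cf; apply: (@cvg_comp _ _ _ (fun s => (x, s)) f _ (nbhs (x, t))) => //.
apply: (@cvg_pair _ _ _ (nbhs t) (nbhs x) (nbhs t) _ _ _ (fun=> x) (fun s => s)) => //.
exact: cvg_cst.
Qed.

Lemma cont_fst (h : R -> R) p : {for p.1, continuous h} ->
  {for p, continuous (fun q : R * R => h q.1)}.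
Proof.
by move=> ch; apply: (@cvg_comp _ _ _ fst h (nbhs p) (nbhs p.1)) => //; exact: cvg_fst.
Qed.

Lemma cont2D f g p : {for p, continuous f} -> {for p, continuous g} ->
  {for p, continuous (fun q => f q + g q)}.
Proof. by move=> cf cg; exact: cvgD cf cg. Qed.

Lemma cont2B f g p : {for p, continuous f} -> {for p, continuous g} ->
  {for p, continuous (fun q => f q - g q)}.
Proof. by move=> cf cg; exact: cvgB cf cg. Qed.

Lemma cont2M f g p : {for p, continuous f} -> {for p, continuous g} ->
  {for p, continuous (fun q => f q * g q)}.
Proof. by move=> cf cg; exact: cvgM cf cg. Qed.

Lemma cont2_cst c p : {for p, continuous (fun _ : R * R => c : R)}.
Proof. exact: cvg_cst. Qed.

Lemma CcM_supp2 phi : CcM phi -> exists a b, 0 < a /\ supp2 a b phi.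
Proof.
move=> [_ _ [a [b [a0 h]]]]; exists a, b; split => // p hp.
by apply/eqP; apply: contraNT hp => /h.
Qed.

Lemma CcM_cont phi : CcM phi -> forall p, {for p, continuous phi}.
Proof. by move=> [s _ _]; exact: (s 0%N). Qed.
Arguments CcM_cont {phi} _ _.

Lemma CcM_isdx phi : CcM phi -> forall x t, isd x (fun y => phi (y, t)) (dx phi (x, t)).
Proof. by move=> [s _ _] x t; apply: derivable_isd; case: (s 1%N) => _ /(_ (x, t)). Qed.

Lemma CcM_isdth phi : CcM phi -> forall x t, isd t (fun s => phi (x, s)) (dth phi (x, t)).
Proof. by move=> [s _ _] x t; apply: derivable_isd; case: (s 1%N) => _ _ /(_ (x, t)). Qed.

Lemma supp2_slice a b phi t : supp2 a b phi -> supp a b (fun x => phi (x, t)).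
Proof. by move=> s x hx; apply: s. Qed.

Lemma supp2_dx a b phi : supp2 a b phi -> supp2 a b (dx phi).
Proof. by move=> s [x t] hx; apply: (supp_der (supp2_slice t s)). Qed.

Lemma supp2_dth a b phi : supp2 a b phi -> supp2 a b (dth phi).
Proof.
move=> s [x t] hx; rewrite /dth /= (_ : (fun t => phi (x, t)) = fun=> 0).
  exact: isd_val (isd_cst t 0).
by apply/funext => r; apply: s.
Qed.

Lemma supp2_CcM a b phi : 0 < a -> supp2 a b phi ->
  exists a b : R, 0 < a /\ forall p : R * R, phi p != 0 -> a <= `|p.1| <= b.
Proof.
move=> a0 s; exists a, b; split => // p.
by apply: contraNT => /s ->.
Qed.

Lemma CcM_dx phi : CcM phi -> CcM (dx phi).
Proof.
move=> c; have [a [b [a0 s]]] := CcM_supp2 c.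
case: c => sm per _; split; last exact: supp2_CcM a0 (supp2_dx s).
- by move=> k; case: (sm k.+1).
- move=> x t; rewrite /dx /=; congr (derive1 _ _).
  by apply/funext => y; exact: per.
Qed.

Lemma CcM_dth phi : CcM phi -> CcM (dth phi).
Proof.
move=> c; have dc := CcM_isdth c; have [a [b [a0 s]]] := CcM_supp2 c.
case: c => sm per _; split; last exact: supp2_CcM a0 (supp2_dth s).
- by move=> k; case: (sm k.+1).
- move=> x t; rewrite {2}/dth /=; apply/esym/isd_val.
  have E : (fun s => phi (x, s)) = (fun s => phi (x, s + 2 * pi)).
    by apply/funext => r; rewrite per.
  rewrite E -[X in is_derive _ _ _ X]mulr1.
  apply: (isd_comp (f := fun s => phi (x, s)) (g := fun s => s + 2 * pi) (dc x (t + 2 * pi))).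
  by apply: isd_eq (isdD (isd_id t) (isd_cst t (2 * pi))) _; rewrite addr0.
Qed.

Lemma dx_lin c f g : (forall p : R * R, derivable (fun y => f (y, p.2)) p.1 1) ->
  (forall p : R * R, derivable (fun y => g (y, p.2)) p.1 1) ->
  dx (fun p => c * f p + g p) = fun p => c * dx f p + dx g p.
Proof.
move=> df dg; apply/funext => p; rewrite /dx; apply: isd_val.
by apply: isdD (isdZ c (derivable_isd (df p))) (derivable_isd (dg p)).
Qed.

Lemma dth_lin c f g : (forall p : R * R, derivable (fun t => f (p.1, t)) p.2 1) ->
  (forall p : R * R, derivable (fun t => g (p.1, t)) p.2 1) ->
  dth (fun p => c * f p + g p) = fun p => c * dth f p + dth g p.
Proof.
move=> df dg; apply/funext => p; rewrite /dth; apply: isd_val.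
by apply: isdD (isdZ c (derivable_isd (df p))) (derivable_isd (dg p)).
Qed.

Lemma Ck2_lin k c f g : Ck2 k f -> Ck2 k g -> Ck2 k (fun p => c * f p + g p).
Proof.
have cc f' g' : continuous f' -> continuous g' -> continuous (fun p : R * R => c * f' p + g' p).
  by move=> cf cg p; apply: cvgD; [apply: cvgM; [exact: cvg_cst|exact: cf]|exact: cg].
elim: k f g => [|k ih] f g; first exact: cc.
move=> [cf xf tf Xf Tf] [cg xg tg Xg Tg]; split.
- exact: cc.
- by move=> p; apply: isd_ex; apply: isdD (isdZ c (derivable_isd (xf p))) (derivable_isd (xg p)).
- by move=> p; apply: isd_ex; apply: isdD (isdZ c (derivable_isd (tf p))) (derivable_isd (tg p)).
- by rewrite (dx_lin c xf xg); apply: ih.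
- by rewrite (dth_lin c tf tg); apply: ih.
Qed.

Lemma CcM_lin c phi psi : CcM phi -> CcM psi -> CcM (fun p => c * phi p + psi p).
Proof.
move=> cf cg; have [a [b [a0 s]]] := CcM_supp2 cf; have [a' [b' [a0' s']]] := CcM_supp2 cg.
case: cf => sf pf _; case: cg => sg pg _; split.
- by move=> k; apply: Ck2_lin; [exact: sf|exact: sg].
- by move=> x t; rewrite pf pg.
- apply: (@supp2_CcM (Num.min a a') (Num.max b b')); first by rewrite lt_min a0.
  move=> p hp; rewrite s ?s' ?mulr0 ?addr0//.
  + apply: contra hp => /andP[h1 h2]; rewrite ge_min h1 orbT/=.
    by rewrite le_max h2 orbT.
  + apply: contra hp => /andP[h1 h2]; rewrite ge_min h1/=.
    by rewrite le_max h2.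
Qed.

Lemma Ck2_cst k c : Ck2 k (fun _ : R * R => c).
Proof.
have d0 : dx (fun _ : R * R => c) = fun=> 0.
  by apply/funext => p; exact: isd_val (isd_cst p.1 c).
have d0' : dth (fun _ : R * R => c) = fun=> 0.
  by apply/funext => p; exact: isd_val (isd_cst p.2 c).
elim: k c d0 d0' => [|k ih] c d0 d0'; first by move=> p; exact: cvg_cst.
split; rewrite ?d0 ?d0'.
- by move=> p; exact: cvg_cst.
- by move=> p; exact: isd_ex (isd_cst _ _).
- by move=> p; exact: isd_ex (isd_cst _ _).
- by apply: ih; apply/funext => p; exact: isd_val (isd_cst _ 0).
- by apply: ih; apply/funext => p; exact: isd_val (isd_cst _ 0).
Qed.

Lemma CcM_zero : CcM (fun _ : R * R => 0 : R).
Proof.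
split=> //; first by move=> k; exact: Ck2_cst.
by exists 1, 1; split => // p; rewrite eqxx.
Qed.

Lemma CcM_derivable phi : CcM phi ->
  (forall p : R * R, derivable (fun y => phi (y, p.2)) p.1 1) /\
  (forall p : R * R, derivable (fun t => phi (p.1, t)) p.2 1).
Proof. by move=> [s _ _]; case: (s 1%N) => _ h1 h2 _ _; split; [exact: h1|exact: h2]. Qed.

Lemma LB_lin alpha c phi psi : CcM phi -> CcM psi ->
  LB alpha (fun p => c * phi p + psi p) = fun p => c * LB alpha phi p + LB alpha psi p.
Proof.
move=> cf cg; have [xf tf] := CcM_derivable cf; have [xg tg] := CcM_derivable cg.
have [xxf _] := CcM_derivable (CcM_dx cf); have [xxg _] := CcM_derivable (CcM_dx cg).
have [_ ttf] := CcM_derivable (CcM_dth cf); have [_ ttg] := CcM_derivable (CcM_dth cg).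
apply/funext => p; rewrite /LB !dx_lin// !dth_lin//.
move: (dx (dx phi) p) (dx phi p) (dth (dth phi) p) => A B C.
move: (dx (dx psi) p) (dx psi p) (dth (dth psi) p) (`|p.1| `^ (2 * alpha)) => A' B' C' e.
by ring.
Qed.

Lemma LB_supp2 alpha a b phi : supp2 a b phi -> supp2 a b (LB alpha phi).
Proof.
move=> s p hp; rewrite /LB (supp2_dx s)// (supp2_dx (supp2_dx s))//.
by rewrite (supp2_dth (supp2_dth s))// !mulr0 subr0 addr0.
Qed.

Lemma cont_inv_fst p : p.1 != 0 -> {for p, continuous (fun q : R * R => q.1^-1)}.
Proof.
move=> p0; apply: (@cont_fst (fun x : R => x^-1)).
exact: isd_continuous (isdV p0 (isd_id _)).
Qed.

Lemma cont_norm_powR_fst r p : p.1 != 0 ->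
  {for p, continuous (fun q : R * R => `|q.1| `^ r)}.
Proof. by move=> p0; apply: (@cont_fst (fun x : R => `|x| `^ r)); exact: norm_powR_cont. Qed.

Lemma LB_cont alpha phi p : CcM phi -> p.1 != 0 -> {for p, continuous (LB alpha phi)}.
Proof.
move=> c p0; have cx := CcM_dx c; have ct := CcM_dth c.
exact: (cont2B
  (cont2D (CcM_cont (CcM_dx cx) p)
    (cont2M (@cont_norm_powR_fst (2 * alpha) p p0) (CcM_cont (CcM_dth ct) p)))
  (cont2M (cont2M (@cont2_cst alpha p) (cont_inv_fst p0)) (CcM_cont cx p))).
Qed.

Lemma supp2_L2 alpha a b f : 0 < a -> supp2 a b f ->
  (forall p, p.1 != 0 -> {for p, continuous f}) -> L2 Mmeasure Mdom (Mweight alpha) f.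
Proof.
move=> a0 s cf; apply: sq_integrable_L2; first exact: measurable_Mdom.
  by apply: measurable_funTS; apply: cont2_measurable; exact: (supp2_cont a0 s).
apply: (@supp2_integrable _ a b) => //.
  by move=> p hp; rewrite s// expr0n mul0r.
move=> p p0; have c2 := cont2M (cf p p0) (cf p p0).
by apply: cont2M; [exact: c2|exact: cont_norm_powR_fst].
Qed.

Lemma CcM_L2 alpha phi : CcM phi -> L2 Mmeasure Mdom (Mweight alpha) phi.
Proof.
move=> c; have [a [b [a0 s]]] := CcM_supp2 c.
by apply: supp2_L2 a0 s _ => p _; exact: CcM_cont.
Qed.

Lemma LB_L2 alpha phi : CcM phi -> L2 Mmeasure Mdom (Mweight alpha) (LB alpha phi).
Proof.
move=> c; have [a [b [a0 s]]] := CcM_supp2 c.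
by apply: supp2_L2 a0 (LB_supp2 alpha s) _ => p; exact: LB_cont.
Qed.

Lemma supp2M a b f g : supp2 a b f -> supp2 a b (fun p => f p * g p).
Proof. by move=> s p hp; rewrite s// mul0r. Qed.

(** The radial and angular parts are integrated by parts separately, each with Fubini in the order
    that makes its own variable the inner one; the boundary terms vanish by compact support in [x]
    and by periodicity in [theta]. *)
Lemma LB_form alpha phi psi : CcM phi -> CcM psi ->
  ip Mmeasure Mdom (Mweight alpha) (LB alpha phi) psi =
  - \int[Mmeasure]_(p in Mdom) ((dx phi p * dx psi p +
       `|p.1| `^ (2 * alpha) * (dth phi p * dth psi p)) * Mweight alpha p).
Proof.
move=> c1 c2; have [a [b [a0 s]]] := CcM_supp2 c1.
have cx1 := CcM_dx c1; have cx2 := CcM_dx c2; have cxx := CcM_dx cx1.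
have ct1 := CcM_dth c1; have ct2 := CcM_dth c2; have ctt := CcM_dth ct1.
have mM := @measurable_Mdom R.
have cw p : p.1 != 0 -> {for p, continuous (Mweight alpha)} by exact: cont_norm_powR_fst.
have ce p : p.1 != 0 -> {for p, continuous (fun q : R * R => `|q.1| `^ (2 * alpha))}.
  exact: cont_norm_powR_fst.
pose r p : R := (dx (dx phi) p - alpha / p.1 * dx phi p) * psi p * Mweight alpha p.
pose r' p : R := dx phi p * dx psi p * Mweight alpha p.
pose s0 p : R := dth (dth phi) p * psi p * (`|p.1| `^ (2 * alpha) * Mweight alpha p).
pose s1 p : R := dth phi p * dth psi p * (`|p.1| `^ (2 * alpha) * Mweight alpha p).
have cr p : p.1 != 0 -> {for p, continuous r}.
  move=> p0; apply: cont2M; last exact: cw.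
  apply: cont2M; last exact: (CcM_cont c2 p).
  apply: cont2B; first exact: (CcM_cont cxx p).
  apply: cont2M; last exact: (CcM_cont cx1 p).
  by apply: cont2M; [exact: cont2_cst|exact: cont_inv_fst].
have cr' p : p.1 != 0 -> {for p, continuous r'}.
  move=> p0; apply: cont2M; last exact: cw.
  by apply: cont2M; [exact: (CcM_cont cx1 p)|exact: (CcM_cont cx2 p)].
have cs0 p : p.1 != 0 -> {for p, continuous s0}.
  move=> p0; apply: cont2M; last by apply: cont2M; [exact: ce|exact: cw].
  by apply: cont2M; [exact: (CcM_cont ctt p)|exact: (CcM_cont c2 p)].
have cs1 p : p.1 != 0 -> {for p, continuous s1}.
  move=> p0; apply: cont2M; last by apply: cont2M; [exact: ce|exact: cw].
  by apply: cont2M; [exact: (CcM_cont ct1 p)|exact: (CcM_cont ct2 p)].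
have sr : supp2 a b r.
  do 2 apply: supp2M; move=> p hp.
  by rewrite (supp2_dx s)// (supp2_dx (supp2_dx s))// mulr0 subr0.
have sr' : supp2 a b r' by do 2 apply: supp2M; exact: supp2_dx.
have ss0 : supp2 a b s0 by do 2 apply: supp2M; do 2 apply: supp2_dth.
have ss1 : supp2 a b s1 by do 2 apply: supp2M; apply: supp2_dth.
have ir := supp2_integrable a0 sr cr.
have ir' := supp2_integrable a0 sr' cr'.
have is0 := supp2_integrable a0 ss0 cs0.
have is1 := supp2_integrable a0 ss1 cs1.
have E1 : \int[Mmeasure]_(p in Mdom) (r p + r' p) = 0.
  rewrite Rintegral_Mdom21; last exact: (@integrableD _ _ _ (mu \x mu)%E _ mM _ _ ir ir').
  rewrite -[RHS](_ : \int[mu]_(t in Th) 0 = 0); last by rewrite /Rintegral integral0.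
  apply: eq_Rintegral => t _.
  apply: (@supp_Rintegral_der0 _ a b (fun x => dx phi (x, t) * psi (x, t) * Rweight alpha x)) => //.
  - by do 2 apply: suppM; apply: supp2_slice; exact: supp2_dx.
  - by apply: suppD; apply: supp2_slice.
  - move=> x x0; apply: isd_eq (isdM (isdM (CcM_isdx cx1 x t) (CcM_isdx c2 x t))
      (isd_norm_powR (- alpha) x0)) _.
    rewrite /r /r' /Mweight /Rweight /=.
    move: (dx (dx phi) (x, t)) (dx phi (x, t)) (dx psi (x, t)) (psi (x, t)) (`|x| `^ _) => *.
    by field.
  - by move=> x x0; apply: cvgD; apply: slice1; [exact: cr|exact: cr'].
have E2 : \int[Mmeasure]_(p in Mdom) (s0 p + s1 p) = 0.
  rewrite Rintegral_Mdom12; last exact: (@integrableD _ _ _ (mu \x mu)%E _ mM _ _ is0 is1).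
  rewrite -[RHS](_ : \int[mu]_(x in Rdom) 0 = 0); last by rewrite /Rintegral integral0.
  apply: eq_Rintegral => x; rewrite inE => x0.
  (* Constant along the circle: the weight does not depend on the angle, so 0 is a dummy second
     coordinate. *)
  pose k : R := `|x| `^ (2 * alpha) * Mweight alpha (x, 0).
  apply: (@Rintegral_Th_der0 (fun t => dth phi (x, t) * psi (x, t) * k)).
  - move=> t; apply: isd_eq (isdM (isdM (CcM_isdth ct1 x t) (CcM_isdth c2 x t)) (isd_cst t k)) _.
    by rewrite /s0 /s1 mulr0 addr0 -mulrDl.
  - by move=> t; apply: cvgD; apply: slice2; [exact: cs0|exact: cs1].
  - by move=> t; case: ct1 => _ -> _; case: c2 => _ -> _.
rewrite RintegralD// in E1; rewrite RintegralD// in E2.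
transitivity (\int[Mmeasure]_(p in Mdom) (r p + s0 p)).
  apply: eq_Rintegral => p _; rewrite /LB /r /s0.
  move: (dx (dx phi) p) (dx phi p) (dth (dth phi) p) => A B C.
  by move: (psi p) (`|p.1| `^ (2 * alpha)) (Mweight _ _) => *; ring.
rewrite RintegralD//.
transitivity (- \int[Mmeasure]_(p in Mdom) (r' p + s1 p)).
  rewrite RintegralD//; lra.
congr (- _); apply: eq_Rintegral => p _; rewrite /r' /s1; ring.
Qed.

Lemma LB_sym alpha phi psi : CcM phi -> CcM psi ->
  ip Mmeasure Mdom (Mweight alpha) (LB alpha phi) psi =
  ip Mmeasure Mdom (Mweight alpha) phi (LB alpha psi).
Proof.
move=> cf cg; apply: etrans (LB_form alpha cf cg) _; apply: esym.
transitivity (ip Mmeasure Mdom (Mweight alpha) (LB alpha psi) phi); first exact: ipC.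
apply: etrans (LB_form alpha cg cf) _; apply: (congr1 -%R).
by apply: eq_Rintegral => x _; ring.
Qed.

Lemma LB_le0 alpha phi : CcM phi ->
  ip Mmeasure Mdom (Mweight alpha) (LB alpha phi) phi <= 0.
Proof.
move=> cf; rewrite (LB_form alpha cf cf) oppr_le0; apply: Rintegral_ge0 => x x0.
rewrite mulr_ge0 ?(ltW (Mweight_gt0 _ _))// -!expr2 addr_ge0 ?sqr_ge0//.
by rewrite mulr_ge0 ?sqr_ge0// powR_ge0.
Qed.

End SurfaceOperator.
Arguments CcM_cont {R phi} _ _.

(** * Failure of essential self-adjointness on the surface by radial functions *)

Section SurfaceLimitCircle.
Context {R : realType}.
Implicit Types (h f g : R -> R) (phi : R * R -> R) (x t alpha : R).
Notation mu := (@lebesgue_measure R).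
Notation Th := (`[0%R, 2 * pi[%classic : set R).

Lemma Rintegral_Th_cst (c : R) : \int[mu]_(t in Th) c = 2 * pi * c.
Proof.
have pi2 : 0 <= 2 * pi :> R by rewrite mulr_ge0 ?pi_ge0.
rewrite Rintegral_Th; last by move=> t; exact: cvg_cst.
transitivity (c * (2 * pi) - c * 0); last by ring.
apply: (@FTC2 _ 0 (2 * pi) (fun=> c) (fun t => c * t)) => //.
  by move=> t _; apply: isd_eq (isdZ c (isd_id t)) _; rewrite mulr1.
by move=> t _; exact: cvg_cst.
Qed.

Lemma integrable_radial f : mu.-integrable Rdom (EFin \o f) ->
  Mmeasure.-integrable Mdom (EFin \o (fun p : R * R => f p.1)).
Proof.
move=> fi.
have mTh : measurable Th by exact: measurable_itv.
have i1 : mu.-integrable setT (EFin \o (f \_ Rdom)).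
  rewrite -restrict_EFin; apply/integrable_restrict => //; first exact: measurable_Rdom.
  by rewrite setTI.
have i2 : mu.-integrable setT (EFin \o (cst (1 : R) \_ Th)).
  rewrite -restrict_EFin; apply/integrable_restrict => //.
  by rewrite setTI; apply: cont_Th_integrable => t; exact: cvg_cst.
have i3 := integrable_tensor i1 i2.
have mM := @measurable_Mdom R.
have i4 := @integrableS _ _ _ (mu \x mu)%E _ _ _ measurableT mM (@subsetT _ _) i3.
apply: eq_integrable i4 => // p; rewrite MdomE inE => -[p1 p2] /=.
by rewrite /patch !mem_set// mulr1.
Qed.

Lemma Rintegral_radial f : mu.-integrable Rdom (EFin \o f) ->
  \int[Mmeasure]_(p in Mdom) f p.1 = 2 * pi * \int[mu]_(x in Rdom) f x.
Proof.
move=> fi; rewrite Rintegral_Mdom12; last exact: integrable_radial.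
rewrite -RintegralZl//; last exact: measurable_Rdom.
by apply: eq_Rintegral => x _; exact: (Rintegral_Th_cst (f x)).
Qed.

Lemma L2_radial alpha f : L2 mu Rdom (Rweight alpha) f ->
  L2 Mmeasure Mdom (Mweight alpha) (fun p => f p.1).
Proof.
move=> Lf; apply: sq_integrable_L2; first exact: measurable_Mdom.
  by apply: measurable_fst_Mdom; case: Lf.
apply: (integrable_radial (f := fun x => f x ^+ 2 * Rweight alpha x)).
exact: (@L2_sq_integrable _ _ _ mu _ _ (@measurable_Rweight R alpha) (@Rweight_gt0 R alpha) _ Lf).
Qed.

(** Against a function independent of [theta] the angular derivative of [phi] integrates to zero
    over each circle; what is left is Green's identity with kk = 0 on each line of constant
    angle. *)
Lemma LB_adjoint_cutoff alpha p C (h h' : R -> R) : -1 < p ->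
  ode_solution alpha 0 p C h h' ->
  adjoint Mmeasure Mdom (Mweight alpha) (LB_graph alpha)
    (fun q => cutoff h q.1, fun q => cutoff_image alpha h h' q.1).
Proof.
move=> p1 [dh dh' bh bh'].
have Lu := L2_radial (cutoff_L2 dh p1 bh).
have Lv := L2_radial (cutoff_image_L2 dh dh' p1 bh bh').
split => //; split => // _ [phi c <-] /=.
have Lp := CcM_L2 alpha c; have LA := LB_L2 alpha c.
have mM := @measurable_Mdom R.
have mw := @measurable_Mweight R alpha.
have w0 := @Mweight_gt0 R alpha.
have [a [b [a0 s]]] := CcM_supp2 c.
have ct := CcM_dth c; have ctt := CcM_dth ct.
have cx := CcM_dx c; have cxx := CcM_dx cx.
(* Split off because it must be integrated over the angle first, whereas the rest is integrated over
   [x] first. *)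
pose B (q : R * R) : R := `|q.1| `^ (2 * alpha) * dth (dth phi) q.
have LB' : L2 Mmeasure Mdom (Mweight alpha) B.
  apply: (@supp2_L2 _ alpha a b) => // [q hq|q q0].
    by rewrite /B (supp2_dth (supp2_dth s))// mulr0.
  exact: (cont2M (@cont_norm_powR_fst _ (2 * alpha) q q0) (CcM_cont ctt q)).
have i1 := @L2_mul_integrable _ _ _ (mu \x mu)%E _ _ mM mw w0 _ _ LA Lu.
have i2 := @L2_mul_integrable _ _ _ (mu \x mu)%E _ _ mM mw w0 _ _ Lp Lv.
have i3 := @L2_mul_integrable _ _ _ (mu \x mu)%E _ _ mM mw w0 _ _ LB' Lu.
have EB : \int[Mmeasure]_(q in Mdom) (B q * cutoff h q.1 * Mweight alpha q) = 0.
  rewrite (Rintegral_Mdom12 i3).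
  rewrite -[RHS](_ : \int[mu]_(x in Rdom) 0 = 0); last by rewrite /Rintegral integral0.
  apply: eq_Rintegral => x _.
  pose k : R := `|x| `^ (2 * alpha) * cutoff h x * Mweight alpha (x, 0).
  transitivity (\int[mu]_(t in Th) (k * dth (dth phi) (x, t))).
    apply: eq_Rintegral => t _.
    rewrite /B /k /Mweight /=; move: (dth (dth phi) (x, t)) (cutoff h x) => *; ring.
  apply: (@Rintegral_Th_der0 _ (fun t => k * dth phi (x, t)) (fun t => k * dth (dth phi) (x, t))).
  - by move=> t; exact: isdZ (CcM_isdth ct x t).
  - by move=> t; apply: cvgM; [exact: cvg_cst|apply: slice2; exact: (CcM_cont ctt)].
  - by move=> t; case: ct => _ -> _.
pose f1 q : R := LB alpha phi q * cutoff h q.1 * Mweight alpha q.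
pose f2 q : R := phi q * cutoff_image alpha h h' q.1 * Mweight alpha q.
pose f3 q : R := B q * cutoff h q.1 * Mweight alpha q.
have i12 : (mu \x mu)%E.-integrable Mdom (EFin \o (fun q => f1 q - f2 q)).
  exact: (@integrableB _ _ _ (mu \x mu)%E _ mM _ _ i1 i2).
have i123 : (mu \x mu)%E.-integrable Mdom (EFin \o (fun q => f1 q - f2 q - f3 q)).
  exact: (@integrableB _ _ _ (mu \x mu)%E _ mM _ _ i12 i3).
apply/eqP; rewrite -subr_eq0; apply/eqP.
rewrite -[LHS]subr0 -[X in _ - X]EB /ip -RintegralB// -RintegralB//.
apply: etrans (Rintegral_Mdom21 i123) _.
rewrite -[RHS](_ : \int[mu]_(t in Th) 0 = 0); last by rewrite /Rintegral integral0.
apply: eq_Rintegral => t _.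
have G := cutoff_green dh dh' a0 (supp2_slice t s) (supp2_slice t (supp2_dx s))
  (fun x => CcM_isdx c x t) (fun x => CcM_isdx cx x t) (fun x => slice1 (CcM_cont cxx (x, t))).
rewrite -[RHS]G; apply: eq_Rintegral => x _.
rewrite /f1 /f2 /f3 /LB /B /Rweight /Mweight /=.
move: (dx (dx phi) (x, t)) (dx phi (x, t)) (dth (dth phi) (x, t)) (phi (x, t)) => *.
by ring.
Qed.

(** The one-dimensional defect of symmetry is multiplied by the length [2 * pi] of the circle and
    remains nonzero. *)
Lemma limit_circle_LB_not_ess_sa alpha : limit_circle alpha 0 -> ~ LB_ess_sa alpha.
Proof.
move=> [p [C [h1 [h1' [h2 [h2' [W [p1 W0 S1 S2 hW]]]]]]]].
have A1 := LB_adjoint_cutoff p1 S1; have A2 := LB_adjoint_cutoff p1 S2.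
have mM := @measurable_Mdom R.
have mw := @measurable_Mweight R alpha.
have w0 := @Mweight_gt0 R alpha.
apply: (@not_ess_self_adjoint _ _ _ (mu \x mu)%E Mdom (Mweight alpha) mM mw w0 CcM (LB alpha)
  (@CcM_L2 R alpha) (@LB_L2 R alpha) _ _ _ _ A1 A2).
have [L1 L1'] : L2 mu Rdom (Rweight alpha) (cutoff h1) /\
    L2 mu Rdom (Rweight alpha) (cutoff_image alpha h1 h1').
  by case: S1 => d d' b b'; split; [exact: cutoff_L2 b|exact: cutoff_image_L2 b b'].
have [L2_ L2'] : L2 mu Rdom (Rweight alpha) (cutoff h2) /\
    L2 mu Rdom (Rweight alpha) (cutoff_image alpha h2 h2').
  by case: S2 => d d' b b'; split; [exact: cutoff_L2 b|exact: cutoff_image_L2 b b'].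
have mRd := @measurable_Rdom R.
have mwR := @measurable_Rweight R alpha.
have wR0 := @Rweight_gt0 R alpha.
have i1 := @L2_mul_integrable _ _ _ mu _ _ mRd mwR wR0 _ _ L1' L2_.
have i2 := @L2_mul_integrable _ _ _ mu _ _ mRd mwR wR0 _ _ L1 L2'.
move=> /eqP; rewrite -subr_eq0 /ip (Rintegral_radial i1) (Rintegral_radial i2).
rewrite -mulrBr -RintegralB// => /eqP E.
have := cutoff_wronskian hW.
under eq_Rintegral do rewrite mulrBl.
move=> E'; move: E; rewrite E' => /eqP.
by rewrite mulf_eq0 oppr_eq0 (negPf W0) orbF mulf_eq0 (gt_eqF (pi_gt0 R)) orbF pnatr_eq0.
Qed.

End SurfaceLimitCircle.

(** * Separation of variables *)

Section FourierUniqueness.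
Context {R : realType}.
Implicit Types (h f p q : R -> R) (t x y : R) (k l : int).
Notation mu := (@lebesgue_measure R).
Notation Th := (`[0%R, 2 * pi[%classic : set R).
Notation To := (`]0%R, 2 * pi[%classic : set R).

Lemma bernoulli_ge y m : 0 <= y <= 1 -> 1 - m%:R * y <= (1 - y) ^+ m.
Proof.
move=> /andP[y0 y1]; elim: m => [|m ih]; first by rewrite mul0r subr0 expr0.
have h := ler_wpM2r (_ : 0 <= 1 - y) ih; rewrite exprSr.
apply: le_trans (h _); last by rewrite subr_ge0.
have m0 : 0 <= m%:R * y ^+ 2 by rewrite mulr_ge0 ?sqr_ge0.
by rewrite -natr1; lra.
Qed.

(** The upper companion of Bernoulli's inequality: (1 - y)^m is at most 1 / (1 + m y). *)
Lemma bernoulli_le y m : 0 <= y <= 1 -> (1 - y) ^+ m * (1 + m%:R * y) <= 1.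
Proof.
move=> /andP[y0 y1]; elim: m => [|m ih]; first by rewrite mul0r addr0 expr0 mulr1.
apply: le_trans ih; rewrite exprSr -mulrA; apply: ler_wpM2l.
  by rewrite exprn_ge0// subr_ge0.
have m0 : 0 <= m%:R * y ^+ 2 by rewrite mulr_ge0 ?sqr_ge0.
have := sqr_ge0 y; rewrite -natr1; lra.
Qed.

(** Polynomials tending to a step on [[0, 1]], as in elementary proofs of the Stone-Weierstrass
    theorem. Exponent times y^(2 n) is (n + 1) (2 y)^(2 n): it tends to 0 for y < 1/2 and is at
    least n + 1 for y >= 1/2, the factor n + 1 being what decides y = 1/2. The two Bernoulli bounds
    conclude. *)
Lemma step_cvg y : 0 <= y <= 1 ->
  (1 - (y ^+ n) ^+ 2) ^+ (n.+1 * 4 ^ n) @[n --> \oo] --> ((y < 2^-1)%R%:R : R).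
Proof.
move=> /andP[y0 y1].
have Y n : 0 <= (y ^+ n) ^+ 2 <= 1.
  by rewrite sqr_ge0/= exprn_ile1// ?exprn_ge0// exprn_ile1.
have f01 n : 0 <= (1 - (y ^+ n) ^+ 2) ^+ (n.+1 * 4 ^ n) <= 1.
  case/andP: (Y n) => Y0 Y1.
  by rewrite exprn_ge0 ?subr_ge0//= exprn_ile1 ?subr_ge0// lerBlDr lerDl.
pose r := 2 * y.
have r0 : 0 <= r by rewrite mulr_ge0.
have E n : (n.+1 * 4 ^ n)%:R * (y ^+ n) ^+ 2 = n.+1%:R * (r ^+ n) ^+ 2 :> R.
  have four : 4 = 2 ^+ 2 :> R by ring.
  by rewrite natrM natrX /r !exprMn four (exprAC 2) -[LHS]mulrA.
have [yh|yh] := ltP y 2^-1.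
  have r1 : r < 1 by rewrite /r; lra.
  pose e := 1 - r; have e0 : 0 < e by rewrite subr_gt0.
  apply: (@squeeze_cvgr _ _ _ _ (fun n => 1 - (e ^+ 2)^-1 * harmonic n) (cst 1)).
  - near=> n; case/andP: (f01 n) => _ ->; rewrite andbT.
    apply: le_trans (bernoulli_ge _ (Y n)); rewrite E lerD2l lerN2 /harmonic.
    (* Bernoulli for [r = 1 - e] gives [r^n <= 1 / (e (n + 1))]; its square times [n + 1] is at most
       e^(-2) / (n + 1). *)
    have e01 : 0 <= e <= 1 by rewrite ltW//= /e; lra.
    have := bernoulli_le n e01; rewrite {1}/e subKr => B.
    have B1 : r ^+ n * (e * n.+1%:R) <= 1.
      apply: le_trans B; apply: ler_wpM2l; first exact: exprn_ge0.
      case/andP: e01 => _ e1; rewrite -natr1; lra.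
    have B2 : (r ^+ n * (e * n.+1%:R)) ^+ 2 <= 1.
      by rewrite exprn_ile1// !mulr_ge0 ?exprn_ge0// ltW.
    rewrite -invfM -[leRHS]mul1r ler_pdivlMr; last by rewrite mulr_gt0// exprn_gt0.
    by apply: le_trans B2; rewrite !exprMn; lra.
  - rewrite -[X in _ --> X]subr0 -[X in _ - X](mulr0 (e ^+ 2)^-1).
    by apply: cvgB; [exact: cvg_cst|apply: cvgMr; exact: cvg_harmonic].
  - exact: cvg_cst.
have r1 : 1 <= r by rewrite /r; lra.
apply: (@squeeze_cvgr _ _ _ _ (cst 0) harmonic); last 2 first.
- exact: cvg_cst.
- exact: cvg_harmonic.
near=> n; case/andP: (f01 n) => -> _ /=.
have := bernoulli_le (n.+1 * 4 ^ n) (Y n); rewrite E /harmonic => B.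
rewrite -[leRHS]mul1r ler_pdivlMr//; apply: le_trans B.
apply: ler_wpM2l; first by case/andP: (f01 n).
rewrite ler_wpDl// ler_peMr// exprn_ege1// exprn_ege1//.
Unshelve. all: by end_near. Qed.

(** Trigonometric polynomials as a span. Frequencies range over all integers, so the differences
    [k - l] of the product-to-sum formulas stay inside and the span is an algebra. *)
Inductive trigonometric : (R -> R) -> Prop :=
| Trig_cos k : trigonometric (fun t => cos (k%:~R * t))
| Trig_sin k : trigonometric (fun t => sin (k%:~R * t))
| Trig_lin c p q : trigonometric p -> trigonometric q ->
    trigonometric (fun t => c * p t + q t).

Lemma trig_eq p q : trigonometric p -> p =1 q -> trigonometric q.
Proof. by move=> tp /funext <-. Qed.

Lemma trigZ c p : trigonometric p -> trigonometric (fun t => c * p t).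
Proof. by move=> tp; apply: trig_eq (Trig_lin (c - 1) tp tp) _ => t; ring. Qed.

Lemma trig_half p q : trigonometric p -> trigonometric q ->
  trigonometric (fun t => 2^-1 * (p t + q t)).
Proof. by move=> tp tq; apply: trig_eq (Trig_lin 2^-1 tp (trigZ 2^-1 tq)) _ => t; ring. Qed.

Lemma trigN p : trigonometric p -> trigonometric (fun t => - p t).
Proof. by move=> tp; apply: trig_eq (trigZ (-1) tp) _ => t; ring. Qed.

Lemma trig_cst c : trigonometric (fun=> c).
Proof. by apply: trig_eq (trigZ c (Trig_cos 0)) _ => t; rewrite mul0r cos0 mulr1. Qed.

Lemma trigM p q : trigonometric p -> trigonometric q -> trigonometric (fun t => p t * q t).
Proof.
move=> tp; elim: tp q => [k|k|c p1 p2 _ ih1 _ ih2] q tq.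
- elim: tq => [l|l|c q1 q2 _ ih1 _ ih2].
  + apply: trig_eq (trig_half (Trig_cos (k + l)) (Trig_cos (k - l))) _ => t.
    by rewrite !intrD mulrNz !mulrDl mulNr !cosD cosN sinN; field.
  + apply: trig_eq (trig_half (Trig_sin (k + l)) (trigN (Trig_sin (k - l)))) _ => t.
    by rewrite !intrD mulrNz !mulrDl mulNr !sinD cosN sinN; field.
  + by apply: trig_eq (Trig_lin c ih1 ih2) _ => t; ring.
- elim: tq => [l|l|c q1 q2 _ ih1 _ ih2].
  + apply: trig_eq (trig_half (Trig_sin (k + l)) (Trig_sin (k - l))) _ => t.
    by rewrite !intrD mulrNz !mulrDl mulNr !sinD cosN sinN; field.
  + apply: trig_eq (trig_half (Trig_cos (k - l)) (trigN (Trig_cos (k + l)))) _ => t.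
    by rewrite !intrD mulrNz !mulrDl mulNr !cosD cosN sinN; field.
  + by apply: trig_eq (Trig_lin c ih1 ih2) _ => t; ring.
- by apply: trig_eq (Trig_lin c (ih1 q tq) (ih2 q tq)) _ => t; ring.
Qed.

Lemma trigX p n : trigonometric p -> trigonometric (fun t => p t ^+ n).
Proof.
move=> tp; elim: n => [|n ih].
  by apply: trig_eq (trig_cst 1) _ => t; rewrite expr0.
by apply: trig_eq (trigM tp ih) _ => t; rewrite exprS.
Qed.

Lemma trig_measurable p : trigonometric p -> measurable_fun setT p.
Proof.
elim=> [k|k|c p1 p2 _ m1 _ m2].
- apply: (measurableT_comp (f := cos)); last exact: measurable_funM.
  by apply: continuous_measurable_fun; exact: continuous_cos.
- apply: (measurableT_comp (f := sin)); last exact: measurable_funM.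
  by apply: continuous_measurable_fun; exact: continuous_sin.
- by apply: measurable_funD => //; exact: measurable_funM.
Qed.

Lemma trig_bounded p : trigonometric p -> exists M, forall t, `|p t| <= M.
Proof.
elim=> [k|k|c p1 p2 _ [M1 b1] _ [M2 b2]].
- by exists 1 => t; exact: cos_max.
- by exists 1 => t; exact: sin_max.
- exists (`|c| * M1 + M2) => t; apply: le_trans (ler_normD _ _) _.
  by rewrite normrM lerD// ler_wpM2l.
Qed.

Lemma trig_mul_integrable p h (D : set R) : measurable D -> trigonometric p ->
  mu.-integrable D (EFin \o h) -> mu.-integrable D (EFin \o (fun t => p t * h t)).
Proof.
move=> mD tp hi; have [M bM] := trig_bounded tp.
have := @integrableMr _ _ _ mu D mD p (EFin \o h).
apply => //; first by apply: measurable_funTS; exact: trig_measurable.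
exists M; split; first exact: num_real.
by move=> N MN t _ /=; apply: le_trans (bM t) (ltW MN).
Qed.

Lemma trig_ortho p h (D : set R) : measurable D -> mu.-integrable D (EFin \o h) ->
  (forall n : nat, \int[mu]_(t in D) (cos (n%:R * t) * h t) = 0) ->
  (forall n : nat, \int[mu]_(t in D) (sin (n%:R * t) * h t) = 0) ->
  trigonometric p -> \int[mu]_(t in D) (p t * h t) = 0.
Proof.
move=> mD hi hc hs; elim=> [k|k|c p1 p2 t1 e1 t2 e2].
- case: k => n; first exact: hc.
  rewrite -[RHS](hc n.+1); apply: eq_Rintegral => t _.
  by rewrite NegzE mulrNz mulNr cosN.
- case: k => n; first exact: hs.
  transitivity (\int[mu]_(t in D) (- 1 * (sin (n.+1%:R * t) * h t))).
    by apply: eq_Rintegral => t _; rewrite NegzE mulrNz [in LHS]mulNr sinN; ring.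
  rewrite RintegralZl//; last exact: (trig_mul_integrable mD (Trig_sin n.+1)).
  by rewrite hs mulr0.
- have i1 := trig_mul_integrable mD t1 hi; have i2 := trig_mul_integrable mD t2 hi.
  have i1' := @integrableZl _ _ _ mu _ mD c _ i1.
  transitivity (\int[mu]_(t in D) (c * (p1 t * h t) + p2 t * h t)).
    by apply: eq_Rintegral => t _; ring.
  by rewrite RintegralD// RintegralZl// e1 e2 mulr0 addr0.
Qed.

(** The arc from 0 to [x] is centred at [x / 2], and [cos (t - x / 2)] compares the angular distance
    of [t] to the centre with the half-width [x / 2]. When [t - x / 2] exceeds [pi] it is first
    reflected to [2 * pi - (t - x / 2)]. *)
Lemma cos_arc x t : 0 < x < 2 * pi -> 0 < t < 2 * pi ->
  (cos (t - x / 2) < cos (x / 2)) = (x < t).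
Proof.
move=> /andP[x0 x2] /andP[t0 t2].
have X : x / 2 \in `[0, pi] by rewrite in_itv/=; apply/andP; split; lra.
have [tx|tx] := leP t (x / 2).
  have -> : cos (t - x / 2) = cos (x / 2 - t) by rewrite -cosN opprB.
  rewrite ltr_cos//; last by rewrite in_itv/=; apply/andP; split; lra.
  by apply/idP/idP; lra.
have [ty|ty] := leP (t - x / 2) pi.
  rewrite ltr_cos//; last by rewrite in_itv/=; apply/andP; split; lra.
  by apply/idP/idP; lra.
have -> : cos (t - x / 2) = cos (2 * pi - (t - x / 2)).
  by rewrite -(cosN (2 * pi - _)) opprB -(cosD2pi (_ - 2 * pi)) mulr2n; congr cos; ring.
rewrite ltr_cos//; last by rewrite in_itv/=; apply/andP; split; lra.
by apply/idP/idP; lra.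
Qed.

(** Composing the step polynomials with a trigonometric polynomial that crosses 1/2 at [x] gives
    trigonometric polynomials bounded by 1 and converging pointwise to the indicator of [t > x];
    dominated convergence applies. *)
Lemma arc_integral0 h x : 0 < x < 2 * pi -> mu.-integrable To (EFin \o h) ->
  (forall p, trigonometric p -> \int[mu]_(t in To) (p t * h t) = 0) ->
  \int[mu]_(t in To) ((x < t)%R%:R * h t) = 0.
Proof.
move=> x0 hi ho.
(* The difference of cosines lies in [[-2, 2]]; a quarter of it plus 1/2 lies in [[0, 1]] and is
   below 1/2 exactly when the difference is negative. *)
pose y t : R := 2^-1 * (1 + 2^-1 * (cos (t - x / 2) - cos (x / 2))).
have y01 t : 0 <= y t <= 1.
  have := cos_le1 (t - x / 2); have := cos_geN1 (t - x / 2).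
  have := cos_le1 (x / 2); have := cos_geN1 (x / 2).
  by rewrite /y => *; apply/andP; split; lra.
have ty : trigonometric y.
  have tc : trigonometric (fun t => cos (t - x / 2)).
    apply: trig_eq (Trig_lin (cos (x / 2)) (Trig_cos 1) (trigZ (sin (x / 2)) (Trig_sin 1))) _ => t.
    by rewrite !mul1r cosB; ring.
  apply: trig_eq (Trig_lin 4^-1 tc (trig_cst (2^-1 - 4^-1 * cos (x / 2)))) _ => t.
  by rewrite /y; field.
pose f n t : R := (1 - (y t ^+ n) ^+ 2) ^+ (n.+1 * 4 ^ n).
have tf n : trigonometric (f n).
  apply: trigX; apply: trig_eq (Trig_lin (-1) (trigX 2 (trigX n ty)) (trig_cst 1)) _ => t.
  by ring.
have mTo : measurable To by exact: measurable_itv.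
have mh : measurable_fun To h by apply/measurable_EFinP; exact: measurable_int hi.
apply: (@Rintegral_dct0 _ _ _ mu To mTo (fun n t => f n t * h t) _ (fun t => `|h t|)).
- by move=> n; apply: measurable_funM => //; apply: measurable_funTS; exact: trig_measurable.
- move=> t; rewrite /= in_itv/= => t0; apply: cvgMl.
  rewrite -(cos_arc x0 t0).
  rewrite (_ : (cos _ < cos _) = (y t < 2^-1)); first exact: step_cvg.
  by rewrite /y; apply/idP/idP; lra.
- exact: integrable_norm hi.
- move=> n t _; rewrite normrM ler_piMl//.
  have /andP[y0 y1] := y01 t.
  have Y0 : 0 <= (y t ^+ n) ^+ 2 by exact: sqr_ge0.
  have Y1 : (y t ^+ n) ^+ 2 <= 1 by rewrite exprn_ile1 ?exprn_ge0// exprn_ile1.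
  by rewrite ger0_norm ?exprn_ge0 ?subr_ge0// exprn_ile1 ?subr_ge0// lerBlDr lerDl.
- by move=> n; exact: ho.
Qed.

(** Orthogonality to the constants and to all tails [t > x] makes every integral of [h] up to [x]
    vanish, so [h] is almost everywhere zero by Lebesgue differentiation. *)
Lemma fourier_uniqueness h : mu.-integrable Th (EFin \o h) ->
  (forall n : nat, \int[mu]_(t in Th) (cos (n%:R * t) * h t) = 0) ->
  (forall n : nat, \int[mu]_(t in Th) (sin (n%:R * t) * h t) = 0) ->
  {ae mu, forall t, Th t -> h t = 0}.
Proof.
move=> hi hc hs.
have mTh : measurable Th by exact: measurable_itv.
have mTo : measurable To by exact: measurable_itv.
have sub : To `<=` Th by exact: subset_itv_oo_co.
have hi' : mu.-integrable To (EFin \o h) by apply: integrableS hi.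
have ho p : trigonometric p -> \int[mu]_(t in To) (p t * h t) = 0.
  move=> tp; rewrite Rintegral_itv_obnd_cbnd; first exact: trig_ortho.
  exact: trig_mul_integrable.
have h0 : \int[mu]_(t in To) h t = 0.
  rewrite -[RHS](ho _ (trig_cst 1)); apply: eq_Rintegral => t _; by rewrite mul1r.
pose F := h \_ To.
have iF : mu.-integrable setT (EFin \o F).
  by rewrite /F -restrict_EFin; apply/integrable_restrict => //; rewrite setTI.
have F0 : {ae mu, forall t, F t = 0}.
  apply: Rintegral_itv_ae0 => // x.
  transitivity (\int[mu]_(t in To) ((t <= x)%R%:R * h t)).
    rewrite [LHS]Rintegral_mkcond [RHS]Rintegral_mkcond; apply: eq_Rintegral => t _.
    rewrite /F /patch !mem_setE !in_itv/=.
    by case: (leP t x) => _; case: ifP => _; rewrite ?mul1r ?mul0r.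
  have [x0|x0] := leP x 0.
    rewrite /Rintegral integral0_eq// => t; rewrite /= in_itv/= => /andP[t0 _].
    by rewrite leNgt (le_lt_trans x0 t0) mul0r.
  have [x2|x2] := leP (2 * pi) x.
    rewrite -[RHS]h0; apply: eq_Rintegral => t; rewrite inE/= in_itv/= => /andP[_ t2].
    by rewrite (ltW (lt_le_trans t2 x2)) mul1r.
  have x02 : 0 < x < 2 * pi by rewrite x0.
  have A := arc_integral0 x02 hi' ho.
  have iA : mu.-integrable To (EFin \o (fun t => (x < t)%R%:R * h t)).
    have iI : mu.-integrable To (EFin \o (h \_ `]x, +oo[%classic)).
      rewrite -restrict_EFin; apply/integrable_restrict => //.
      by apply: integrableS hi' => //; exact: measurableI.
    apply: eq_integrable iI => // t _.
    by rewrite /= /patch mem_setE in_itv/= andbT; case: (x < t); rewrite ?mul1r ?mul0r.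
  transitivity (\int[mu]_(t in To) h t - \int[mu]_(t in To) ((x < t)%R%:R * h t)).
    rewrite -RintegralB//; apply: eq_Rintegral => t _; rewrite leNgt.
    by case: (x < t) => /=; ring.
  by rewrite h0 A subrr.
(* The open interval lost the point 0 of [Th], a null set. *)
have F1 : {ae mu, forall t : R, t != 0}.
  exists [set 0]; split => //; first exact: lebesgue_measure_set1.
  by move=> t /=; case: eqP.
apply: (@filterS2 _ _ (ae_filter_ringOfSetsType mu) _ _ _ _ F0 F1) => t + t0 tT.
rewrite /F /patch mem_setE in_itv/=.
by move: tT; rewrite /= in_itv/= le_eqVlt eq_sym (negPf t0)/= => ->.
Qed.

End FourierUniqueness.

(** * Slices and angular Fourier coefficients of functions on the surface *)

Section Slices.
Context {R : realType}.
Implicit Types (f u : R * R -> R) (e : R -> R) (x t alpha : R).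
Notation mu := (@lebesgue_measure R).
Notation Th := (`[0%R, 2 * pi[%classic : set R).

Let mTh : measurable Th. Proof. exact: measurable_itv. Qed.

Lemma patch_Mdom f x t : Rdom x -> (f \_ Mdom) (x, t) = ((fun s => f (x, s)) \_ Th) t.
Proof. by move=> Rx; rewrite /patch MdomE in_setX mem_set. Qed.

Lemma measurable_slice f x : measurable_fun Mdom f -> Rdom x ->
  measurable_fun Th (fun t => f (x, t)).
Proof.
move=> mf Rx.
have mF : measurable_fun setT (f \_ Mdom).
  apply/measurable_restrict => //; first exact: measurable_Mdom.
  by rewrite setTI.
have ms := measurable_fun_pair2 x mF.
apply: eq_measurable_fun (measurable_funTS ms) => t tT.
by rewrite patch_Mdom// /patch tT.
Qed.

(** Integrability is not assumed: the integrals of the positive and negative parts are measurable by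
    Tonelli, and so is the [fine] of their difference. *)
Lemma measurable_partial f : measurable_fun Mdom f ->
  measurable_fun Rdom (fun x => \int[mu]_(t in Th) f (x, t)).
Proof.
move=> mf; pose F := f \_ Mdom.
have mF : measurable_fun setT (EFin \o F).
  apply/measurable_EFinP/measurable_restrict => //; first exact: measurable_Mdom.
  by rewrite setTI.
have mp := measurable_fun_fubini_tonelli_F (m2 := mu) (EFin \o F)^\+%E
  (measurable_funepos mF) (funepos_ge0 _).
have mn := measurable_fun_fubini_tonelli_F (m2 := mu) (EFin \o F)^\-%E
  (measurable_funeneg mF) (funeneg_ge0 _).
have mB := emeasurable_funB mp mn.
have md := @measurable_funTS _ _ _ _ (@Rdom R) _ mB.
have mfine : measurable_fun Rdom (fine \o (fun x => (\int[mu]_t ((EFin \o F)^\+ (x, t)) -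
    \int[mu]_t ((EFin \o F)^\- (x, t)))%E)) by exact: measurableT_comp md.
apply: eq_measurable_fun mfine => x; rewrite inE => Rx /=.
rewrite [RHS]Rintegral_mkcond [RHS]/Rintegral [in RHS]integralE; congr (fine (_ - _)%E).
  by apply: eq_integral => t _; rewrite !funeposE /= -patch_Mdom.
by apply: eq_integral => t _; rewrite !funenegE /= -patch_Mdom.
Qed.

Lemma ae_slice_integrable f : Mmeasure.-integrable Mdom (EFin \o f) ->
  {ae mu, forall x, Rdom x -> mu.-integrable Th (EFin \o (fun t => f (x, t)))}.
Proof.
move=> fi; have mM := @measurable_Mdom R.
have iF : (mu \x mu)%E.-integrable setT (EFin \o (f \_ Mdom)).
  rewrite -restrict_EFin; apply/(integrable_restrict (mu \x mu)%E mM measurableT).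
  by rewrite setTI.
apply: aeS (ae_integrable1 iF) => x ix Rx.
have : mu.-integrable setT (EFin \o ((fun t => f (x, t)) \_ Th)).
  by apply: eq_integrable ix => // t _; rewrite /= patch_Mdom.
rewrite -restrict_EFin => /(integrable_restrict mu mTh measurableT _).2.
by rewrite setTI.
Qed.

Lemma integrable_partial f : Mmeasure.-integrable Mdom (EFin \o f) ->
  mu.-integrable Rdom (EFin \o (fun x => \int[mu]_(t in Th) f (x, t))).
Proof.
move=> fi; have mM := @measurable_Mdom R.
have iF : (mu \x mu)%E.-integrable setT (EFin \o (f \_ Mdom)).
  rewrite -restrict_EFin; apply/(integrable_restrict (mu \x mu)%E mM measurableT).
  by rewrite setTI.
have mf : measurable_fun Mdom f by apply/measurable_EFinP; exact: measurable_int fi.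
apply/integrableP; split; first by apply/measurable_EFinP; exact: measurable_partial.
have iG := @integrableS _ _ _ mu _ _ _ measurableT (@measurable_Rdom R) (@subsetT _ _)
  (integrable_fubini_F iF).
have := integrable_abse iG => /integrableP[mG].
apply: le_lt_trans.
apply: (@ae_ge0_le_integral _ _ _ mu).
- exact: measurable_Rdom.
- by [].
- apply: measurableT_comp => //; apply/measurable_EFinP; exact: measurable_partial.
- by [].
- exact: measurableT_comp.
have := ae_slice_integrable fi; apply: aeS => x ix Rx.
rewrite abse_id /= /fubini_F.
rewrite (_ : (\int[mu]_y _)%E = (\int[mu]_(t in Th) (f (x, t))%:E)%E).
  have fk := @integrable_fin_num _ _ _ mu _ mTh _ (ix Rx).
  by rewrite -[X in (_ <= `|X|)%E](fineK fk).
rewrite [RHS]integral_mkcond; apply: eq_integral => t _ /=.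
by rewrite patch_Mdom// /patch; case: ifP.
Qed.

(** For fixed [x] the weight is a positive constant and can be divided out, which leaves the weight
    1 on the circle. *)
Lemma L2_slice alpha u : L2 Mmeasure Mdom (Mweight alpha) u ->
  {ae mu, forall x, Rdom x -> L2 mu Th (cst 1) (fun t => u (x, t))}.
Proof.
move=> Lu.
have iK := @L2_sq_integrable _ _ _ (mu \x mu)%E _ _ (@measurable_Mweight R alpha)
  (@Mweight_gt0 R alpha) _ Lu.
apply: aeS (ae_slice_integrable iK) => x ix Rx.
apply: sq_integrable_L2 => //; first by apply: measurable_slice => //; case: Lu.
have := @integrableZl _ _ _ mu _ mTh (Rweight alpha x)^-1 _ (ix Rx).
apply: eq_integrable => // t _ /=; rewrite -EFinM mulr1; congr EFin.
have := gt_eqF (Rweight_gt0 alpha Rx); rewrite /Mweight /Rweight /= => w0.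
by rewrite mulrC mulfK// w0.
Qed.

(** For [e] a cosine or a sine, the unnormalised real Fourier coefficient of [u] on the circle over
    [x]. *)
Definition angular_mode e u x := \int[mu]_(t in Th) (e t * u (x, t)).

End Slices.

Section AngularModes.
Context {R : realType}.
Implicit Types (u phi : R * R -> R) (e g psi : R -> R) (x t a b alpha A B : R) (n : nat).
Notation mu := (@lebesgue_measure R).
Notation isd x f a := (is_derive (x : R) (1 : R) (f : R -> R) (a : R)).
Notation Th := (`[0%R, 2 * pi[%classic : set R).

Let mTh : measurable Th. Proof. exact: measurable_itv. Qed.
Let mRd := @measurable_Rdom R.
Let mM := @measurable_Mdom R.

Lemma cont_L2_Th e : (forall t, {for t, continuous e}) -> L2 mu Th (cst 1) e.
Proof.
move=> ce; apply: sq_integrable_L2 => //.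
  by apply: measurable_funTS; apply: continuous_measurable_fun; exact: ce.
apply: cont_Th_integrable => t.
have c2 := cvgM (ce t) (ce t).
by apply: cvgM; [exact: c2|exact: cvg_cst].
Qed.

Lemma measurable_separated e u : (forall t, {for t, continuous e}) ->
  measurable_fun Mdom u -> measurable_fun Mdom (fun p : R * R => e p.2 * u p).
Proof.
move=> ce mu_; apply: measurable_funM => //; apply: measurable_funTS.
apply: (measurableT_comp (f := e)); last exact: measurable_snd.
by apply: continuous_measurable_fun; exact: ce.
Qed.

(** Cauchy-Schwarz on almost every circle bounds the square of the mode by [C] times the integral of
    [u^2] over that circle, and the latter is integrable in [x] by Fubini. *)
Lemma angular_mode_L2 alpha e u : (forall t, {for t, continuous e}) ->
  L2 Mmeasure Mdom (Mweight alpha) u -> L2 mu Rdom (Rweight alpha) (angular_mode e u).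
Proof.
move=> ce Lu.
have mu_ : measurable_fun Mdom u by case: Lu.
have mU : measurable_fun Rdom (angular_mode e u).
  exact: (measurable_partial (measurable_separated ce mu_)).
have iK := @L2_sq_integrable _ _ _ (mu \x mu)%E _ _ (@measurable_Mweight R alpha)
  (@Mweight_gt0 R alpha) _ Lu.
pose K x := \int[mu]_(t in Th) (u (x, t) ^+ 2 * Mweight alpha (x, t)).
have iKp : mu.-integrable Rdom (EFin \o K) := integrable_partial iK.
pose C := ip mu Th (cst 1) e e.
have C0 : 0 <= C by apply: ip_ge0.
have iCK := @integrableZl _ _ _ mu _ mRd C _ iKp.
apply: sq_integrable_L2 => //.
have mf : measurable_fun Rdom (fun x => angular_mode e u x ^+ 2 * Rweight alpha x).
  by apply: measurable_funM; [exact: measurable_funX|exact: measurable_Rweight].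
apply/integrableP; split; first exact/measurable_EFinP.
have /integrableP[mCK] := iCK; apply: le_lt_trans.
apply: (@ae_ge0_le_integral _ _ _ mu) => //.
- by apply: measurableT_comp => //; exact/measurable_EFinP.
- exact: measurableT_comp.
have Lua := L2_slice Lu; have iKa := ae_slice_integrable iK.
apply: (@filterS2 _ _ (ae_filter_ringOfSetsType mu) _ _ _ _ Lua iKa) => x Lx ix Rx.
have w0 := Rweight_gt0 alpha Rx.
have one0 : forall t, Th t -> 0 < cst (1 : R) t by move=> t _; exact: ltr01.
have m1 : measurable_fun Th (cst (1 : R)) by exact: measurable_cst.
have Le := cont_L2_Th ce.
have := @cauchy_schwarz _ _ _ mu Th (cst 1) mTh m1 one0 _ _ Le (Lx Rx).
have -> : ip mu Th (cst 1) e (fun t => u (x, t)) = angular_mode e u x.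
  by apply: eq_Rintegral => t _; rewrite mulr1.
rewrite -/C => CS.
have iu := @L2_mul_integrable _ _ _ mu Th (cst 1) mTh m1 one0 _ _ (Lx Rx) (Lx Rx).
have KE : K x = ip mu Th (cst 1) (fun t => u (x, t)) (fun t => u (x, t)) * Rweight alpha x.
  rewrite /ip -RintegralZr//; apply: eq_Rintegral => t _.
  by rewrite mulr1 expr2.
have Uw0 : 0 <= angular_mode e u x ^+ 2 * Rweight alpha x.
  by rewrite mulr_ge0 ?sqr_ge0//; exact: ltW.
have W : angular_mode e u x ^+ 2 * Rweight alpha x <= C * K x.
  by rewrite KE mulrA ler_pM2r.
by rewrite -EFinM !abse_EFin lee_fin !ger0_norm// (le_trans Uw0).
Qed.

Lemma angular_mode_pairing alpha a b g e u : 0 < a -> supp a b g ->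
  (forall x, x != 0 -> {for x, continuous g}) -> (forall t, {for t, continuous e}) ->
  L2 Mmeasure Mdom (Mweight alpha) u ->
  ip Mmeasure Mdom (Mweight alpha) (fun p => g p.1 * e p.2) u =
  ip mu Rdom (Rweight alpha) g (angular_mode e u).
Proof.
move=> a0 s cg ce Lu.
have mu_ : measurable_fun Mdom u by case: Lu.
have mg : measurable_fun Rdom g by exact: measurable_punctured.
have Lge : L2 Mmeasure Mdom (Mweight alpha) (fun p => g p.1 * e p.2).
  apply: (@supp2_L2 _ alpha a b) => // [p hp|p p0]; first by rewrite s ?mul0r.
  have c1 : {for p, continuous (fun q : R * R => g q.1)} by apply: cont_fst; exact: cg.
  have c2 : {for p, continuous (fun q : R * R => e q.2)}.
    by apply: (@cvg_comp _ _ _ snd e (nbhs p) (nbhs p.2)); [exact: cvg_snd|exact: ce].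
  exact: (cont2M c1 c2).
have i1 := @L2_mul_integrable _ _ _ (mu \x mu)%E _ _ mM (@measurable_Mweight R alpha)
  (@Mweight_gt0 R alpha) _ _ Lge Lu.
apply: etrans (Rintegral_Mdom12 i1) _; congr fine.
apply: ae_eq_integral => //.
- apply/measurable_EFinP.
  apply: (measurable_partial (f := fun p => g p.1 * e p.2 * u p * Mweight alpha p)).
  by apply/measurable_EFinP; exact: measurable_int i1.
- apply/measurable_EFinP; apply: measurable_funM; last exact: measurable_Rweight.
  apply: measurable_funM => //.
  exact: (measurable_partial (measurable_separated ce mu_)).
apply: aeS (L2_slice Lu) => x Lx Rx; congr EFin.
have one0 : forall t, Th t -> 0 < cst (1 : R) t by move=> t _; exact: ltr01.
have m1 : measurable_fun Th (cst (1 : R)) by exact: measurable_cst.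
have iu := @L2_mul_integrable _ _ _ mu Th (cst 1) mTh m1 one0 _ _ (cont_L2_Th ce) (Lx Rx).
transitivity (\int[mu]_(t in Th) ((g x * Rweight alpha x) * (e t * u (x, t) * 1))).
  by apply: eq_Rintegral => t _; rewrite /Mweight /Rweight /=; ring.
rewrite RintegralZl//.
have -> : \int[mu]_(t in Th) (e t * u (x, t) * 1) = angular_mode e u x.
  by apply: eq_Rintegral => t _; rewrite mulr1.
by ring.
Qed.

(** Keeping both coefficients makes the family stable under differentiation, [(A, B)] becoming
    [(n B, - n A)]; smoothness is then an induction. *)
Definition emode n A B t : R := A * cos (n%:R * t) + B * sin (n%:R * t).

Lemma emode_isd n A B t : isd t (emode n A B) (emode n (n%:R * B) (- n%:R * A) t).
Proof.
have dn : isd t (fun t => n%:R * t) n%:R.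
  by apply: isd_eq (isdZ n%:R (isd_id t)) _; rewrite mulr1.
apply: isd_eq (isdD (isdZ A (isd_comp (is_derive_cos _) dn))
  (isdZ B (isd_comp (is_derive_sin _) dn))) _.
by rewrite /emode; ring.
Qed.

Lemma emode_der n A B : derive1 (emode n A B) = emode n (n%:R * B) (- n%:R * A).
Proof. by apply/funext => t; exact: isd_val (emode_isd n A B t). Qed.

Lemma emode_der2 n A B : derive1 (derive1 (emode n A B)) = fun t => - n%:R ^+ 2 * emode n A B t.
Proof. by rewrite !emode_der; apply/funext => t; rewrite /emode; ring. Qed.

Lemma emode_cont n A B t : {for t, continuous (emode n A B)}.
Proof. exact: isd_continuous (emode_isd n A B t). Qed.

Lemma emode_smooth n A B : smooth1 (emode n A B).
Proof.
move=> k; elim: k A B => [|k ih] A B; first by move=> t; exact: emode_cont.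
split; [by move=> t; exact: emode_cont|by move=> t; exact: isd_ex (emode_isd n A B t)|].
by rewrite emode_der.
Qed.

Lemma emode_periodic n A B t : emode n A B (t + 2 * pi) = emode n A B t.
Proof.
rewrite /emode mulrDr; have -> : n%:R * (2 * pi) = (pi *+ 2) *+ n :> R.
  by rewrite mulr_natl [2 * pi]mulr_natl.
by rewrite (periodicn (@cosD2pi R)) (periodicn (@sinD2pi R)).
Qed.

Lemma dx_separated psi e : smooth1 psi ->
  dx (fun p : R * R => psi p.1 * e p.2) = fun p => derive1 psi p.1 * e p.2.
Proof.
move=> s; apply/funext => p; rewrite /dx /=; apply: isd_val.
have d : isd p.1 psi (derive1 psi p.1) by apply: derivable_isd; case: (s 1%N).
by apply: isd_eq (isdM d (isd_cst _ (e p.2))) _; rewrite mulr0 addr0.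
Qed.

Lemma dth_separated psi e : smooth1 e ->
  dth (fun p : R * R => psi p.1 * e p.2) = fun p => psi p.1 * derive1 e p.2.
Proof.
move=> s; apply/funext => p; rewrite /dth /=; apply: isd_val.
have d : isd p.2 e (derive1 e p.2) by apply: derivable_isd; case: (s 1%N).
exact: isdZ d.
Qed.

Lemma smooth1_der psi : smooth1 psi -> smooth1 (derive1 psi).
Proof. by move=> s k; case: (s k.+1). Qed.

Lemma separated_smooth psi e : smooth1 psi -> smooth1 e ->
  smooth2 (fun p : R * R => psi p.1 * e p.2).
Proof.
have cc psi' e' : smooth1 psi' -> smooth1 e' -> continuous (fun p : R * R => psi' p.1 * e' p.2).
  move=> s1 s2 p.
  have c1 : {for p, continuous (fun q : R * R => psi' q.1)}.
    by apply: cont_fst; exact: (s1 0%N).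
  have c2 : {for p, continuous (fun q : R * R => e' q.2)}.
    by apply: (@cvg_comp _ _ _ snd e' (nbhs p) (nbhs p.2)); [exact: cvg_snd|exact: (s2 0%N)].
  exact: (cont2M c1 c2).
move=> + + k; elim: k psi e => [|k ih] psi e s1 s2; first exact: cc.
split; first exact: cc.
- move=> p; have d : isd p.1 psi (derive1 psi p.1) by apply: derivable_isd; case: (s1 1%N).
  exact: isd_ex (isdM d (isd_cst _ (e p.2))).
- move=> p; have d : isd p.2 e (derive1 e p.2) by apply: derivable_isd; case: (s2 1%N).
  exact: isd_ex (isdZ (psi p.1) d).
- by rewrite (dx_separated e s1); apply: ih => //; exact: smooth1_der.
- by rewrite (dth_separated psi s2); apply: ih => //; exact: smooth1_der.
Qed.

Lemma separated_CcM psi n A B : Cc1 psi -> CcM (fun p => psi p.1 * emode n A B p.2).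
Proof.
move=> [s [a [b [a0 h]]]]; split.
- exact: separated_smooth s (emode_smooth n A B).
- by move=> x t /=; rewrite emode_periodic.
- by exists a, b; split => // p; rewrite mulf_eq0 negb_or => /andP[/h].
Qed.

Lemma LB_separated alpha psi n A B : Cc1 psi ->
  LB alpha (fun p => psi p.1 * emode n A B p.2) =
  fun p => (derive1 (derive1 psi) p.1 - alpha / p.1 * derive1 psi p.1
    - n%:R ^+ 2 * `|p.1| `^ (2 * alpha) * psi p.1) * emode n A B p.2.
Proof.
move=> [s _]; have s' := smooth1_der s; have e := emode_smooth n A B.
have e' := smooth1_der e.
rewrite /LB; apply/funext => p.
rewrite (dx_separated _ s) (dx_separated _ s') (dth_separated _ e) (dth_separated _ e').
rewrite emode_der2.
move: (derive1 (derive1 psi) p.1) (derive1 psi p.1) (psi p.1) (emode n A B p.2) => *.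
by ring.
Qed.

Section Kernel.
Variables (alpha : R) (u : R * R -> R).
Hypothesis hyp : alpha <= -3 \/ 1 <= alpha.
Hypothesis Lu : L2 Mmeasure Mdom (Mweight alpha) u.
Hypothesis weak : forall phi, CcM phi ->
  ip Mmeasure Mdom (Mweight alpha) (LB alpha phi \- phi) u = 0.

(** Testing the equation for [u] on products of a radial test function and an angular mode gives the
    one-dimensional equation with frequency [n], so the mode has norm zero by the punctured-line
    kernel. *)
Lemma angular_mode_eq0 n A B :
  {ae mu, forall x, Rdom x -> angular_mode (emode n A B) u x = 0}.
Proof.
set e := emode n A B; set U := angular_mode e u.
have ce t : {for t, continuous e} by exact: emode_cont.
have LU : L2 mu Rdom (Rweight alpha) U by exact: angular_mode_L2.
have U0 : ip mu Rdom (Rweight alpha) U U = 0.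
  apply: (@punctured_kernel _ alpha (n%:R ^+ 2)) => //.
  - by case: hyp => ?; [left|right; left].
  - move=> psi cpsi; have [a [b [a0 s]]] := Cc1_supp cpsi.
    pose g x := derive1 (derive1 psi) x - alpha / x * derive1 psi x
      - (n%:R ^+ 2 * `|x| `^ (2 * alpha) + 1) * psi x.
    have sg : supp a b g.
      move=> x hx; rewrite /g (supp_der s)// (supp_der (supp_der s))// s//.
      by rewrite !mulr0 !subr0.
    have cg x : x != 0 -> {for x, continuous g}.
      move=> x0; apply: cvgB.
        apply: cvgB; first exact: (@Cc1_cont2 _ psi).
        apply: cvgM; last exact: isd_continuous (Cc1_isd2 cpsi x).
        apply: cvgM; first exact: cvg_cst.
        exact: isd_continuous (isdV x0 (isd_id x)).
      apply: cvgM; last exact: isd_continuous (Cc1_isd cpsi x).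
      apply: cvgD; last exact: cvg_cst.
      by apply: cvgM; [exact: cvg_cst|exact: norm_powR_cont].
    have := weak (separated_CcM n A B cpsi).
    rewrite (LB_separated alpha n A B cpsi) => E.
    transitivity (ip mu Rdom (Rweight alpha) g U) => //.
    rewrite -(angular_mode_pairing a0 sg cg ce Lu) -[RHS]E.
    apply: eq_Rintegral => p _; rewrite /g /e /=.
    by move: (derive1 (derive1 psi) p.1) (derive1 psi p.1) => *; ring.
have mU : measurable_fun Rdom U by case: LU.
have mw := @measurable_Rweight R alpha.
have i0 : (\int[mu]_(x in Rdom) `|(U x ^+ 2 * Rweight alpha x)%:E| = 0)%E.
  have := @EFin_ip _ _ _ mu _ _ mRd mw (@Rweight_gt0 R alpha) _ LU; rewrite U0 => E.
  rewrite [RHS]E; apply: eq_integral => x; rewrite inE => Rx.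
  by rewrite gee0_abs// lee_fin mulr_ge0 ?sqr_ge0// (ltW (Rweight_gt0 _ Rx)).
have mf : measurable_fun Rdom (fun x => (U x ^+ 2 * Rweight alpha x)%:E).
  by apply/measurable_EFinP; apply: measurable_funM => //; exact: measurable_funX.
have := (@ae_eq_integral_abs _ _ _ mu _ mRd _ mf).1 i0.
apply: aeS => x h Rx; have [/eqP] := h Rx.
by rewrite mulf_eq0 (gt_eqF (Rweight_gt0 alpha Rx)) orbF sqrf_eq0 => /eqP.
Qed.

(** For almost every [x] all Fourier coefficients of the slice [u (x, .)] vanish, so the slice is
    zero almost everywhere and contributes nothing to the norm. *)
Lemma LB_kernel : ip Mmeasure Mdom (Mweight alpha) u u = 0.
Proof.
have i1 := @L2_mul_integrable _ _ _ (mu \x mu)%E _ _ mM (@measurable_Mweight R alpha)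
  (@Mweight_gt0 R alpha) _ _ Lu Lu.
apply: etrans (Rintegral_Mdom12 i1) _.
rewrite -[RHS](_ : \int[mu]_(x in Rdom) 0 = 0); last by rewrite /Rintegral integral0.
congr fine; apply: ae_eq_integral => //.
  apply/measurable_EFinP; apply: (measurable_partial (f := fun p => u p * u p * Mweight alpha p)).
  by apply/measurable_EFinP; exact: measurable_int i1.
(* There are countably many modes, so one null set of [x] serves all of them. *)
have c0 : {ae mu, forall x, forall n, Rdom x -> angular_mode (emode n 1 0) u x = 0}.
  by apply: ae_foralln => n; exact: angular_mode_eq0.
have s0 : {ae mu, forall x, forall n, Rdom x -> angular_mode (emode n 0 1) u x = 0}.
  by apply: ae_foralln => n; exact: angular_mode_eq0.
have cs := @filterS2 _ _ (ae_filter_ringOfSetsType mu) _ _ _ (fun x h1 h2 => conj h1 h2) c0 s0.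
apply: (@filterS2 _ _ (ae_filter_ringOfSetsType mu) _ _ _ _ cs (L2_slice Lu)).
move=> x [hc hs] Lx Rx; congr EFin.
have one0 : forall t, Th t -> 0 < cst (1 : R) t by move=> t _; exact: ltr01.
have m1 : measurable_fun Th (cst (1 : R)) by exact: measurable_cst.
have iu : mu.-integrable Th (EFin \o (fun t => u (x, t))).
  have L1 : L2 mu Th (cst 1) (cst 1) by apply: cont_L2_Th => t; exact: cvg_cst.
  have := @L2_mul_integrable _ _ _ mu Th (cst 1) mTh m1 one0 _ _ L1 (Lx Rx).
  by apply: eq_integrable => // t _; rewrite /= mul1r mulr1.
have u0 : {ae mu, forall t, Th t -> u (x, t) = 0}.
  apply: fourier_uniqueness => // n.
  - rewrite -[RHS](hc n Rx); apply: eq_Rintegral => t _.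
    by rewrite /emode mul1r mul0r addr0.
  - rewrite -[RHS](hs n Rx); apply: eq_Rintegral => t _.
    by rewrite /emode mul1r mul0r add0r.
transitivity (\int[mu]_(t in Th) (0 : R)); last by rewrite /Rintegral integral0.
congr fine; apply: ae_eq_integral => //.
  apply/measurable_EFinP.
  apply: (measurable_slice (f := fun p => u p * u p * Mweight alpha p)) => //.
  by apply/measurable_EFinP; exact: measurable_int i1.
by apply: aeS u0 => t h tT; rewrite h// !mul0r.
Qed.

End Kernel.

Lemma LB_ess_self_adjoint alpha : alpha <= -3 \/ 1 <= alpha -> LB_ess_sa alpha.
Proof.
move=> hyp; apply: ess_self_adjoint_crit.
- exact: measurable_Mdom.
- exact: measurable_Mweight.
- exact: Mweight_gt0.
- exact: CcM_L2.
- by move=> phi; exact: LB_L2.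
- exact: CcM_zero.
- exact: CcM_lin.
- by move=> a phi psi; exact: LB_lin.
- by move=> phi psi; exact: LB_sym.
- by move=> phi; exact: LB_le0.
- by move=> u Lu h; exact: LB_kernel.
Qed.

End AngularModes.

Theorem mainTheorem3 (R : realType) (alpha : R) :
  [/\ (alpha <= -3 -> LB_ess_sa alpha),
      (-3 < alpha <= -1 ->
         [/\ ~ LBk_ess_sa alpha 0,
             (forall k : int, k != 0 -> LBk_ess_sa alpha k) &
             ~ LB_ess_sa alpha]),
      (-1 < alpha < 1 -> forall k : int, ~ LBk_ess_sa alpha k) &
      (1 <= alpha -> LB_ess_sa alpha)].
Proof.
split.
- by move=> h; apply: LB_ess_self_adjoint; left.
- move=> /andP[a3 a1].
  have a31 : -3 < alpha < 1 by rewrite a3 /=; lra.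
  have lc : limit_circle alpha (0 ^+ 2) by apply: limit_circleP => //; left.
  split.
  + exact: limit_circle_not_ess_sa.
  + by move=> k k0; apply: LBk_ess_self_adjoint; right; right.
  + by apply: limit_circle_LB_not_ess_sa; move: lc; rewrite expr0n.
- move=> /andP[a1 b1] k; apply: limit_circle_not_ess_sa; apply: limit_circleP.
    by rewrite b1 andbT; lra.
  by right.
- by move=> h; apply: LB_ess_self_adjoint; right.
Qed.
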